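(* Let $f:\mathbb{R}^d\to\mathbb{R}$ be differentiable with minimizer $x^*\in\arg\min_{x\in\mathbb{R}^d}f(x)$, let $x^0\in\mathbb{R}^d$, $R>0$, $R\ge\|x^0-x^*\|$, and $Q=B_{3R}(x^* )$. Suppose that for some $L>0$, $\mu>0$ and all $x,y\in Q$: $\|\nabla f(x)-\nabla f(y)\|\le L\|x-y\|$, $\|\nabla f(x)\|^2\le2L(f(x)-\inf_Qf)$, and $f(y)\ge f(x)+\langle\nabla f(x),y-x\rangle+\frac\mu2\|x-y\|^2$. Let $\varepsilon>0$, $\delta\in(0,1]$ and let R-clipped-SSTM run clipped-SSTM $\tau$ times, where \[ \tau=\left\lceil\log_2\frac{\mu R^2}{2\varepsilon}\right\rceil\ge1,\qquad R_{t}=\frac R{2^{t/2}},\qquad\varepsilon_t=\frac{\mu R_{t-1}^2}4 . \] Assume that the estimator $\nabla f_{\Xi^{k,t}}(x^{k+1,t})$ used in clipped-SSTM at the $k$-th iteration of stage $t$ has bias at most $b_k^t$ and variance at most $(\sigma_k^t)^2$ (in the sense given in the context), with \[ b_k^t\le\frac{15\mu R}{24\cdot2^{t+1}}, \] and put $b_t=\max_kb_k^t$, $\sigma^t=\max_k\sigma_k^t$, $\sigma=\max_{1\le t\le\tau}\sigma^t$. Let, for $t=1,\dots,\tau$, \[ K_t=\left\lceil\max\left\{2160\sqrt{\frac{LR_{t-1}^2}{\varepsilon_t}}\ln\frac{4320\sqrt{LR_{t-1}^2}\,\tau}{\sqrt{\varepsilon_t}\,\delta},\ 4\left(\frac{5400\sigma^tR_{t-1}}{\varepsilon_t}\right)^2\ln\left(\frac{8\tau}\delta\left(\frac{5400\sigma^tR_{t-1}}{\varepsilon_t}\right)^2\right)\right\}\right\rceil,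 \] \[ a_t=\max\left\{97200\ln^2\frac{4K_t\tau}\delta,\ \frac{1800\sigma^t(K_t+1)\sqrt{K_t}\sqrt{\ln\frac{4K_t\tau}\delta}}{LR_{t-1}},\ \frac{4b_t(K_t+2)^2}{15LR_{t-1}},\ \frac{60b_t(K_t+2)\ln\frac{4K_t}\delta}{LR_{t-1}}\right\}, \] \[ \lambda_k^t=\frac{R_{t-1}}{30\alpha_{k+1}^t\ln\frac{4K_t\tau}\delta}. \] Then, to guarantee $f(\hat x^\tau)-f(x^* )\le\varepsilon$ with probability at least $1-\delta$, R-clipped-SSTM requires \[ \sum_{t=1}^\tau K_t=\mathcal{O}\left(\max\left\{\sqrt{\frac L\mu}\ln\left(\frac{\mu R^2}\varepsilon\right)\ln\left(\frac{\sqrt L}{\sqrt\mu\,\delta}\ln\left(\frac{\mu R^2}\varepsilon\right)\right),\ \frac{\sigma^2}{\mu\varepsilon}\ln\left(\frac{\sigma^2}{\mu\varepsilon\delta}\ln\left(\frac{\mu R^2}\varepsilon\right)\right)\right\}\right) \] iterations. Moreover, with probability at least $1-\delta$ the iterates of R-clipped-SSTM at stage $t$ stay in the ball $B_{2R_{t-1}}(x^* )$, $t=1,\dots,\tau$.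
   Context: $\|\cdot\|$ is the Euclidean norm; $B_r(x^* )$ is the ball of radius $r$ centred at $x^*$. $\mathrm{clip}(x,\lambda)=\min\{1,\lambda/\|x\|\}x$ for $x\ne0$, $\mathrm{clip}(0,\lambda)=0$. clipped-SSTM with stepsize parameter $a>0$, clipping levels $\lambda_0,\lambda_1,\dots$, starting point $x^0$: $z^0=y^0=x^0$, $\alpha_0=A_0=0$, $\alpha_{k+1}=\frac{k+2}{2aL}$, $A_{k+1}=A_k+\alpha_{k+1}$, and \[ x^{k+1}=\frac{A_ky^k+\alpha_{k+1}z^k}{A_{k+1}},\quad z^{k+1}=z^k-\alpha_{k+1}\mathrm{clip}(\nabla f_{\Xi^k}(x^{k+1}),\lambda_k),\quad y^{k+1}=\frac{A_ky^k+\alpha_{k+1}z^{k+1}}{A_{k+1}}, \] where $\nabla f_{\Xi^k}(x^{k+1})$ is sampled independently of previous iterations; the output after $K$ iterations is $y^K$. R-clipped-SSTM: set $\hat x^0=x^0$; for $t=1,\dots,\tau$ run clipped-SSTM for $K_t$ iterations with stepsize parameter $a_t$ (so $\alpha_{k+1}^t=\frac{k+2}{2a_tL}$), clipping levels $\{\lambda_k^t\}_{k=0}^{K_t-1}$ and starting point $\hat x^{t-1}$, and let $\hat x^t$ be its output. The output is $\hat x^\tau$. Bias/variance assumption with parameters $b,\sigma$: the estimator is obtained by applying an aggregation rule to some number $N$ of i.i.d. stochastic gradients from the oracle, $\nabla f_\Xi(x)=\mathcal{R}(\nabla f_{\xi_1}(x),\dots,\nabla f_{\xi_N}(x))$, and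 for every $x\in\mathbb{R}^d$: $\|\mathbb{E}[\nabla f_\Xi(x)]-\nabla f(x)\|\le b$ and $\mathbb{E}[\|\nabla f_\Xi(x)-\mathbb{E}[\nabla f_\Xi(x)]\|^2]\le\sigma^2$. $\mathcal{O}(\cdot)$ hides universal numerical constants, including inside the logarithms. Terms with $\sigma^t=0$ in the definition of $K_t$ are read as $0$. *)

(* Defs.v *)
From HB Require Import structures.
From mathcomp Require Import all_boot all_order all_algebra.
From mathcomp Require Import all_classical all_reals all_analysis.

Set Implicit Arguments.
Unset Strict Implicit.
Unset Printing Implicit Defensive.

Import Order.TTheory GRing.Theory Num.Theory.
Import numFieldNormedType.Exports.

Local Open Scope classical_set_scope.
Local Open Scope ring_scope.

Section Euclidean.
Context {R : realType} {d : nat}.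
Implicit Types (u v x : 'rV[R]_d) (f : 'rV[R]_d -> R).

Definition dot u v : R := \sum_i u 0 i * v 0 i.

(* The library norm `|u| on row vectors is the sup norm. *)
Definition enorm u : R := Num.sqrt (dot u u).

Definition eball (c : 'rV[R]_d) (r : R) : set 'rV[R]_d :=
  [set x | enorm (x - c) <= r].

Definition grad f x : 'rV[R]_d := \row_i 'D_(delta_mx 0 i) f x.

Definition clip x (lam : R) : 'rV[R]_d :=
  if x == 0 then 0 else Num.min 1 (lam / enorm x) *: x.

End Euclidean.

Definition log2 {R : realType} (x : R) : R := ln x / ln 2.

(* R^d with its Borel sigma-algebra. *)
Notation borel R d := (g_sigma_algebraType (@open 'rV[R]_d)).

Section Probability.
Context {dT : measure_display} {T : measurableType dT} {R : realType}.
Variable P : probability T R.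

Definition mean_vec {d : nat} (X : T -> 'rV[R]_d) : 'rV[R]_d :=
  \row_i fine ('E_P[fun w => X w 0 i]).

Definition bias_variance {d : nat} (f : 'rV[R]_d -> R)
    (g : 'rV[R]_d -> T -> 'rV[R]_d) (b sigma : R) : Prop :=
  forall x : 'rV[R]_d,
    [/\ forall i, P.-integrable [set: T] (fun w => (g x w 0 i)%:E),
        enorm (mean_vec (g x) - grad f x) <= b &
        ('E_P[fun w => (enorm (g x w - mean_vec (g x)) ^+ 2)%R]
           <= (sigma ^+ 2)%:E)%E].

Definition mutually_independent {dS : measure_display} {S : measurableType dS}
    {I : eqType} (A : set I) (X : I -> T -> S) : Prop :=
  forall s : seq I, uniq s -> (forall i, i \in s -> A i) ->
  forall B : I -> set S, (forall i, measurable (B i)) ->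
    P (\bigcap_(i in [set` s]) (X i @^-1` B i)) =
    (\prod_(i <- s) P (X i @^-1` B i))%E.

End Probability.

Section SSTM.
Context {R : realType} {d : nat}.
Local Notation V := 'rV[R]_d.

(* alpha_k, with alpha_0 = 0 *)
Definition alpha (a L : R) (k : nat) : R :=
  if k is k'.+1 then (k'.+2)%:R / (2 * a * L) else 0.

(* A_k *)
Definition alpha_sum (a L : R) (k : nat) : R := \sum_(j < k.+1) alpha a L j.

Record sstm_state := SstmState { sstm_x : V; sstm_y : V; sstm_z : V }.

(* State (x^k, y^k, z^k) after k iterations; g k x is the value returned by
   the estimator of iteration k at the query point x. *)
Fixpoint clipped_SSTM (a L : R) (lam : nat -> R) (g : nat -> V -> V) (x0 : V)
    (k : nat) : sstm_state :=
  if k is k'.+1 then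
    let s := clipped_SSTM a L lam g x0 k' in
    let al := alpha a L k'.+1 in
    let A := alpha_sum a L k' in
    let A' := alpha_sum a L k'.+1 in
    let x' := A'^-1 *: (A *: sstm_y s + al *: sstm_z s) in
    let z' := sstm_z s - al *: clip (g k' x') (lam k') in
    let y' := A'^-1 *: (A *: sstm_y s + al *: z') in
    SstmState x' y' z'
  else SstmState x0 x0 x0.

(* The output \hat x^t of stage t. *)
Fixpoint R_clipped_SSTM (K : nat -> nat) (a : nat -> R) (L : R)
    (lam : nat -> nat -> R) (g : nat -> nat -> V -> V) (x0 : V) (t : nat) : V :=
  if t is t'.+1 then
    sstm_y (clipped_SSTM (a t) L (lam t) (g t)
              (R_clipped_SSTM K a L lam g x0 t') (K t))
  else x0.

(* State of stage t >= 1 after k of its iterations. *)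
Definition stage_state (K : nat -> nat) (a : nat -> R) (L : R)
    (lam : nat -> nat -> R) (g : nat -> nat -> V -> V) (x0 : V) (t k : nat) :=
  clipped_SSTM (a t) L (lam t) (g t) (R_clipped_SSTM K a L lam g x0 t.-1) k.

End SSTM.

Section Stages.
Context {R : realType}.

(* R_t *)
Definition stage_radius (Rad : R) (t : nat) : R := Rad / 2 `^ (t%:R / 2).

(* epsilon_t *)
Definition stage_eps (mu Rad : R) (t : nat) : R :=
  mu * stage_radius Rad t.-1 ^+ 2 / 4.

(* The real number whose ceiling is K_t. Here ln 0 = 0, so the second entry of
   the maximum vanishes when sigma = 0. *)
Definition stage_iterations (L mu Rad delta : R) (tau t : nat) (sigma : R) : R :=
  let r := stage_radius Rad t.-1 in
  let e := stage_eps mu Rad t in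
  Num.max
    (2160 * Num.sqrt (L * r ^+ 2 / e) *
       ln (4320 * Num.sqrt (L * r ^+ 2) * tau%:R / (Num.sqrt e * delta)))
    (4 * (5400 * sigma * r / e) ^+ 2 *
       ln (8 * tau%:R / delta * (5400 * sigma * r / e) ^+ 2)).

(* a_t. The constant 97200 is written 972 * 100: ring literals are unary, and
   one that large overflows the stack. *)
Definition stage_stepparam (L Rad delta : R) (tau t K : nat) (b sigma : R) : R :=
  let r := stage_radius Rad t.-1 in
  let l := ln (4 * K%:R * tau%:R / delta) in
  Num.max (972 * 100 * l ^+ 2)
   (Num.max (1800 * sigma * K.+1%:R * Num.sqrt K%:R * Num.sqrt l / (L * r))
     (Num.max (4 * b * K.+2%:R ^+ 2 / (15 * L * r))
              (60 * b * K.+2%:R * ln (4 * K%:R / delta) / (L * r)))).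

(* lambda_k^t *)
Definition stage_clip (L Rad delta : R) (tau t K : nat) (a : R) (k : nat) : R :=
  stage_radius Rad t.-1 /
    (30 * alpha a L k.+1 * ln (4 * K%:R * tau%:R / delta)).

End Stages.

(* Main.v *)
Require Import Defs.
From HB Require Import structures.
From mathcomp Require Import all_boot all_order all_algebra.
From mathcomp Require Import all_classical all_reals all_analysis.
From mathcomp Require Import measurable_realfun.
From mathcomp Require Import ring lra.

Set Implicit Arguments.
Unset Strict Implicit.
Unset Printing Implicit Defensive.

Import Order.TTheory GRing.Theory Num.Theory.
Import numFieldNormedType.Exports.

Local Open Scope classical_set_scope.
Local Open Scope ring_scope.

(** Within one stage, started at distance at most r from the minimizer xs, let
    V_k = A_k (f(y^k) - f(xs)) + |z^k - xs|^2 / 2 and condition on the event that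
    the iterates have stayed in the ball of radius 2r. There the clipping level is
    at least twice the norm of the mean of the estimator, so a clipped estimate
    differs from its mean by a bounded noise whose moment generating function is
    controlled by the variance; the noise of iteration k is independent of the past,
    which turns this into an exponential supermartingale. Two processes are bounded
    in this way. The first, sqrt (2 V_k + r^2 / 100), moves under a bias b by at
    most about alpha_{k+1} b per step, and b A_K <= 15 r / 16; this keeps the
    iterates in the ball. V_K alone is too large to give the final accuracy because
    of this drift. The second process,
    p_k V_k - A_k <y^k - xs, z^k - xs> / 2 with weights p_k decreasing from 3 A_K / 2
    to A_K, uses strong convexity to absorb the bias, and at k = K it bounds
    f(y^K) - f(xs) by mu r^2 / 4. Chernoff's inequality and a union bound over the
    iterations give a failure probability (K_t + 1) exp (- l_t) <= delta / (2 tau),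
    where l_t = ln (4 K_t tau / delta). By quadratic growth a successful stage halves
    the squared distance to xs, so the stages chain. In the sum of the K_t the first
    entry of the maximum is the same for all stages, while the second ones are
    dominated by a geometric sum. *)

(** * Euclidean geometry and measurability *)

(** The bias moves V_k by al b |z^k - xs|, where al is the step size, and |z^k - xs| is itself of
    order sqrt V_k; only the square root has a drift that does not depend on its size. The summand
    r^2 / 100 keeps the first process above r / 10, so that dividing by it is harmless. It starts
    below 201 r / 200 and drifts by about 15 r / 16 at most, which leaves some 23 r / 400 below 2 r
    for the noise; at the rate 30 l / r this is still more than l in the exponent. The outcome V_K
    <= 2 r^2 with mu A_K >= 5 yields only a gap of 2 mu r^2 / 5, above the mu r^2 / 4 that halves
    the squared radius: this deficit is what the second process makes up. Conditional expectations
    are replaced by integrals over two copies of the sample point. Past and current samples generate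
    independent sigma-algebras, so w -> (w, w) has the product law, and an iteration is a function
    of a past point w and a noise point v. *)

Section EuclideanGeometry.
Context {R : realType} {d : nat}.
Implicit Types u v w x y g m : 'rV[R]_d.

Lemma dotC u v : dot u v = dot v u.
Proof. by rewrite /dot; apply: eq_bigr => i _; rewrite mulrC. Qed.

Lemma dotDl u v w : dot (u + v) w = dot u w + dot v w.
Proof. by rewrite /dot -big_split; apply: eq_bigr => i _; rewrite mxE mulrDl. Qed.

Lemma dotZl c u v : dot (c *: u) v = c * dot u v.
Proof. by rewrite /dot mulr_sumr; apply: eq_bigr => i _; rewrite mxE mulrA. Qed.

Lemma dotNl u v : dot (- u) v = - dot u v.
Proof. by rewrite -scaleN1r dotZl mulN1r. Qed.

Lemma dotDr u v w : dot u (v + w) = dot u v + dot u w.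
Proof. by rewrite dotC dotDl !(dotC u). Qed.

Lemma dotZr c u v : dot u (c *: v) = c * dot u v.
Proof. by rewrite dotC dotZl dotC. Qed.

Lemma dotNr u v : dot u (- v) = - dot u v.
Proof. by rewrite dotC dotNl dotC. Qed.

Definition dotE := (dotDl, dotDr, dotNl, dotNr, dotZl, dotZr).

Lemma dot_ge0 u : 0 <= dot u u.
Proof. by apply: sumr_ge0 => i _; rewrite -expr2 sqr_ge0. Qed.

Lemma enorm_ge0 u : 0 <= enorm u.
Proof. exact: sqrtr_ge0. Qed.

Lemma enorm_sqr u : enorm u ^+ 2 = dot u u.
Proof. by rewrite sqr_sqrtr ?dot_ge0. Qed.

Lemma dot_eq0 u : (dot u u == 0) = (u == 0).
Proof.
apply/idP/eqP => [|->]; last first.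
  by apply/eqP; rewrite /dot big1 // => i _; rewrite mxE mul0r.
rewrite /dot psumr_eq0 => [/allP h|i _]; last by rewrite -expr2 sqr_ge0.
apply/rowP => i; rewrite mxE.
have /implyP/(_ isT) := h i (mem_index_enum i).
by rewrite mulf_eq0 orbb => /eqP.
Qed.

Lemma enorm_eq0 u : (enorm u == 0) = (u == 0).
Proof. by rewrite -(sqrf_eq0 (enorm u)) enorm_sqr dot_eq0. Qed.

Lemma enorm0 : enorm (0 : 'rV[R]_d) = 0.
Proof. by apply/eqP; rewrite enorm_eq0. Qed.

Lemma enormZ c u : enorm (c *: u) = `|c| * enorm u.
Proof.
by rewrite /enorm !dotE mulrA -expr2 sqrtrM ?sqr_ge0// sqrtr_sqr.
Qed.

Lemma enormN u : enorm (- u) = enorm u.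
Proof. by rewrite -scaleN1r enormZ normrN1 mul1r. Qed.

Lemma enormB u v : enorm (u - v) = enorm (v - u).
Proof. by rewrite -opprB enormN. Qed.

(** Cauchy-Schwarz: the vector |v|^2 u - <u, v> v has a nonnegative squared norm, which is |v|^2
    times the difference of the two sides. *)
Lemma dot_sqr_le u v : dot u v ^+ 2 <= dot u u * dot v v.
Proof.
have [v0|v0] := eqVneq (dot v v) 0.
  have /eqP := v0; rewrite dot_eq0 => /eqP ->.
  by rewrite -(scale0r v) !dotZr !dotZl !mul0r expr0n mulr0.
have vp : 0 < dot v v by rewrite lt_def v0 dot_ge0.
have := dot_ge0 (dot v v *: u - dot u v *: v).
rewrite !dotE (dotC v u).
set a := dot u u; set b := dot u v; set c := dot v v => h.
have {}h : 0 <= c * (a * c - b ^+ 2).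
  by apply: le_trans h _; rewrite le_eqVlt; apply/orP; left; apply/eqP; ring.
by move: h; rewrite pmulr_rge0// subr_ge0.
Qed.

Lemma dot_norm_le u v : `|dot u v| <= enorm u * enorm v.
Proof.
rewrite -ler_sqr ?nnegrE ?mulr_ge0 ?enorm_ge0//.
by rewrite exprMn !enorm_sqr real_normK ?num_real ?dot_sqr_le.
Qed.

Lemma dot_le u v : dot u v <= enorm u * enorm v.
Proof. exact: le_trans (ler_norm _) (dot_norm_le u v). Qed.

Lemma dot_ge u v : - (enorm u * enorm v) <= dot u v.
Proof. by have := dot_norm_le u v; rewrite ler_norml => /andP[]. Qed.

Lemma enormD u v : enorm (u + v) <= enorm u + enorm v.
Proof.
rewrite -ler_sqr ?nnegrE ?addr_ge0 ?enorm_ge0//.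
rewrite sqrrD !enorm_sqr !dotE (dotC v u).
have := dot_le u v.
by move=> h; lra.
Qed.

Lemma enorm_leB u v : enorm u <= enorm v + enorm (u - v).
Proof. by have := enormD v (u - v); rewrite addrC subrK. Qed.

Lemma enorm_convex (p q r : R) u v : 0 <= p -> 0 <= q -> 0 < p + q ->
  enorm u <= r -> enorm v <= r ->
  enorm ((p + q)^-1 *: (p *: u + q *: v)) <= r.
Proof.
move=> p0 q0 pq hu hv; rewrite enormZ ger0_norm ?invr_ge0 ?(ltW pq)//.
rewrite mulrC ler_pdivrMr//; apply: le_trans (enormD _ _) _.
by rewrite !enormZ !ger0_norm// (mulrC r) mulrDl lerD// ler_wpM2l.
Qed.

Lemma clipE x (lam : R) : clip x lam = Num.min 1 (lam / enorm x) *: x.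
Proof. by rewrite /clip; case: eqVneq => // ->; rewrite scaler0. Qed.

Lemma clip_id x (lam : R) : enorm x <= lam -> clip x lam = x.
Proof.
rewrite clipE; have [->|x0 h] := eqVneq x 0; first by rewrite scaler0.
have xp : 0 < enorm x by rewrite lt_def enorm_eq0 x0 enorm_ge0.
by rewrite min_l ?scale1r// ler_pdivlMr ?mul1r.
Qed.

Lemma clip_large x (lam : R) : lam < enorm x ->
  clip x lam = (lam / enorm x) *: x.
Proof.
rewrite clipE; have [->|x0 h] := eqVneq x 0; first by rewrite !scaler0.
have xp : 0 < enorm x by rewrite lt_def enorm_eq0 x0 enorm_ge0.
by rewrite min_r// ler_pdivrMr ?mul1r// ltW.
Qed.

Lemma enorm_clip_large x (lam : R) : 0 <= lam -> lam < enorm x ->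
  enorm (clip x lam) = lam.
Proof.
move=> l0 h; rewrite clip_large// enormZ ger0_norm ?divr_ge0 ?enorm_ge0//.
by rewrite divfK// gt_eqF// (le_lt_trans l0 h).
Qed.

Lemma enorm_clip_le x (lam : R) : 0 <= lam -> enorm (clip x lam) <= lam.
Proof.
move=> l0; have [h|h] := leP (enorm x) lam; first by rewrite clip_id.
by rewrite enorm_clip_large.
Qed.

(** Clipping is the projection onto the ball of radius lam, and m lies in that ball. *)
Lemma clip_nonexpansive g m (lam : R) : 0 <= lam -> enorm m <= lam ->
  enorm (clip g lam - m) <= enorm (g - m).
Proof.
move=> l0 hm; have [h|h] := leP (enorm g) lam; first by rewrite clip_id.
rewrite -ler_sqr ?nnegrE ?enorm_ge0// !enorm_sqr.
have ep : 0 < enorm g by exact: le_lt_trans h.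
have gl : dot g g = enorm g ^+ 2 by rewrite enorm_sqr.
have cl : dot (clip g lam) (clip g lam) = lam ^+ 2.
  by rewrite -enorm_sqr enorm_clip_large.
have cm : dot (clip g lam) m = lam / enorm g * dot g m.
  by rewrite clip_large// dotZl.
rewrite !dotE gl cl (dotC m (clip _ _)) (dotC m g) cm.
set t := lam / enorm g.
have te : t * enorm g = lam by rewrite divfK// gt_eqF.
have t0 : 0 <= t by rewrite divr_ge0// enorm_ge0.
have t1 : t <= 1 by rewrite ler_pdivrMr// mul1r ltW.
have gm : dot g m <= enorm g * lam.
  by apply: le_trans (dot_le _ _) _; rewrite ler_wpM2l// enorm_ge0.
have : (1 - t) * dot g m <= (1 - t) * (enorm g * lam).
  by rewrite ler_wpM2l// subr_ge0.
(* With lam = t |g| the difference of the squares is (1 - t) ((1 + t) |g|^2 - 2 <g, m>), and <g, m>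
   <= t |g|^2 makes it at least (1 - t)^2 |g|^2. *)
have := sqr_ge0 ((1 - t) * enorm g).
rewrite -te; nra.
Qed.

(** Pointwise control of what clipping removes, whose mean is then at most the variance over 2 lam.
    With u = |g| - lam / 2 <= |g - m|, the bound 2 lam (|g| - lam) <= u^2 is (u - lam)^2 >= 0. *)
Lemma clip_residual_le g m (lam : R) : 0 < lam -> enorm m <= lam / 2 ->
  enorm (g - clip g lam) <= enorm (g - m) ^+ 2 / (2 * lam).
Proof.
move=> l0 hm; have [h|h] := leP (enorm g) lam.
  by rewrite clip_id// subrr enorm0 divr_ge0 ?sqr_ge0 ?mulr_ge0 ?ltW.
have ep : 0 < enorm g by exact: lt_trans h.
have -> : enorm (g - clip g lam) = enorm g - lam.
  rewrite clip_large// -[X in enorm (X - _)]scale1r -scalerBl enormZ.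
  have te : lam / enorm g * enorm g = lam by rewrite divfK// gt_eqF.
  have t1 : lam / enorm g <= 1 by rewrite ler_pdivrMr// mul1r ltW.
  by rewrite ger0_norm ?subr_ge0// mulrBl mul1r te.
have hr : enorm g - lam / 2 <= enorm (g - m).
  by have := enorm_leB g m; lra.
rewrite ler_pdivlMr ?mulr_gt0//.
have r0 : 0 <= enorm g - lam / 2 by lra.
have : (enorm g - lam / 2) ^+ 2 <= enorm (g - m) ^+ 2.
  by rewrite ler_sqr ?nnegrE ?enorm_ge0.
have := sqr_ge0 (enorm g - lam / 2 - lam).
nra.
Qed.

End EuclideanGeometry.

(** * Measurability of vector-valued maps through their coordinates *)

Section MeasurableComparison.
Context {R : realType} d (T : measurableType d) (f g : T -> R).
Hypotheses (mf : measurable_fun [set: T] f) (mg : measurable_fun [set: T] g).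

Lemma measurable_le_set : measurable [set w | f w <= g w].
Proof.
have := measurable_fun_ler mf mg measurableT (I : measurable [set true]).
by rewrite setTI.
Qed.

Lemma measurable_lt_set : measurable [set w | f w < g w].
Proof.
have := measurable_fun_ltr mf mg measurableT (I : measurable [set true]).
by rewrite setTI.
Qed.

End MeasurableComparison.

Section VectorMeasurability.
Context {R : realType} {d : nat}.
Context d' (T : measurableType d').

Lemma measurable_coord (i : 'I_d) :
  measurable_fun [set: borel R d] (fun x : borel R d => (x : 'rV[R]_d) 0 i).
Proof.
apply: (measurability _ (RGenOInfty.measurableE R)) => _ [_ [a ->] <-].
rewrite setTI; apply: sub_sigma_algebra.
by apply: open_comp => [x _|]; [exact: coord_continuous|exact: interval_open].
Qed.

(** An open set is the union of the rational boxes that it contains, and these are countably many; a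
    box is a condition on finitely many coordinates. *)
Lemma measurable_rV (X : T -> borel R d) :
  (forall i, measurable_fun [set: T] (fun w => (X w : 'rV[R]_d) 0 i)) ->
  measurable_fun [set: T] X.
Proof.
move=> mX; apply: (@measurability _ _ T (borel R d) setT X (@open 'rV[R]_d)) => [//|_ [U oU <-]].
rewrite setTI.
pose box (p : 'rV[rat]_d * nat) : set 'rV[R]_d :=
  [set x | forall i, `|x 0 i - ratr (p.1 0 i)| < p.2.+1%:R^-1].
have -> : X @^-1` U = \bigcup_p ((if `[< box p `<=` U >]
    then X @^-1` box p else set0)).
  apply/seteqP; split=> [w /= Uw|w [p _]]; last first.
    by case: asboolP => // h /h.
  (* Two points of a box are at sup distance below 2 / (n + 1) < e, so a box that contains [X w]
     stays inside U. *)
  have /nbhs_ballP[e /= e0 eU] : nbhs (X w) U by exact: open_nbhs_nbhs.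
  have [n] : exists n : nat, n.+1%:R^-1 < e / 2.
    have [n hn] := ltr_add_invr (divr_gt0 e0 (ltr0n _ 2)).
    by exists n; rewrite add0r in hn.
  move=> hn.
  have n0 : 0 < n.+1%:R^-1 :> R by rewrite invr_gt0 ltr0n.
  have /choice[q hq] : forall i : 'I_d, exists q : rat,
      `|(X w : 'rV[R]_d) 0 i - ratr q| < n.+1%:R^-1.
    move=> i; have xlt : (X w : 'rV[R]_d) 0 i < (X w : 'rV[R]_d) 0 i + n.+1%:R^-1.
      by rewrite ltrDl.
    have [q] := rat_in_itvoo xlt; rewrite in_itv/= => /andP[h1 h2].
    exists q; rewrite distrC ltr_distl; apply/andP; split; first by apply: lt_trans h1; rewrite gtrDl oppr_lt0. exact: h2.
  exists (\row_i q i, n) => //.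
  case: asboolP => [_ i|ns]; first by rewrite mxE; exact: hq.
  exfalso; apply: ns => y hy; apply: eU; split => // i j.
  rewrite (ord1 i) /ball/=; have := hy j; have := hq j; rewrite /= mxE.
  move=> h1 h2; rewrite (le_lt_trans (ler_distD (ratr (q j)) _ _))//.
  move: h1 h2 hn; rewrite (distrC (y 0 j)); move: (n.+1%:R^-1) => c ? ? ?; lra.
apply: countable_bigcupT_measurable => [|[q n]]; first exact: countableP.
case: ifP => // _.
rewrite (_ : _ @^-1` _ = \bigcap_i [set w | `|(X w : 'rV[R]_d) 0 i - ratr (q 0 i)| < n.+1%:R^-1]); last first.
  by apply/seteqP; split => w /= h i; [move=> _|]; exact: h.
apply: fin_bigcap_measurable => // i _.
apply: (@measurable_lt_set _ _ _
  (fun w => `|(X w : 'rV[R]_d) 0 i - ratr (q 0 i)|) (cst n.+1%:R^-1)) => //.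
apply: measurableT_comp => //.
exact: measurable_funB.
Qed.
End VectorMeasurability.

Section VectorValuedMaps.
Context {R : realType} {d : nat}.
Context d' (T : measurableType d').
Implicit Types X Y : T -> 'rV[R]_d.

Definition vmeasurable X :=
  forall i, measurable_fun [set: T] (fun w => X w 0 i).

Lemma vmeasurable_borel X :
  measurable_fun [set: T] (X : T -> borel R d) -> vmeasurable X.
Proof. by move=> mX i; exact: measurableT_comp (measurable_coord i) mX. Qed.

Lemma vmeasurable_cst (x : 'rV[R]_d) : vmeasurable (fun=> x).
Proof. by move=> i; exact: measurable_cst. Qed.

Lemma vmeasurableD X Y : vmeasurable X -> vmeasurable Y ->
  vmeasurable (fun w => X w + Y w).
Proof.
move=> mX mY i; under eq_fun do rewrite mxE.
by apply: measurable_funD; [exact: mX|exact: mY].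
Qed.

Lemma vmeasurableZ (c : T -> R) X : measurable_fun [set: T] c ->
  vmeasurable X -> vmeasurable (fun w => c w *: X w).
Proof.
move=> mc mX i; under eq_fun do rewrite mxE.
by apply: measurable_funM; [exact: mc|exact: mX].
Qed.

Lemma vmeasurableB X Y : vmeasurable X -> vmeasurable Y ->
  vmeasurable (fun w => X w - Y w).
Proof.
move=> mX mY i; under eq_fun do rewrite !mxE.
by apply: measurable_funB; [exact: mX|exact: mY].
Qed.

Lemma measurable_dot X Y : vmeasurable X -> vmeasurable Y ->
  measurable_fun [set: T] (fun w => dot (X w) (Y w)).
Proof.
move=> mX mY; apply: measurable_sum => i.
by apply: measurable_funM; [exact: mX|exact: mY].
Qed.

Lemma measurable_sqrt (f : T -> R) : (forall w, 0 <= f w) ->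
  measurable_fun [set: T] f -> measurable_fun [set: T] (fun w => Num.sqrt (f w)).
Proof.
move=> f0 mf; under eq_fun do rewrite -powR12_sqrt//.
exact: (measurableT_comp (measurable_powR _)).
Qed.

Lemma measurable_enorm X : vmeasurable X ->
  measurable_fun [set: T] (fun w => enorm (X w)).
Proof.
move=> mX; apply: measurable_sqrt => [w|]; first exact: dot_ge0.
exact: measurable_dot.
Qed.

Lemma vmeasurable_clip (lam : R) X : vmeasurable X ->
  vmeasurable (fun w => clip (X w) lam).
Proof.
move=> mX; under [fun w => _]eq_fun do rewrite clipE.
apply: vmeasurableZ => //; apply: measurable_minr => //.
apply: measurable_funM => //; under eq_fun do rewrite -powR_inv1 ?enorm_ge0//.
by apply: (measurableT_comp (measurable_powR _)); exact: measurable_enorm.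
Qed.

Lemma measurable_eball (c : 'rV[R]_d) (r : R) X : vmeasurable X ->
  measurable [set w | eball c r (X w)].
Proof.
move=> mX; apply: measurable_le_set => //.
by apply: measurable_enorm; apply: vmeasurableB => //; exact: vmeasurable_cst.
Qed.

Lemma continuous_measurable_borel (f : 'rV[R]_d -> R) : continuous f ->
  measurable_fun [set: borel R d] (f : borel R d -> R).
Proof.
move=> cf; apply: (measurability _ (RGenOInfty.measurableE R)) => _ [_ [a ->] <-].
rewrite setTI; apply: sub_sigma_algebra.
by apply: open_comp => [x _|]; [exact: cf|exact: interval_open].
Qed.

Lemma measurable_continuous_comp (f : 'rV[R]_d -> R) X : continuous f ->
  vmeasurable X -> measurable_fun [set: T] (fun w => f (X w)).
Proof.
move=> cf mX; apply: (measurableT_comp (continuous_measurable_borel cf)).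
exact: measurable_rV.
Qed.

End VectorValuedMaps.

(** * Independent sigma-algebras *)

Section IndependentSigmaAlgebras.
Context dT (T : measurableType dT) (R : realType) (P : probability T R).
Variables F H : set (set T).
Hypotheses (Fm : F `<=` measurable) (Hm : H `<=` measurable).
Hypotheses (FT : F setT) (HT : H setT).
Hypotheses (FI : setI_closed F) (HI : setI_closed H).
Hypothesis indep : forall A B, F A -> H B -> P (A `&` B) = (P A * P B)%E.

Lemma sigma_sub_measurable (G : set (set T)) : G `<=` measurable ->
  <<s G >> `<=` measurable.
Proof. exact: (smallest_sub (@sigma_algebra_measurable _ T)). Qed.

(** For fixed B in H, the finite measures A -> P (A [&] B) and A -> P B * P A agree on the pi-system
    F, hence on the sigma-algebra that it generates. *)
Let indep1 (A B : set T) : <<s F >> A -> H B -> P (A `&` B) = (P A * P B)%E.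
Proof.
move=> sA HB; have mB := Hm HB.
have Bfin : P B \is a fin_num by exact: fin_num_measure.
have Bge0 : 0 <= fine (P B) by exact: fine_ge0.
have := g_sigma_algebra_measure_unique F Fm (fun=> setT) (fun=> FT) _
  (mrestr P mB) (mscale (NngNum Bge0) P) FI.
have sE C : mscale (NngNum Bge0) P C = (P B * P C)%E by rewrite /mscale/= fineK.
move=> h; have {h} : mrestr P mB A = mscale (NngNum Bge0) P A.
  apply: h => //; first by rewrite bigcup_const.
    by move=> C FC; apply: etrans (esym (sE C)); rewrite /= /mrestr indep// muleC.
  by move=> _; rewrite /= /mrestr setTI ltey_eq Bfin.
by rewrite sE muleC.
Qed.

(** The same uniqueness argument in the other variable, now with A already in the generated
    sigma-algebra. *)
Lemma indep_sigma (A B : set T) : <<s F >> A -> <<s H >> B ->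
  P (A `&` B) = (P A * P B)%E.
Proof.
move=> sA sB; have mA := sigma_sub_measurable Fm sA.
have Afin : P A \is a fin_num by exact: fin_num_measure.
have Age0 : 0 <= fine (P A) by exact: fine_ge0.
have := g_sigma_algebra_measure_unique H Hm (fun=> setT) (fun=> HT) _
  (mrestr P mA) (mscale (NngNum Age0) P) HI.
have sE C : mscale (NngNum Age0) P C = (P A * P C)%E by rewrite /mscale/= fineK.
move=> h; have {h} : mrestr P mA B = mscale (NngNum Age0) P B.
  apply: h => //; first by rewrite bigcup_const.
    by move=> C FC; apply: etrans (esym (sE C)); rewrite /= /mrestr setIC indep1.
  by move=> _; rewrite /= /mrestr setTI ltey_eq Afin.
by rewrite sE /mrestr setIC.
Qed.

Local Notation TF := (g_sigma_algebraType F).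
Local Notation TH := (g_sigma_algebraType H).

Lemma measurable_id_sigma (G : set (set T)) : G `<=` measurable ->
  measurable_fun [set: T] (id : T -> g_sigma_algebraType G).
Proof. by move=> Gm _ A mA; rewrite setTI; exact: sigma_sub_measurable mA. Qed.

Let mF := measurable_id_sigma Fm.
Let mH := measurable_id_sigma Hm.
Let mD : measurable_fun [set: T] (fun w => (w, w) : TF * TH).
Proof. by apply: measurable_fun_pair. Qed.

Let idF : {RV P >-> TF} := mfun_Sub (mem_set mF).
Let idH : {RV P >-> TH} := mfun_Sub (mem_set mH).
Let diag : {RV P >-> (TF * TH)%type} := mfun_Sub (mem_set mD).

(** Substitute for conditional expectation. The law of w -> (w, w) on the product of the two
    sigma-algebras is the product of its marginals, since a rectangle pulls back to an intersection
    of independent events; Tonelli then separates the variables. *)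
Lemma ge0_integral_diag (h : TF * TH -> \bar R) :
  measurable_fun [set: TF * TH] h -> (forall p, 0 <= h p)%E ->
  (\int[P]_w h (w, w) = \int[P]_w \int[P]_v h (w, v))%E.
Proof.
move=> mh h0.
transitivity (\int[distribution P diag]_p h p)%E.
  by rewrite ge0_integral_pushforward.
transitivity (\int[(distribution P idF \x distribution P idH)%E]_p h p)%E.
  apply: eq_measure_integral => A mA _.
  apply/esym/(@product_measure_unique _ _ TF TH R (distribution P idF)
    (distribution P idH) (distribution P diag)) => // B C mB mC.
  exact: indep_sigma.
rewrite fubini_tonelli1// /fubini_F ge0_integral_pushforward//.
- apply: eq_integral => w _ /=.
  rewrite ge0_integral_pushforward//.
  exact: measurableT_comp.
- exact: measurable_fun_fubini_tonelli_F.
- by move=> w _; apply: integral_ge0.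
Qed.

Lemma measurable_integral_section (h : TF * TH -> \bar R) :
  measurable_fun [set: TF * TH] h -> (forall p, 0 <= h p)%E ->
  measurable_fun [set: T] (fun w => \int[P]_v h (w, v))%E.
Proof.
move=> mh h0.
have -> : (fun w => \int[P]_v h (w, v))%E =
    (fubini_F (distribution P idH) h) \o (id : T -> TF).
  apply/funext => w /=; rewrite /fubini_F ge0_integral_pushforward//.
  exact: measurableT_comp.
apply: measurableT_comp mF.
exact: (@measurable_fun_fubini_tonelli_F _ _ TF TH R (distribution P idH) h).
Qed.

End IndependentSigmaAlgebras.

(** * Cylinder events of a family of independent variables *)

Section CylinderSets.
Context dT (T : measurableType dT) (R : realType) (P : probability T R).
Context dS (S : measurableType dS) (I : eqType) (X : I -> T -> S).
Hypothesis mX : forall i, measurable_fun [set: T] (X i).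

(** A pi-system that generates the sigma-algebra of the variables with index in J. Its elements have
    exactly the form to which [mutually_independent] applies. *)
Definition cylinders (J : set I) : set (set T) :=
  [set A | exists s (B : I -> set S), [/\ uniq s, forall i, i \in s -> J i,
     forall i, measurable (B i) & A = \bigcap_(i in [set` s]) X i @^-1` B i]].

Lemma cylinders_measurable J : cylinders J `<=` measurable.
Proof.
move=> _ [s [B [_ _ mB ->]]]; apply: fin_bigcap_measurable => [|i _].
  exact: finite_seq.
by rewrite -[X in measurable X]setTI; exact: mX.
Qed.

Lemma cylindersT J : cylinders J setT.
Proof. by exists [::], (fun=> setT); split => //; rewrite set_nil bigcap_set0. Qed.

Lemma cylinders_preimage (J : set I) i (B : set S) : J i -> measurable B ->
  cylinders J (X i @^-1` B).
Proof.
move=> Ji mB; exists [:: i], (fun=> B); split => // [j|].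
  by rewrite inE => /eqP ->.
by rewrite set_cons1 bigcap_set1.
Qed.

Lemma cylindersI J : setI_closed (cylinders J).
Proof.
move=> _ _ [s1 [B1 [u1 J1 m1 ->]]] [s2 [B2 [u2 J2 m2 ->]]].
exists (undup (s1 ++ s2)), (fun i => (if i \in s1 then B1 i else setT) `&`
  (if i \in s2 then B2 i else setT)); split.
- exact: undup_uniq.
- by move=> i; rewrite mem_undup mem_cat => /orP[/J1|/J2].
- by move=> i; apply: measurableI; case: ifP.
- apply/seteqP; split => [w [w1 w2] i _ /=|w h]; split.
  + by case: ifP => // i1; exact: w1.
  + by case: ifP => // i2; exact: w2.
  + move=> i /= i1; have /= := h i.
    by rewrite mem_undup mem_cat i1/= => /(_ isT)[].
  + move=> i /= i2; have /= := h i.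
    by rewrite mem_undup mem_cat i2 orbT => /(_ isT)[].
Qed.

(** Lists of indices taken from the disjoint sets J1 and J2 concatenate to a duplicate-free list in
    J0, and the product over it splits. *)
Lemma cylinders_indep (J0 J1 J2 : set I) :
  mutually_independent P J0 X -> J1 `<=` J0 -> J2 `<=` J0 ->
  (forall i, J1 i -> ~ J2 i) ->
  forall A B, cylinders J1 A -> cylinders J2 B -> P (A `&` B) = (P A * P B)%E.
Proof.
move=> ind J10 J20 J12 _ _ [s1 [B1 [u1 h1 m1 ->]]] [s2 [B2 [u2 h2 m2 ->]]].
have d12 i : i \in s1 -> i \notin s2.
  by move=> /h1/J12 h; apply/negP => /h2.
pose B i := if i \in s1 then B1 i else B2 i.
have e1 : \bigcap_(i in [set` s1]) X i @^-1` B1 i =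
    \bigcap_(i in [set` s1]) X i @^-1` B i.
  by apply: eq_bigcapr => i /= i1; rewrite /B i1.
have e2 : \bigcap_(i in [set` s2]) X i @^-1` B2 i =
    \bigcap_(i in [set` s2]) X i @^-1` B i.
  apply: eq_bigcapr => i /= i2; rewrite /B; case: ifP => // /d12.
  by rewrite i2.
have mB i : measurable (B i) by rewrite /B; case: ifP.
rewrite e1 e2 (ind s1)// => [|i /h1/J10//]; rewrite (ind s2)// => [|i /h2/J20//].
rewrite -big_cat -ind//.
- congr (P _); apply/seteqP; split => [w [w1 w2] i /=|w h].
    by rewrite mem_cat => /orP[]; [exact: w1|exact: w2].
  by split => i /= hi; apply: h; rewrite /= mem_cat hi ?orbT.
- rewrite cat_uniq u1 u2 andbT/=; apply/hasPn => i i2.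
  by apply/negP => /d12; rewrite i2.
- by move=> i; rewrite mem_cat => /orP[/h1/J10|/h2/J20].
Qed.

Lemma measurable_cylinders (J : set I) i : J i ->
  measurable_fun [set: g_sigma_algebraType (cylinders J)]
    (X i : g_sigma_algebraType (cylinders J) -> S).
Proof.
move=> Ji _ B mB; rewrite setTI; apply: sub_sigma_algebra.
exact: cylinders_preimage.
Qed.

End CylinderSets.

(** * Moments of the clipped noise *)

Section ExpBounds.
Context {R : realType}.
Implicit Types x y c : R.

Lemma expR_le_inv x : x < 1 -> expR x <= (1 - x)^-1.
Proof.
move=> x1; rewrite -[expR x]invrK lef_pV2 ?posrE ?invr_gt0 ?expR_gt0 ?subr_gt0//.
by rewrite -expRN expR_ge1Dx.
Qed.

Lemma expR_le_nonpos x : x <= 0 -> expR x <= 1 + x + x ^+ 2.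
Proof.
move=> x0; apply: le_trans (expR_le_inv _) _; first lra.
rewrite -div1r ler_pdivrMr; last lra.
nra.
Qed.

(** Squaring a quadratic bound at y gives one at 2 y; the hypothesis compares the coefficients of
    y^2 after squaring. *)
Lemma expR_doubling c c' y : 0 <= y -> 0 <= c ->
  1 + 2 * c + 2 * c * y + c ^+ 2 * y ^+ 2 <= 4 * c' ->
  expR y <= 1 + y + c * y ^+ 2 -> expR (2 * y) <= 1 + 2 * y + c' * (2 * y) ^+ 2.
Proof.
move=> y0 c0 h hy; rewrite mulr_natl mulr2n expRD -expr2.
have h2 : expR y ^+ 2 <= (1 + y + c * y ^+ 2) ^+ 2.
  by rewrite ler_sqr ?nnegrE ?expR_ge0 ?addr_ge0 ?mulr_ge0 ?sqr_ge0.
apply: le_trans h2 _; rewrite -mulr2n -(mulr_natl y 2).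
have : y ^+ 2 * (1 + 2 * c + 2 * c * y + c ^+ 2 * y ^+ 2) <= y ^+ 2 * (4 * c').
  by rewrite ler_wpM2l// sqr_ge0.
nra.
Qed.

(** The noise exponents below are shown to be at most 4, hence this range. The coefficient 7 is paid
    once, in front of the variance. *)
Lemma expR_le_quadratic4 x : x <= 4 -> expR x <= 1 + x + 7 * x ^+ 2.
Proof.
move=> x4; have [x0|x0] := leP x 0.
  by apply: le_trans (expR_le_nonpos x0) _; have := sqr_ge0 x; lra.
(* At y = x / 16 <= 1 / 4 the bound by 1 / (1 - y) is sharp enough; four doublings carry it back to
   x, with coefficients 4/3, 1.12, 1.18, 1.8 and 7. *)
have -> : x = 2 * (2 * (2 * (2 * (x / 16)))) by lra.
set y := x / 16; have y0 : 0 <= y by rewrite /y; lra.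
have y4 : y <= 1 / 4 by rewrite /y; lra.
have yy : y ^+ 2 <= 1 / 16 by nra.
have h0 : expR y <= 1 + y + 4 / 3 * y ^+ 2.
  apply: le_trans (expR_le_inv _) _; first lra.
  by rewrite -div1r ler_pdivrMr; [nra|lra].
have h1 : expR (2 * y) <= 1 + 2 * y + 112 / 100 * (2 * y) ^+ 2.
  by apply: expR_doubling h0 => //; lra.
have h2 : expR (2 * (2 * y)) <= 1 + 2 * (2 * y) + 118 / 100 * (2 * (2 * y)) ^+ 2.
  by apply: expR_doubling h1 => //; lra.
have h3 : expR (2 * (2 * (2 * y))) <=
    1 + 2 * (2 * (2 * y)) + 18 / 10 * (2 * (2 * (2 * y))) ^+ 2.
  by apply: expR_doubling h2 => //; lra.
by apply: expR_doubling h3 => //; lra.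
Qed.

Lemma expR1_le3 : expR 1 <= 3 :> R.
Proof.
have -> : 1 = 8%:R * (1 / 8) :> R by lra.
rewrite expRM_natl.
have h : expR (1 / 8 : R) <= 8 / 7.
  apply: le_trans (expR_le_inv _) _; first lra.
  by rewrite -div1r ler_pdivrMr; lra.
apply: (@le_trans _ _ ((8 / 7) ^+ 8)); last by lra.
by rewrite lerXn2r ?nnegrE ?expR_ge0; lra.
Qed.

End ExpBounds.

(** * Moment generating function of a clipped estimate *)

Section ClippedNoiseMoment.
Context dT (T : measurableType dT) (R : realType) (P : probability T R).
Context {d : nat}.

Lemma integral_prob_cst (c : R) : (\int[P]_w c%:E = c%:E)%E.
Proof.
rewrite integral_cst// -[RHS]mule1; congr (_ * _)%E; exact: probability_setT.
Qed.

Lemma integral_dot_centered (g : T -> 'rV[R]_d) (v : 'rV[R]_d) :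
  (forall i, P.-integrable [set: T] (fun w => (g w 0 i)%:E)) ->
  P.-integrable [set: T] (fun w => (dot (g w - mean_vec P g) v)%:E) /\
  (\int[P]_w (dot (g w - mean_vec P g) v)%:E = 0)%E.
Proof.
move=> gi; set m := mean_vec P g.
have ii i : P.-integrable [set: T] (fun w => ((g w - m) 0 i * v 0 i)%:E).
  have -> : (fun w => ((g w - m) 0 i * v 0 i)%:E) =
      (fun w => (v 0 i)%:E * ((g w 0 i)%:E - (m 0 i)%:E))%E.
    by apply/funext => w; rewrite !mxE -EFinB -EFinM mulrC.
  apply: integrableZl => //; apply: integrableB => //.
  exact: finite_measure_integrable_cst.
have E : (fun w => (dot (g w - m) v)%:E) =
    (fun w => \sum_(i < d) ((g w - m) 0 i * v 0 i)%:E)%E.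
  by apply/funext => w; rewrite /dot -sumEFin.
rewrite E; split; first exact: integrable_sum.
rewrite integral_sum// big1// => i _.
have -> : (fun w => ((g w - m) 0 i * v 0 i)%:E) =
    (fun w => (v 0 i)%:E * ((g w 0 i)%:E - (m 0 i)%:E))%E.
  by apply/funext => w; rewrite !mxE -EFinB -EFinM mulrC.
rewrite integralZl//; last first.
  by apply: integrableB => //; exact: finite_measure_integrable_cst.
rewrite integralB//; last exact: finite_measure_integrable_cst.
rewrite integral_prob_cst mxE.
have fi : (\int[P]_w (g w 0 i)%:E)%E \is a fin_num.
  exact: integrable_fin_num.
have -> : ('E_P[fun w => (g w 0 i)%R])%E = (\int[P]_w (g w 0 i)%:E)%E.
  by rewrite unlock.
by rewrite fineK// subee// mule0.
Qed.

(** The exponent is compared pointwise with the unclipped deviation: its first-order part is a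
    centred variable plus the clipping residual, and the residual and all second-order parts are
    multiples of |g - m|^2. Integrating 1 + (centred) + C |g - m|^2 leaves 1 + C sigma^2 <= exp (C
    sigma^2). *)
Lemma exp_clip_moment (g : T -> 'rV[R]_d) (sigma lam s h nv : R)
    (v : 'rV[R]_d) :
  measurable_fun [set: T] (g : T -> borel R d) ->
  (forall i, P.-integrable [set: T] (fun w => (g w 0 i)%:E)) ->
  ('E_P[fun w => (enorm (g w - mean_vec P g) ^+ 2)%R] <= (sigma ^+ 2)%:E)%E ->
  0 < lam -> enorm (mean_vec P g) <= lam / 2 -> 0 <= s -> 0 <= h ->
  enorm v <= nv ->
  s * (nv * (3 / 2 * lam) + h * (3 / 2 * lam) ^+ 2) <= 4 ->
  (\int[P]_w (expR (s * (dot (clip (g w) lam - mean_vec P g) v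
       + h * enorm (clip (g w) lam - mean_vec P g) ^+ 2)))%:E <=
   (expR ((s * (nv / (2 * lam) + h) + 7 * (s * (nv + h * (3 / 2 * lam))) ^+ 2)
            * sigma ^+ 2))%:E)%E.
Proof.
move=> mg gi hvar l0; set m := mean_vec P g in hvar * => hm s0 h0 hv hs.
set C := s * (nv / (2 * lam) + h) + 7 * (s * (nv + h * (3 / 2 * lam))) ^+ 2.
have nv0 : 0 <= nv by apply: le_trans hv; exact: enorm_ge0.
have C0 : 0 <= C.
  apply: addr_ge0; last by rewrite mulr_ge0// sqr_ge0.
  by rewrite mulr_ge0// addr_ge0// divr_ge0// mulr_ge0// ltW.
pose Y w := enorm (g w - m) ^+ 2.
have pw w : expR (s * (dot (clip (g w) lam - m) v
       + h * enorm (clip (g w) lam - m) ^+ 2)) <=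
    1 + s * dot (g w - m) v + C * Y w.
  set c := clip (g w) lam - m.
  have c1 : enorm c <= 3 / 2 * lam.
    have := enormD (clip (g w) lam) (- m); rewrite enormN.
    by have := enorm_clip_le (g w) (ltW l0); rewrite -/c; lra.
  have c2 : enorm c <= enorm (g w - m).
    by apply: clip_nonexpansive; lra.
  have cc0 := enorm_ge0 c.
  have c3 : enorm c ^+ 2 <= Y w by rewrite /Y ler_sqr ?nnegrE ?enorm_ge0.
  (* Clipping destroys the zero mean. The defect is the residual g - clip g, which
     [clip_residual_le] bounds by a quadratic term. *)
  have dcv : dot c v <= dot (g w - m) v + nv * (Y w / (2 * lam)).
    have -> : dot c v = dot (g w - m) v + dot (- (g w - clip (g w) lam)) v.
      rewrite -dotDl; congr (dot _ _); apply/rowP => i.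
      by rewrite /c !mxE; ring.
    rewrite lerD2l; apply: le_trans (dot_le _ _) _; rewrite enormN mulrC.
    have hr := @clip_residual_le _ _ (g w) m lam l0 hm.
    by apply: ler_pM => //; exact: enorm_ge0.
  have dcn : `|dot c v| <= nv * enorm c.
    apply: le_trans (dot_norm_le _ _) _.
    by rewrite mulrC ler_wpM2r ?enorm_ge0.
  set X := dot c v + h * enorm c ^+ 2.
  have Xn : `|X| <= (nv + h * (3 / 2 * lam)) * enorm c.
    rewrite /X; apply: le_trans (ler_normD _ _) _.
    rewrite [X in _ + X]ger0_norm ?mulr_ge0 ?sqr_ge0//.
    have : h * enorm c ^+ 2 <= h * (3 / 2 * lam) * enorm c.
      by rewrite expr2 mulrA ler_wpM2r// ler_wpM2l.
    by rewrite mulrDl; lra.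
  have q0 : 0 <= nv + h * (3 / 2 * lam).
    by rewrite addr_ge0// mulr_ge0// mulr_ge0// ltW.
  have X4 : s * X <= 4.
    apply: le_trans hs; rewrite ler_wpM2l//; apply: le_trans (ler_norm _) _.
    apply: le_trans Xn _.
    apply: (@le_trans _ _ ((nv + h * (3 / 2 * lam)) * (3 / 2 * lam))).
      by rewrite ler_wpM2l.
    by lra.
  apply: le_trans (expR_le_quadratic4 X4) _.
  have X2 : (s * X) ^+ 2 <= (s * (nv + h * (3 / 2 * lam))) ^+ 2 * Y w.
    rewrite (exprMn _ s X) (exprMn _ s) -(mulrA (s ^+ 2)).
    apply: ler_wpM2l; first exact: sqr_ge0.
    apply: (@le_trans _ _ (((nv + h * (3 / 2 * lam)) * enorm c) ^+ 2)).
      rewrite -[X ^+ 2]real_normK ?num_real// ler_sqr ?nnegrE//.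
      by rewrite mulr_ge0.
    by rewrite exprMn ler_wpM2l// sqr_ge0.
  have X1 : s * X <= s * dot (g w - m) v + s * (nv / (2 * lam) + h) * Y w.
    rewrite -[X in _ + X]mulrA -mulrDr ler_wpM2l// /X.
    have : h * enorm c ^+ 2 <= h * Y w by rewrite ler_wpM2l.
    have eY : nv * (Y w / (2 * lam)) = nv / (2 * lam) * Y w.
      by rewrite mulrA mulrAC.
    rewrite eY in dcv.
    by rewrite mulrDl; lra.
  by rewrite /C mulrDl; lra.
clearbody C.
have mcoord i : measurable_fun [set: T] (fun w => g w 0 i).
  exact: measurableT_comp (measurable_coord i) mg.
have mY : measurable_fun [set: T] Y.
  have -> : Y = (fun w => \sum_i (g w 0 i - m 0 i) * (g w 0 i - m 0 i)).
    apply/funext => w; rewrite /Y enorm_sqr /dot.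
    by apply: eq_bigr => i _; rewrite !mxE.
  by apply: measurable_sum => i; apply: measurable_funM; exact: measurable_funB.
have Y0 w : 0 <= Y w by exact: sqr_ge0.
have iY : P.-integrable [set: T] (EFin \o Y).
  apply/integrableP; split; first exact/measurable_EFinP.
  rewrite (eq_integral (EFin \o Y)); last by move=> w _ /=; rewrite ger0_norm.
  by move: hvar; rewrite unlock => /le_lt_trans; apply; rewrite ltry.
have [iD D0] := integral_dot_centered v gi.
have RE : (fun w => (1 + s * dot (g w - m) v + C * Y w)%:E) =
    (fun w => (1%:E + s%:E * (dot (g w - m) v)%:E) + C%:E * (Y w)%:E)%E.
  by apply/funext => w; rewrite !EFinD !EFinM.
have i0 : P.-integrable [set: T] (fun=> 1%:E).
  exact: finite_measure_integrable_cst.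
have i1 : P.-integrable [set: T] (fun w => s%:E * (dot (g w - m) v)%:E)%E.
  exact: integrableZl.
have i01 : P.-integrable [set: T]
    (fun w => 1%:E + s%:E * (dot (g w - m) v)%:E)%E by exact: integrableD.
have i2 : P.-integrable [set: T] (fun w => C%:E * (Y w)%:E)%E.
  exact: integrableZl.
have iR : P.-integrable [set: T]
    (fun w => (1 + s * dot (g w - m) v + C * Y w)%:E).
  by rewrite RE; exact: integrableD.
apply: (@le_trans _ _ (\int[P]_w (1 + s * dot (g w - m) v + C * Y w)%:E)%E).
  apply: ge0_le_integral => //.
  - apply/measurable_EFinP; apply: measurableT_comp; first exact: measurable_expR.
    apply: measurable_funM => //; apply: measurable_funD.
      apply: measurable_dot; last exact: vmeasurable_cst.
      by apply: vmeasurableB; [exact: vmeasurable_clip|exact: vmeasurable_cst].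
    apply: measurable_funM => //; apply: measurable_funX; apply: measurable_enorm.
    by apply: vmeasurableB; [exact: vmeasurable_clip|exact: vmeasurable_cst].
  - by case/integrableP: iR.
  - by move=> w _; rewrite lee_fin.
have -> : (\int[P]_w (1 + s * dot (g w - m) v + C * Y w)%:E =
    1 + C%:E * \int[P]_w (Y w)%:E)%E.
  rewrite RE (integralD measurableT i01 i2) (integralD measurableT i0 i1).
  by rewrite !integralZl// D0 mule0 adde0 integral_prob_cst.
apply: (@le_trans _ _ (1 + C * sigma ^+ 2)%:E).
  rewrite EFinD EFinM. apply: leeD2l; apply: lee_wpmul2l; first by rewrite lee_fin.
  by move: hvar; rewrite unlock.
by rewrite lee_fin expR_ge1Dx.
Qed.

End ClippedNoiseMoment.

(** * One iteration *)

Section StronglyConvexOnBall.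
Context {R : realType} {d : nat}.
Variables (f : 'rV[R]_d -> R) (xs : 'rV[R]_d) (rho L mu : R).
Hypotheses (rho0 : 0 <= rho) (L0 : 0 < L) (mu0 : 0 < mu).
Hypothesis fmin : forall x, f xs <= f x.
Hypothesis smooth : forall x y, eball xs rho x -> eball xs rho y ->
  enorm (grad f x - grad f y) <= L * enorm (x - y).
Hypothesis gradbound : forall x, eball xs rho x ->
  enorm (grad f x) ^+ 2 <= 2 * L * (f x - inf (f @` eball xs rho)).
Hypothesis strconv : forall x y, eball xs rho x -> eball xs rho y ->
  f x + dot (grad f x) (y - x) + mu / 2 * enorm (x - y) ^+ 2 <= f y.

Lemma eball_center : eball xs rho xs.
Proof. by rewrite /eball/= subrr enorm0. Qed.

Lemma inf_eballE : inf (f @` eball xs rho) = f xs.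
Proof.
apply/eqP; rewrite eq_le; apply/andP; split.
  apply: ge_inf; last by exists xs => //; exact: eball_center.
  by exists (f xs) => _ [x _ <-].
apply: lb_le_inf; first by exists (f xs), xs => //; exact: eball_center.
by move=> _ [x _ <-].
Qed.

Lemma grad_sqr_le x : eball xs rho x ->
  enorm (grad f x) ^+ 2 <= 2 * L * (f x - f xs).
Proof. by move=> /gradbound; rewrite inf_eballE. Qed.

(** The bound on the squared gradient at the centre, where the gap vanishes. *)
Lemma grad_min : grad f xs = 0.
Proof.
apply/eqP; rewrite -enorm_eq0 -sqrf_eq0 eq_le sqr_ge0 andbT.
by have := grad_sqr_le eball_center; rewrite subrr mulr0.
Qed.

Lemma grad_le x : eball xs rho x -> enorm (grad f x) <= L * enorm (x - xs).
Proof. by move=> hx; have := smooth hx eball_center; rewrite grad_min subr0. Qed.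

Lemma quadratic_growth x : eball xs rho x ->
  mu / 2 * enorm (x - xs) ^+ 2 <= f x - f xs.
Proof.
move=> hx; have := strconv eball_center hx.
rewrite grad_min /dot big1 => [|i _]; last by rewrite mxE mul0r.
by rewrite enormB; lra.
Qed.

Lemma gap_le x : eball xs rho x ->
  f x - f xs + mu / 2 * enorm (x - xs) ^+ 2 <= dot (grad f x) (x - xs).
Proof.
move=> hx; have := strconv hx eball_center.
by rewrite -(opprB x xs) dotNr; lra.
Qed.

Lemma convex_le x y : eball xs rho x -> eball xs rho y ->
  f x + dot (grad f x) (y - x) <= f y.
Proof.
move=> hx hy; have := strconv hx hy.
have : 0 <= mu / 2 * enorm (x - y) ^+ 2 by rewrite mulr_ge0 ?sqr_ge0 ?divr_ge0 ?ltW.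
lra.
Qed.

(* The constant L replaces the usual L / 2: this form needs no integration of
   the gradient along the segment. *)
Lemma descent x y : eball xs rho x -> eball xs rho y ->
  f y <= f x + dot (grad f x) (y - x) + L * enorm (y - x) ^+ 2.
Proof.
move=> hx hy; have := convex_le hy hx.
have := dot_le (grad f y - grad f x) (y - x).
have := smooth hy hx; set g := enorm (grad f y - grad f x) => h1.
have : g * enorm (y - x) <= L * enorm (y - x) ^+ 2.
  by rewrite expr2 mulrA ler_wpM2r// enorm_ge0.
rewrite dotDl dotNl -(opprB y x) dotNr; lra.
Qed.

(** Adding the strong convexity inequalities between xs and y = xs + rho e_0 gives mu rho^2 <= <grad
    f y - grad f xs, y - xs> <= L rho^2. A second point exists because d and rho are positive. *)
Lemma mu_le_L : (0 < d)%N -> 0 < rho -> mu <= L.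
Proof.
case: d f xs fmin smooth gradbound strconv => // n f' xs' _ hs _ hc _ rp.
pose v : 'rV[R]_n.+1 := delta_mx 0 0.
have v1 : dot v v = 1.
  rewrite /dot (bigD1 ord0)//= big1 ?addr0 => [|i /negbTE i0].
    by rewrite /v mxE !eqxx mulr1.
  by rewrite /v mxE i0 andbF mul0r.
have ev : enorm v = 1 by rewrite /enorm v1 sqrtr1.
pose y := xs' + rho *: v.
have yE : y - xs' = rho *: v by rewrite /y addrC addKr.
have nE : enorm (y - xs') = rho by rewrite yE enormZ ev mulr1 gtr0_norm.
have hy : eball xs' rho y by rewrite /eball/= nE.
have hx : eball xs' rho xs' by rewrite /eball/= subrr enorm0 ltW.
have := hc _ _ hx hy; have := hc _ _ hy hx; have := hs _ _ hy hx.
rewrite (enormB xs' y) nE -(opprB y xs') dotNr.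
have := dot_le (grad f' y - grad f' xs') (y - xs'); rewrite nE dotDl dotNl.
set g := enorm _ => h1 h2 h3 h4.
have h5 : g * rho <= L * rho ^+ 2 by rewrite expr2 mulrA ler_wpM2r// ltW.
have : mu * rho ^+ 2 <= L * rho ^+ 2 by lra.
by rewrite ler_pM2r// exprn_gt0.
Qed.

End StronglyConvexOnBall.

(** * Algebra of one accelerated step *)

Section SSTMStep.
Context {R : realType} {d : nat}.
Implicit Types u v w x y z q c e : 'rV[R]_d.

Definition sstm_query (A al : R) y z := (A + al)^-1 *: (A *: y + al *: z).

Lemma sstm_query_sub (A al : R) x0 y z : A + al != 0 ->
  (A + al) *: (sstm_query A al y z - x0) = A *: (y - x0) + al *: (z - x0).
Proof.
move=> A0; rewrite scalerBr scalerA divff// scale1r scalerDl !scalerBr.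
by apply/rowP => i; rewrite !mxE; ring.
Qed.

(* [q] stands for the gradient at [x] and [g] for its clipped estimate. *)
Lemma sstm_potential_step (fs fx fy fy' A al a L : R) xs y z q g
    (x := sstm_query A al y z) (z' := z - al *: g)
    (y' := sstm_query A al y z') :
  0 <= A -> 0 < al -> 1000 <= a -> a * L * al ^+ 2 <= A + al ->
  fx + dot q (y - x) <= fy ->
  fy' <= fx + dot q (y' - x) + L * enorm (y' - x) ^+ 2 ->
  (A + al) * (fy' - fs) + enorm (z' - xs) ^+ 2 / 2 <=
  A * (fy - fs) + enorm (z - xs) ^+ 2 / 2
  + al * (fx - fs - dot q (x - xs)) - al * dot (g - q) (z - xs)
  + 51 / 100 * al ^+ 2 * enorm (g - q) ^+ 2.
Proof.
move=> A0 al0 a1 aL hc hd.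
have A'0 : 0 < A + al by rewrite ltr_wpDl.
have A'n : A + al != 0 by rewrite gt_eqF.
(* Both points average y with the same weights, so they differ only through z' - z = - al g. *)
have yx : y' - x = - (al ^+ 2 / (A + al)) *: g.
  apply/rowP => i; rewrite /y' /x /z' /sstm_query !mxE.
  by field.
have xE : (A + al) *: (x - xs) = A *: (y - xs) + al *: (z - xs).
  exact: sstm_query_sub.
have zE : z' - xs = (z - xs) - al *: g by rewrite /z' addrAC.
clearbody x y' z'.
have dyx : (A + al) * dot q (y' - x) = - al ^+ 2 * dot q g.
  by rewrite yx dotZr; field.
have nyx : (A + al) * (L * enorm (y' - x) ^+ 2) <= al ^+ 2 / a * dot g g.
  rewrite yx enorm_sqr dotZl dotZr.
  have -> : (A + al) * (L * (- (al ^+ 2 / (A + al)) * (- (al ^+ 2 / (A + al))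
      * dot g g))) = al ^+ 2 * dot g g * (L * al ^+ 2 / (A + al)).
    by field.
  have -> : al ^+ 2 / a * dot g g = al ^+ 2 * dot g g * a^-1 by rewrite mulrAC.
  apply: ler_wpM2l; first by rewrite mulr_ge0 ?sqr_ge0 ?dot_ge0.
  have ap : 0 < a by lra.
  by rewrite ler_pdivrMr// ler_pdivlMl// mulrA.
(* The query satisfies A (y - x) = al (x - z); this converts the convexity inequality at y into
   terms in x - xs and z - xs. *)
have key : A * dot q (y - x) = al * dot q (x - xs) - al * dot q (z - xs).
  have := congr1 (dot q) xE.
  rewrite !dotDr !dotZr !dotDr !dotNr; lra.
have h1 : A * fx + (al * dot q (x - xs) - al * dot q (z - xs)) <= A * fy.
  by rewrite -key -mulrDr ler_wpM2l.
have h2 : (A + al) * fy' <= (A + al) * fx - al ^+ 2 * dot q g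
    + al ^+ 2 / a * dot g g.
  apply: (@le_trans _ _ ((A + al) * (fx + dot q (y' - x)
      + L * enorm (y' - x) ^+ 2))); first by rewrite ler_wpM2l// ltW.
  by rewrite !mulrDr dyx; move: nyx; lra.
have hz : enorm (z' - xs) ^+ 2 = enorm (z - xs) ^+ 2 - 2 * al * dot g (z - xs)
    + al ^+ 2 * dot g g.
  rewrite zE; move: (z - xs) => u.
  rewrite !enorm_sqr !(dotDl, dotDr, dotNl, dotNr, dotZl, dotZr) (dotC u g).
  ring.
have ia0 : 0 <= a^-1 by rewrite invr_ge0; lra.
have ia1 : a^-1 <= 1 / 1000.
  by rewrite -div1r ler_pdivrMr; lra.
rewrite hz !enorm_sqr; clear nyx.
move: (a^-1) h2 ia0 ia1 => ia h2 ia0 ia1.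
set t := g - q; have gE : g = q + t by rewrite /t addrC subrK.
clearbody t.
have hq : 0 <= dot (q - t) (q - t) by exact: dot_ge0.
have qq := dot_ge0 q; have tt := dot_ge0 t.
(* With g = q + t the main part is (|t|^2 - |q|^2) / 2, so the gradient contributes with a negative
   sign and only the error t costs anything; 51/100 is 1/2 plus room for the terms in 1 / a. *)
have hquad : al ^+ 2 * ((1 / 2 + ia) * dot g g - dot q g) <=
    al ^+ 2 * (51 / 100 * dot t t).
  apply: ler_wpM2l; first exact: sqr_ge0.
  move: hq; rewrite gE !dotDl !dotDr !dotNl !dotNr (dotC t q) => hq.
  have hq' : ia * (2 * dot q t) <= ia * (dot q q + dot t t).
    by apply: ler_wpM2l => //; lra.
  have : ia * dot q q <= 1 / 1000 * dot q q by apply: ler_wpM2r.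
  have : ia * dot t t <= 1 / 1000 * dot t t by apply: ler_wpM2r.
  lra.
have gz : dot g (z - xs) = dot q (z - xs) + dot t (z - xs).
  by rewrite {1}gE dotDl.
move: hquad h1 h2; rewrite gz; lra.
Qed.

(** The cross term grows by about al |z - xs|^2 per step. Subtracting half of it in [sstm_mixed]
    produces a negative multiple of |z - xs|^2, which pays for the bias along z - xs. *)
Lemma sstm_cross_step (A al : R) xs y z g
    (x := sstm_query A al y z) (z' := z - al *: g)
    (y' := sstm_query A al y z') : A + al != 0 ->
  dot ((A + al) *: (y' - xs)) (z' - xs) - dot (A *: (y - xs)) (z - xs) =
  al * (enorm (z - xs) ^+ 2 + enorm (z' - xs) ^+ 2
        + al ^+ 2 * enorm g ^+ 2) / 2
  - al * (A + al) * dot (x - xs) g.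
Proof.
move=> A'n; rewrite sstm_query_sub//.
have xE : (A + al) * dot (x - xs) g = A * dot (y - xs) g + al * dot (z - xs) g.
  rewrite -[LHS]dotZl sstm_query_sub//; move: (y - xs) (z - xs) => v u.
  by rewrite dotDl !dotZl.
have zE : z' - xs = (z - xs) - al *: g by rewrite /z' addrAC.
rewrite -[al * (A + al) * _]mulrA xE zE; clear xE zE.
move: (y - xs) (z - xs) => v u; rewrite !enorm_sqr.
rewrite !(dotDl, dotDr, dotNl, dotNr, dotZl, dotZr) (dotC g u) (dotC v g).
by field.
Qed.

End SSTMStep.

(** * Increments of the two processes in one iteration *)

Section StageStep.
Context {R : realType} {d : nat}.
Variables (f : 'rV[R]_d -> R) (xs : 'rV[R]_d) (rho L mu : R).
Hypotheses (rho0 : 0 <= rho) (L0 : 0 < L) (mu0 : 0 < mu).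
Hypothesis fmin : forall x, f xs <= f x.
Hypothesis smooth : forall x y, eball xs rho x -> eball xs rho y ->
  enorm (grad f x - grad f y) <= L * enorm (x - y).
Hypothesis gradbound : forall x, eball xs rho x ->
  enorm (grad f x) ^+ 2 <= 2 * L * (f x - inf (f @` eball xs rho)).
Hypothesis strconv : forall x y, eball xs rho x -> eball xs rho y ->
  f x + dot (grad f x) (y - x) + mu / 2 * enorm (x - y) ^+ 2 <= f y.

Definition sstm_potential (A : R) (y z : 'rV[R]_d) : R :=
  A * (f y - f xs) + enorm (z - xs) ^+ 2 / 2.

Definition sstm_cross (A : R) (y z : 'rV[R]_d) : R :=
  dot (A *: (y - xs)) (z - xs).

Variables (r l a A al : R) (y z : 'rV[R]_d).
Hypotheses (r0 : 0 < r) (rrho : 3 * r <= rho) (l10 : 10 <= l).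
Hypothesis (ha : (310 * l) ^+ 2 <= a).
Hypotheses (A0 : 0 <= A) (al0 : 0 < al) (aL : a * L * al ^+ 2 <= A + al).
(** Bounding the gradient at y by the potential divides by A. The first iteration, where A = 0, is
    separate: there the query equals z and al L = 1 / a. *)
Hypothesis start : (A = 0 /\ y = z /\ a * L * al = 1) \/ (A + al <= 5 / 2 * A).
Hypotheses (yball : enorm (y - xs) <= 2 * r) (zball : enorm (z - xs) <= 2 * r).
Hypothesis Vball : sstm_potential A y z <= 2 * r ^+ 2.

Local Ltac facts := move: (r0) (rrho) (l10) (ha) (A0) (al0) (L0) (aL) (yball)
  (zball) => ? ? ? ? ? ? ? ? ? ?.

Let x := sstm_query A al y z.
Let q := grad f x.

Let A'0 : 0 < A + al. Proof. by rewrite ltr_wpDl. Qed.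
Let A'n : A + al != 0. Proof. by rewrite gt_eqF. Qed.
Let a0 : 0 < a.
Proof.
by apply: lt_le_trans ha; apply: exprn_gt0; move: l10; lra.
Qed.

Lemma query_ball : enorm (x - xs) <= 2 * r.
Proof.
have -> : x - xs = (A + al)^-1 *: (A *: (y - xs) + al *: (z - xs)).
  by rewrite -(@sstm_query_sub _ _ _ _ xs)// scalerA mulVf// scale1r.
by apply: enorm_convex => //; exact: ltW.
Qed.

Let inQ v : enorm (v - xs) <= 3 * r -> eball xs rho v.
Proof. by move=> h; apply: le_trans h _. Qed.

Let xQ : eball xs rho x.
Proof. by facts; apply: inQ; apply: le_trans query_ball _; lra. Qed.

Let yQ : eball xs rho y.
Proof. by facts; apply: inQ; apply: le_trans yball _; lra. Qed.

(** The right side is one third of al lam. The gradient at y is bounded through the gap, itself at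
    most 2 r^2 / A, and passing from y to the query costs L |x - y|, where x - y is of order r al /
    (A + al). *)
Lemma grad_query_le : al * enorm q <= r / (90 * l).
Proof.
have l0 : 0 < l by move: l10; lra.
have a1 : 90 * 100 * l <= a.
  apply: le_trans ha; have : l * 10 <= l * l by rewrite ler_wpM2l// ltW.
  by rewrite exprMn expr2; lra.
move: (r0) (A0) (al0) (aL) (yball) (zball) => ? ? ? ? ? ?.
have ra : r * (90 * 100 * l) <= r * a by rewrite ler_wpM2l// ltW.
have rl : 0 < r * l by rewrite mulr_gt0.
case: start => [[A00 [yz aL1]]|A52].
  have xz : x = z.
    by rewrite /x /sstm_query A00 yz scale0r !add0r scalerA mulVf ?scale1r ?gt_eqF.
  have h := grad_le rho0 fmin smooth gradbound xQ.
  have h1 : al * enorm q <= al * (L * (2 * r)).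
    rewrite ler_wpM2l ?(ltW al0)//; apply: le_trans h _.
    by rewrite ler_wpM2l ?(ltW L0)// query_ball.
  apply: le_trans h1 _; rewrite ler_pdivlMr; last lra.
  rewrite -(ler_pM2l a0).
  have -> : a * (al * (L * (2 * r)) * (90 * l)) = (a * L * al) * (180 * r * l).
    by ring.
  by rewrite aL1 mul1r; lra.
have Ap : 0 < A by lra.
have F2 : A * (f y - f xs) <= 2 * r ^+ 2.
  apply: le_trans Vball; rewrite /sstm_potential lerDl.
  by rewrite divr_ge0// sqr_ge0.
have F0 : 0 <= f y - f xs by rewrite subr_ge0.
have gy := grad_sqr_le rho0 fmin gradbound yQ.
(* Here a (al |grad f y|)^2 <= 10 r^2, and 10 * 98^2 <= 310^2: this is the origin of the constant
   310 in [ha]. *)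
have gy2 : (al * enorm (grad f y)) ^+ 2 <= (r / (98 * l)) ^+ 2.
  rewrite exprMn.
  have h1 : a * (al ^+ 2 * enorm (grad f y) ^+ 2) <= 10 * r ^+ 2.
    apply: (@le_trans _ _ (a * L * al ^+ 2 * (2 * (f y - f xs)))).
      have -> : a * L * al ^+ 2 * (2 * (f y - f xs)) =
        a * (al ^+ 2 * (2 * L * (f y - f xs))) by ring.
      by rewrite ler_wpM2l ?(ltW a0)// ler_wpM2l// sqr_ge0.
    apply: (@le_trans _ _ (5 / 2 * A * (2 * (f y - f xs)))); last lra.
    by rewrite ler_wpM2r// ?mulr_ge0//; apply: le_trans aL _.
  rewrite expr_div_n ler_pdivlMr; last by rewrite exprn_gt0// mulr_gt0.
  set X := al ^+ 2 * _ in h1 *.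
  have X0 : 0 <= X by rewrite mulr_ge0// sqr_ge0.
  have h2 : X * (310 * l) ^+ 2 <= X * a by rewrite ler_wpM2l.
  have : 0 <= X * l ^+ 2 by rewrite mulr_ge0// sqr_ge0.
  lra.
have gy1 : al * enorm (grad f y) <= r / (98 * l).
  have n1 : 0 <= al * enorm (grad f y) by rewrite mulr_ge0 ?enorm_ge0 ?(ltW al0).
  have n2 : 0 <= r / (98 * l) by rewrite divr_ge0 ?mulr_ge0 ?(ltW r0) ?(ltW l0).
  by rewrite -ler_sqr ?nnegrE.
have xy : (A + al) * enorm (x - y) <= al * (4 * r).
  have -> : (A + al) * enorm (x - y) = enorm ((A + al) *: (x - y)).
    by rewrite enormZ gtr0_norm.
  rewrite (@sstm_query_sub _ _ _ _ y)// subrr scaler0 add0r enormZ gtr0_norm//.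
  rewrite ler_wpM2l ?(ltW al0)//.
  have -> : z - y = (z - xs) + - (y - xs) by rewrite opprB addrA subrK.
  by apply: le_trans (enormD _ _) _; rewrite enormN; lra.
have gxy : al * enorm (grad f x - grad f y) <= 4 * r / a.
  rewrite ler_pdivlMr//.
  have h := smooth xQ yQ.
  have h1 : al * enorm (grad f x - grad f y) * a <= a * L * al * enorm (x - y).
    have -> : a * L * al * enorm (x - y) = al * (L * enorm (x - y)) * a by ring.
    by rewrite ler_wpM2r ?(ltW a0)// ler_wpM2l ?(ltW al0).
  apply: le_trans h1 _; rewrite -(ler_pM2l A'0).
  have -> : (A + al) * (a * L * al * enorm (x - y)) =
    a * L * al * ((A + al) * enorm (x - y)) by ring.
  apply: (@le_trans _ _ (a * L * al * (al * (4 * r)))).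
    by rewrite ler_wpM2l// !mulr_ge0 ?(ltW a0) ?(ltW L0) ?(ltW al0).
  have -> : a * L * al * (al * (4 * r)) = a * L * al ^+ 2 * (4 * r) by ring.
  by rewrite ler_wpM2r// mulr_ge0// ltW.
have t1 : al * enorm q <= al * enorm (grad f y) + al * enorm (grad f x - grad f y).
  by rewrite -mulrDr ler_wpM2l ?(ltW al0)// enorm_leB.
have e98 : r / (98 * l) = r / l / 98 by field; rewrite gt_eqF.
rewrite e98 in gy1.
have rl0 : 0 <= r / l by rewrite divr_ge0 ?(ltW r0) ?(ltW l0).
(* It remains that 1/98 + 1/2000 <= 1/90. *)
have t2 : 4 * r / a <= r / l / 2000.
  rewrite ler_pdivrMr; last exact: a0.
  have h : r / l * (90 * 100 * l) <= r / l * a by rewrite ler_wpM2l.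
  have e : r / l * (90 * 100 * l) = r * (90 * 100).
    by field; rewrite gt_eqF.
  clear gy gy2 xy t1 gxy gy1 e98 F2 a1 ra.
  by rewrite e in h; lra.
have -> : r / (90 * l) = r / l / 90 by field; rewrite gt_eqF.
clear gy gy2 xy F2 a1 ra.
lra.
Qed.

Variables (b lam : R) (m g : 'rV[R]_d).
Hypotheses (b0 : 0 <= b) (alb : al * b <= r / (720 * l)) (lam0 : 0 < lam).
Hypotheses (alam : al * lam = r / (30 * l)) (mq : enorm (m - q) <= b).

(** In units of r / l, the gradient and the bias add up to 1/90 + 1/720 <= 1/60, half of al lam.
    This is the condition of [clip_residual_le]. *)
Lemma mean_le_half_clip : enorm m <= lam / 2.
Proof.
facts; have l0 : 0 < l by lra.
have rl : 0 < r / l by rewrite divr_gt0.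
rewrite -(ler_pM2l al0) mulrA alam.
have h1 : al * enorm m <= al * enorm q + al * b.
  rewrite -mulrDr ler_wpM2l ?(ltW al0)//.
  by apply: le_trans (enorm_leB m q) _; rewrite lerD2l.
have e90 : r / (90 * l) = r / l / 90 by field; rewrite gt_eqF.
have e720 : r / (720 * l) = r / l / 720 by field; rewrite gt_eqF.
have -> : r / (30 * l) = r / l / 30 by field; rewrite gt_eqF.
by move: grad_query_le alb h1; rewrite e90 e720; lra.
Qed.

Let c := clip g lam - m.
Let z' := z - al *: clip g lam.
Let y' := sstm_query A al y z'.

Lemma clip_step_le : al * enorm (clip g lam) <= r / 300.
Proof.
facts; have l0 : 0 < l by lra.
apply: (@le_trans _ _ (r / (30 * l))).
  by rewrite -alam ler_wpM2l ?(ltW al0)// enorm_clip_le// ltW.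
have rl : r * 10 <= r * l by rewrite ler_wpM2l// ltW.
rewrite ler_pdivrMr; last by rewrite mulr_gt0.
have -> : r / 300 * (30 * l) = r * l / 10 by field.
lra.
Qed.

(** One step moves z by at most r / 300, so the new point stays within 3 r of xs whatever the noise,
    and the descent inequality applies there. *)
Let y'Q : eball xs rho y'.
Proof.
facts; apply: inQ.
have -> : y' - xs = (A + al)^-1 *: (A *: (y - xs) + al *: (z' - xs)).
  by rewrite -(@sstm_query_sub _ _ _ _ xs)// scalerA mulVf// scale1r.
apply: enorm_convex => //; [exact: ltW|lra|].
have -> : z' - xs = (z - xs) + - (al *: clip g lam) by rewrite /z' addrAC.
apply: le_trans (enormD _ _) _; rewrite enormN enormZ gtr0_norm//.
by have := clip_step_le; lra.
Qed.

Lemma potential_step :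
  sstm_potential (A + al) y' z' <= sstm_potential A y z
  + al * (f x - f xs - dot q (x - xs)) - al * dot (clip g lam - q) (z - xs)
  + 51 / 100 * al ^+ 2 * enorm (clip g lam - q) ^+ 2.
Proof.
apply: (@sstm_potential_step _ _ (f xs) (f x) (f y) (f y') A al a L) => //.
- apply: le_trans ha; move: l10 => l10'.
  have : l * 10 <= l * l by rewrite ler_wpM2l//; lra.
  by rewrite exprMn expr2; lra.
- exact: (convex_le mu0 strconv xQ yQ).
- exact: (descent mu0 smooth strconv xQ y'Q).
Qed.

Lemma theta_split : enorm (clip g lam - q) ^+ 2 =
  enorm c ^+ 2 + 2 * dot c (m - q) + enorm (m - q) ^+ 2.
Proof.
have -> : clip g lam - q = c + (m - q) by rewrite /c addrA subrK.
by move: c (m - q) => u v; rewrite !enorm_sqr !(dotDl, dotDr) (dotC v u); ring.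
Qed.

Lemma theta_dot v : dot (clip g lam - q) v = dot c v + dot (m - q) v.
Proof.
have -> : clip g lam - q = c + (m - q) by rewrite /c addrA subrK.
by rewrite dotDl.
Qed.

Definition sstm_phi (r' A' : R) (y z : 'rV[R]_d) : R :=
  Num.sqrt (2 * sstm_potential A' y z + r' ^+ 2 / 100).

Let V0 A1 y1 z1 : 0 <= A1 -> 0 <= sstm_potential A1 y1 z1.
Proof.
move=> A10; rewrite addr_ge0 ?divr_ge0 ?sqr_ge0//.
by rewrite mulr_ge0// subr_ge0.
Qed.

Lemma sstm_phi_sqr A1 y1 z1 : 0 <= A1 ->
  sstm_phi r A1 y1 z1 ^+ 2 = 2 * sstm_potential A1 y1 z1 + r ^+ 2 / 100.
Proof.
move=> A10; rewrite sqr_sqrtr//; apply: addr_ge0.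
  by rewrite mulr_ge0 ?V0.
by rewrite divr_ge0 ?sqr_ge0.
Qed.

Lemma sstm_phi_ge A1 y1 z1 : 0 <= A1 -> r / 10 <= sstm_phi r A1 y1 z1.
Proof.
move=> A10; have r1 : 0 <= r / 10 by rewrite divr_ge0 ?(ltW r0).
rewrite -ler_sqr ?nnegrE ?sqrtr_ge0// sstm_phi_sqr//.
have := @V0 A1 y1 z1 A10; have -> : (r / 10) ^+ 2 = r ^+ 2 / 100 by field.
lra.
Qed.

Lemma enorm_le_phi A1 y1 z1 : 0 <= A1 -> enorm (z1 - xs) <= sstm_phi r A1 y1 z1.
Proof.
move=> A10; rewrite -ler_sqr ?nnegrE ?sqrtr_ge0 ?enorm_ge0// sstm_phi_sqr//.
have : 0 <= A1 * (f y1 - f xs) by rewrite mulr_ge0// subr_ge0.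
have : 0 <= r ^+ 2 by exact: sqr_ge0.
rewrite /sstm_potential; lra.
Qed.

Let phi := sstm_phi r A y z.

(** [phi_dir] and [phi_curv] are the linear and quadratic coefficients of the noise c in the
    increment of [sstm_phi], that is, those of the potential divided by phi. The factor 102/100 = 2
    * 51/100 comes from the product of noise and bias. *)
Definition phi_dir : 'rV[R]_d :=
  phi^-1 *: ((102 / 100 * al ^+ 2) *: (m - q) - al *: (z - xs)).
Definition phi_curv : R := 51 / 100 * al ^+ 2 / phi.

Let phip : 0 < phi.
Proof. by apply: lt_le_trans (sstm_phi_ge _ _ A0); rewrite divr_gt0. Qed.

Let iphi : phi^-1 <= 10 / r.
Proof.
rewrite -[10 / r]invrK lef_pV2 ?posrE ?invr_gt0 ?divr_gt0// invf_div.
exact: sstm_phi_ge.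
Qed.

(** Dividing by phi >= |z - xs| makes the direction of size al, whatever the position; the bias part
    adds less than al / 100. *)
Lemma phi_dir_le : enorm phi_dir <= 101 / 100 * al.
Proof.
facts; have l0 : 0 < l by lra.
rewrite /phi_dir enormZ gtr0_norm ?invr_gt0// mulrC ler_pdivrMr//.
apply: le_trans (enormD _ _) _; rewrite enormN !enormZ.
have c0 : 0 <= 102 / 100 * al ^+ 2 by rewrite mulr_ge0 ?sqr_ge0 ?divr_ge0.
rewrite (gtr0_norm al0) (ger0_norm c0).
have h1 : al * enorm (z - xs) <= al * phi.
  by rewrite ler_wpM2l ?(ltW al0)// enorm_le_phi.
have h2 : al ^+ 2 * enorm (m - q) <= al * (al * b).
  rewrite expr2 -mulrA ler_wpM2l ?(ltW al0)//.
  by rewrite ler_wpM2l ?(ltW al0).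
have h3 : al * (al * b) <= al * (phi / 720).
  rewrite ler_wpM2l ?(ltW al0)//; apply: le_trans alb _.
  have e720 : r / (720 * l) = r / l / 720 by field; rewrite gt_eqF.
  have hp := sstm_phi_ge y z A0; rewrite -/phi in hp.
  have rl : r / l <= r / 10 by rewrite ler_wpM2l ?(ltW r0)// lef_pV2// ?posrE.
  rewrite e720; lra.
have ap : 0 < al * phi by rewrite mulr_gt0.
lra.
Qed.

Lemma phi_curv_ge0 : 0 <= phi_curv.
Proof. by rewrite divr_ge0 ?(ltW phip)// mulr_ge0 ?sqr_ge0. Qed.

Lemma phi_curv_le : phi_curv <= 51 / 10 * al ^+ 2 / r.
Proof.
have -> : 51 / 10 * al ^+ 2 / r = 51 / 100 * al ^+ 2 * (10 / r) by field; rewrite gt_eqF.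
by rewrite ler_wpM2l// mulr_ge0 ?sqr_ge0.
Qed.

(** Concavity of the square root: phi' - phi <= (phi'^2 - phi^2) / (2 phi) = (V' - V) / phi.
    Convexity removes the gap term, and the bias term al b |z - xs| becomes al b after the
    division. *)
Lemma phi_step : sstm_phi r (A + al) y' z' - phi <=
  al * b + 51 / 10 * al ^+ 2 * b ^+ 2 / r
  + (dot c phi_dir + phi_curv * enorm c ^+ 2).
Proof.
set phi' := sstm_phi r (A + al) y' z'.
have h1 : phi' - phi <= (sstm_potential (A + al) y' z' - sstm_potential A y z) / phi.
  rewrite ler_pdivlMr//.
  have e1 : phi' ^+ 2 = 2 * sstm_potential (A + al) y' z' + r ^+ 2 / 100.
    by rewrite sstm_phi_sqr// ltW.
  have e2 : phi ^+ 2 = 2 * sstm_potential A y z + r ^+ 2 / 100.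
    by rewrite sstm_phi_sqr.
  have := sqr_ge0 (phi' - phi); rewrite sqrrB; lra.
apply: le_trans h1 _.
have gap := gap_le rho0 strconv xQ; rewrite -/q in gap.
have gx : f x - f xs - dot q (x - xs) <= 0.
  have : 0 <= mu / 2 * enorm (x - xs) ^+ 2.
    by rewrite mulr_ge0 ?sqr_ge0 ?divr_ge0 ?(ltW mu0).
  move: gap; lra.
have agx : al * (f x - f xs - dot q (x - xs)) <= 0.
  by rewrite mulr_ge0_le0// ltW.
have VS := potential_step; rewrite theta_split theta_dot in VS.
have du : - (al * dot (m - q) (z - xs)) <= al * b * phi.
  rewrite -mulrN -mulrA ler_wpM2l ?(ltW al0)//.
  have := dot_ge (m - q) (z - xs).
  have : enorm (m - q) * enorm (z - xs) <= b * phi.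
    by rewrite ler_pM ?enorm_ge0 ?enorm_le_phi.
  lra.
have e2 : enorm (m - q) ^+ 2 <= b ^+ 2 by rewrite ler_sqr ?nnegrE ?enorm_ge0.
have ae2 : al ^+ 2 * enorm (m - q) ^+ 2 <= al ^+ 2 * b ^+ 2.
  by rewrite ler_wpM2l ?sqr_ge0.
rewrite ler_pdivrMr//.
have -> : (al * b + 51 / 10 * al ^+ 2 * b ^+ 2 / r +
    (dot c phi_dir + phi_curv * enorm c ^+ 2)) * phi =
  al * b * phi + 51 / 100 * (al ^+ 2 * b ^+ 2) * (10 / r * phi)
  + (102 / 100 * al ^+ 2 * dot c (m - q) - al * dot c (z - xs))
  + 51 / 100 * al ^+ 2 * enorm c ^+ 2.
  rewrite /phi_dir /phi_curv; move: (m - q) (z - xs) => e u.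
  by rewrite !(dotZr, dotDr, dotNr); field; rewrite !gt_eqF.
have ab0 : 0 <= al ^+ 2 * b ^+ 2 by rewrite mulr_ge0 ?sqr_ge0.
have : al ^+ 2 * b ^+ 2 * 1 <= al ^+ 2 * b ^+ 2 * (10 / r * phi).
  rewrite ler_wpM2l// -ler_pdivrMr//.
  by rewrite mul1r.
move: VS du agx ae2; lra.
Qed.

Variable AK : R.
Hypothesis hAK : A + al <= AK.

(* The weight of the potential decreases from 3 AK / 2 to AK, at half the speed
   at which A grows: this makes the terms A (f y - f xs) of the potential and of
   the cross term cancel. *)
Definition sstm_weight (AK A' : R) := AK + (AK - A') / 2.

Definition sstm_mixed (AK A' : R) (y z : 'rV[R]_d) : R :=
  sstm_weight AK A' * sstm_potential A' y z - sstm_cross A' y z / 2.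

Let p := sstm_weight AK (A + al).

(** Linear coefficient of the noise in the increment of [sstm_mixed]: the part along x - xs comes
    from the cross term, the rest from p times the potential. *)
Definition mixed_dir : 'rV[R]_d :=
  (al * (A + al) / 2) *: (x - xs) - (p * al) *: (z - xs)
  + (102 / 100 * p * al ^+ 2) *: (m - q).
Definition mixed_curv : R := 51 / 100 * p * al ^+ 2.

Let AKp : 0 < AK. Proof. exact: lt_le_trans hAK. Qed.
Let pE : p = 3 / 2 * AK - (A + al) / 2. Proof. rewrite /p /sstm_weight; lra. Qed.
Let p_ge : AK <= p. Proof. by move: hAK; rewrite pE; lra. Qed.
Let p_le : p <= 3 / 2 * AK. Proof. by move: (A'0); rewrite pE; lra. Qed.
Let pp : 0 < p. Proof. exact: lt_le_trans p_ge. Qed.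

Let alb720 : al * b <= r / 720.
Proof.
apply: le_trans alb _; have l0 : 0 < l by move: l10; lra.
have e720 : r / (720 * l) = r / l / 720 by field; rewrite gt_eqF.
have rl : r / l <= r by rewrite ler_pdivrMr// ler_peMr ?(ltW r0)//; move: l10; lra.
by rewrite e720; lra.
Qed.

(** Since 2 p = 3 AK - (A + al), the two main parts add up to exactly 3 AK r al; the bias part fits
    in the remaining 1/100. *)
Lemma mixed_dir_le : enorm mixed_dir <= 301 / 100 * AK * r * al.
Proof.
have c0 : 0 <= 102 / 100 * p * al ^+ 2.
  by rewrite !mulr_ge0 ?invr_ge0 ?(ltW pp) ?(ltW al0).
have c1 : 0 <= al * (A + al) / 2 by rewrite divr_ge0 ?mulr_ge0 ?(ltW al0) ?(ltW A'0).
have c2 : 0 <= p * al by rewrite mulr_ge0 ?(ltW pp) ?(ltW al0).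
apply: le_trans (enormD _ _) _.
have h1 : enorm ((al * (A + al) / 2) *: (x - xs) - (p * al) *: (z - xs)) <=
    al * (A + al) / 2 * (2 * r) + p * al * (2 * r).
  apply: le_trans (enormD _ _) _; rewrite enormN !enormZ !ger0_norm//.
  by rewrite lerD// ler_wpM2l// query_ball.
have h2 : enorm ((102 / 100 * p * al ^+ 2) *: (m - q)) <=
    102 / 100 * (3 / 2 * AK) * (al * (r / 720)).
  rewrite enormZ ger0_norm//.
  apply: (@le_trans _ _ (102 / 100 * p * (al * (al * b)))).
    have -> : 102 / 100 * p * (al * (al * b)) = 102 / 100 * p * al ^+ 2 * b by ring.
    by rewrite ler_wpM2l.
  apply: ler_pM.
  - by rewrite !mulr_ge0 ?invr_ge0 ?(ltW pp).
  - by rewrite !mulr_ge0 ?(ltW al0).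
  - by rewrite ler_wpM2l ?divr_ge0.
  - by rewrite ler_wpM2l ?(ltW al0).
have e : al * (A + al) / 2 * (2 * r) + p * al * (2 * r) = 3 * (AK * r * al).
  by rewrite pE; field.
have ark : 0 <= AK * r * al by rewrite !mulr_ge0 ?(ltW AKp) ?(ltW r0) ?(ltW al0).
rewrite e in h1; lra.
Qed.

Lemma mixed_curv_ge0 : 0 <= mixed_curv.
Proof. by rewrite !mulr_ge0 ?invr_ge0 ?(ltW pp) ?(ltW al0). Qed.

Lemma mixed_curv_le : mixed_curv <= 77 / 100 * AK * al ^+ 2.
Proof. by rewrite ler_wpM2r ?sqr_ge0//; move: p_le (AKp); lra. Qed.

(** With U = |z - xs| and X = |x - xs|, the first two summands are the maxima of p b U - 3 U^2 / 4
    and of AK b X / 2 - AK mu X^2 / 4. Next, r^2 / 225 = r^2 / 900 + r^2 / 300 collects the errors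
    of [cvx] and [U'_ge] in [mixed_step], and the last term is the squared bias. *)
Definition mixed_drift : R :=
  al * (b ^+ 2 * p ^+ 2 / 3 + b ^+ 2 * AK / (4 * mu) + r ^+ 2 / 225)
  + 77 / 100 * AK * (al * b) ^+ 2.

(** The decreasing weight gives - al U^2 / 4, half of the cross term about - al U^2 / 2, and strong
    convexity at the query - al AK mu X^2 / 4. Completing squares, they absorb the bias terms p al b
    U and al AK b X / 2. *)
Lemma mixed_step :
  sstm_mixed AK (A + al) y' z' - sstm_mixed AK A y z <=
  mixed_drift + (dot c mixed_dir + mixed_curv * enorm c ^+ 2).
Proof.
set V := sstm_potential A y z; set V' := sstm_potential (A + al) y' z'.
set U := enorm (z - xs); set U' := enorm (z' - xs); set X := enorm (x - xs).
set F := f x - f xs; set P := dot q (x - xs); set gam := clip g lam.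
set E := enorm (m - q).
have U0 : 0 <= U by exact: enorm_ge0.
have U2 : U <= 2 * r by exact: zball.
have X0 : 0 <= X by exact: enorm_ge0.
have E0 : 0 <= E by exact: enorm_ge0.
have Eb : E <= b by exact: mq.
have pw : sstm_weight AK A = p + al / 2 by rewrite /p /sstm_weight; field.
have VS : V' <= V + al * (F - P) - al * (dot c (z - xs) + dot (m - q) (z - xs))
    + 51 / 100 * al ^+ 2 * (enorm c ^+ 2 + 2 * dot c (m - q) + E ^+ 2).
  by have := potential_step; rewrite theta_split theta_dot.
have WS : sstm_cross (A + al) y' z' - sstm_cross A y z =
    al * (U ^+ 2 + U' ^+ 2 + al ^+ 2 * enorm gam ^+ 2) / 2
    - al * (A + al) * (P + dot c (x - xs) + dot (m - q) (x - xs)).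
  rewrite /sstm_cross sstm_cross_step//; congr (_ - _ * _).
  rewrite -addrA -theta_dot -/gam dotDl dotNl -/P (dotC _ gam) -/x; ring.
have gap : F + mu / 2 * X ^+ 2 <= P by exact: (gap_le rho0 strconv xQ).
(* After the gap inequality at x is used, the function values left over are al / 2 times this
   difference. Convexity reduces it to al <q, z - xs>, which is small by [grad_query_le]. *)
have cvx : (A + al) * F - A * (f y - f xs) <= r ^+ 2 / 450.
  have h1 := convex_le mu0 strconv xQ yQ.
  have h2 : A * (f x + dot q (y - x)) <= A * f y by rewrite ler_wpM2l.
  have key : A * dot q (y - x) = al * P - al * dot q (z - xs).
    have := congr1 (dot q) (@sstm_query_sub _ _ A al xs y z A'n).
    rewrite -/x /P; move: (x) => x1.
    by rewrite !(dotDr, dotZr, dotNr); lra.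
  have h3 : al * dot q (z - xs) <= r / (90 * l) * (2 * r).
    apply: (@le_trans _ _ (al * enorm q * U)).
      by rewrite -mulrA ler_wpM2l ?(ltW al0)// dot_le.
    by rewrite ler_pM ?mulr_ge0 ?(ltW al0) ?enorm_ge0// grad_query_le.
  have h4 : r / (90 * l) * (2 * r) <= r ^+ 2 / 450.
    have l0 : 0 < l by move: l10; lra.
    have -> : r / (90 * l) * (2 * r) = r ^+ 2 / 45 * l^-1.
      by field; rewrite gt_eqF.
    have il : l^-1 <= 10^-1 by rewrite lef_pV2 ?posrE.
    have : r ^+ 2 / 45 * l^-1 <= r ^+ 2 / 45 * 10^-1.
      by rewrite ler_wpM2l// divr_ge0 ?sqr_ge0.
    by lra.
  have : 0 <= mu / 2 * X ^+ 2 by rewrite mulr_ge0 ?sqr_ge0 ?divr_ge0 ?(ltW mu0).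
  have := ler_wpM2l (ltW al0) gap.
  rewrite mulrDr key in h2 => h5 h6.
  have h7 : 0 <= al * (mu / 2 * X ^+ 2) by rewrite mulr_ge0 ?(ltW al0).
  rewrite /F in h5 *; lra.
(* The cross term brings in |z' - xs|^2, which depends on the noise; bounding it below by U^2 keeps
   the noise terms affine in c and |c|^2. *)
have U'_ge : U ^+ 2 - r ^+ 2 / 75 <= U' ^+ 2.
  have -> : U' ^+ 2 = U ^+ 2 - 2 * (al * dot gam (z - xs))
      + al ^+ 2 * enorm gam ^+ 2.
    have zE : z' - xs = (z - xs) - al *: gam by rewrite /z' addrAC.
    rewrite /U' zE /U; move: (z - xs) => u.
    by rewrite !enorm_sqr !(dotDl, dotDr, dotNl, dotNr, dotZl, dotZr) (dotC u); ring.
  have h1 : al * dot gam (z - xs) <= r / 300 * (2 * r).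
    apply: (@le_trans _ _ (al * enorm gam * U)).
      by rewrite -mulrA ler_wpM2l ?(ltW al0)// dot_le.
    by rewrite ler_pM ?mulr_ge0 ?(ltW al0) ?enorm_ge0// clip_step_le.
  have : 0 <= al ^+ 2 * enorm gam ^+ 2 by rewrite mulr_ge0 ?sqr_ge0.
  lra.
(* The coefficient left in front of the gap inequality is 3 AK / 2 - (A + al), which stays at least
   AK / 2 up to the last iteration. *)
have k_ge : AK / 2 <= p - (A + al) / 2 by move: hAK; rewrite pE; lra.
have gapk : (p - (A + al) / 2) * al * (F + mu / 2 * X ^+ 2) <=
    (p - (A + al) / 2) * al * P.
  by rewrite ler_wpM2l// mulr_ge0 ?(ltW al0)//; move: (AKp); lra.
have gapX : AK / 2 * (al * (mu / 2 * X ^+ 2)) <=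
    (p - (A + al) / 2) * (al * (mu / 2 * X ^+ 2)).
  by rewrite ler_wpM2r// !mulr_ge0 ?invr_ge0 ?(ltW al0) ?(ltW mu0).
have pVS := ler_wpM2l (ltW pp) VS.
have ac := ler_wpM2l (ltW al0) cvx.
have aU := ler_wpM2l (ltW al0) U'_ge.
have bU : - (p * al * dot (m - q) (z - xs)) <= p * al * (b * U).
  rewrite -mulrN ler_wpM2l ?mulr_ge0 ?(ltW pp) ?(ltW al0)//.
  have := dot_ge (m - q) (z - xs); rewrite -/E -/U.
  have : E * U <= b * U by rewrite ler_wpM2r.
  lra.
have bX : al * (A + al) * dot (m - q) (x - xs) <= al * AK * (b * X).
  apply: (@le_trans _ _ (al * (A + al) * (b * X))).
    rewrite ler_wpM2l ?mulr_ge0 ?(ltW al0) ?(ltW A'0)//.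
    by apply: le_trans (dot_le _ _) _; rewrite -/E -/X ler_wpM2r.
  by rewrite ler_wpM2r ?mulr_ge0// ler_wpM2l ?(ltW al0).
have sqU : 0 <= al * (3 / 4 * (U - 2 / 3 * (p * b)) ^+ 2).
  by rewrite mulr_ge0 ?(ltW al0)// mulr_ge0 ?divr_ge0 ?sqr_ge0.
have [T TE] : exists T, T = b ^+ 2 * AK / (4 * mu) by exists (b ^+ 2 * AK / (4 * mu)).
have sqX : 0 <= al * (AK * mu / 4 * X ^+ 2 - AK * b / 2 * X + T).
  rewrite mulr_ge0 ?(ltW al0)//.
  have -> : AK * mu / 4 * X ^+ 2 - AK * b / 2 * X + T =
    AK / (4 * mu) * (mu * X - b) ^+ 2 by rewrite TE; field; rewrite gt_eqF.
  by rewrite mulr_ge0 ?sqr_ge0// divr_ge0 ?mulr_ge0 ?(ltW AKp) ?(ltW mu0).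
have pE2 : p * (al ^+ 2 * E ^+ 2) <= 3 / 2 * AK * (al ^+ 2 * b ^+ 2).
  apply: ler_pM; [exact: ltW|by rewrite mulr_ge0 ?sqr_ge0|exact: p_le|].
  by rewrite ler_wpM2l ?sqr_ge0// ler_sqr ?nnegrE.
have AKb : 0 <= AK * (al ^+ 2 * b ^+ 2) by rewrite mulr_ge0 ?(ltW AKp)// mulr_ge0 ?sqr_ge0.
rewrite /sstm_mixed pw -/p -/V -/V' /mixed_drift -TE exprMn.
have -> : dot c mixed_dir = al * (A + al) / 2 * dot c (x - xs)
    - p * al * dot c (z - xs) + 102 / 100 * p * al ^+ 2 * dot c (m - q).
  rewrite /mixed_dir; move: (x - xs) (z - xs) (m - q) => v u e.
  by rewrite !(dotDr, dotNr, dotZr).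
rewrite /mixed_curv.
have ag : 0 <= al * (al ^+ 2 * enorm gam ^+ 2) by rewrite mulr_ge0 ?(ltW al0)// mulr_ge0 ?sqr_ge0.
have VE : V = A * (f y - f xs) + U ^+ 2 / 2 by [].
clear VS; move: V V' VE pVS => V V' VE pVS.
rewrite VE in pVS *.
have [W WE] : exists W, W = sstm_cross A y z by exists (sstm_cross A y z).
have [W' WE'] : exists W', W' = sstm_cross (A + al) y' z'.
  by exists (sstm_cross (A + al) y' z').
rewrite -WE -WE' in WS *.
clear U'_ge cvx gap pw WE WE'.
lra.
Qed.

End StageStep.

(** * One stage *)

Section ExponentialSupermartingale.
Context dT (T : measurableType dT) (R : realType) (P : probability T R).

Lemma measurable_fun_sigma_mono (F1 F2 : set (set T)) d' (Y : measurableType d')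
    (X : T -> Y) : F1 `<=` F2 ->
  measurable_fun [set: g_sigma_algebraType F1] (X : g_sigma_algebraType F1 -> Y) ->
  measurable_fun [set: g_sigma_algebraType F2] (X : g_sigma_algebraType F2 -> Y).
Proof.
move=> F12 mX mT B mB; have := mX measurableT B mB.
exact: sub_sigma_algebra2.
Qed.

Lemma measurable_fun_sigma_sub (F : set (set T)) d' (Y : measurableType d')
    (X : T -> Y) : F `<=` measurable ->
  measurable_fun [set: g_sigma_algebraType F] (X : g_sigma_algebraType F -> Y) ->
  measurable_fun [set: T] X.
Proof.
move=> Fm mX mT B mB; have := mX measurableT B mB.
exact: sigma_sub_measurable.
Qed.

Variables F H : nat -> set (set T).
Hypotheses (Fm : forall k, F k `<=` measurable) (Hm : forall k, H k `<=` measurable).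
Hypotheses (FT : forall k, F k setT) (HT : forall k, H k setT).
Hypotheses (FI : forall k, setI_closed (F k)) (HI : forall k, setI_closed (H k)).
Hypothesis indep : forall k A B, F k A -> H k B -> P (A `&` B) = (P A * P B)%E.

Local Notation TF k := (g_sigma_algebraType (F k)).
Local Notation TH k := (g_sigma_algebraType (H k)).

(** [Psi k w v] is the next value computed from the past of w and the fresh noise of v; the actual
    process is its restriction to the diagonal. *)
Variables (G : nat -> set T) (Phi : nat -> T -> R) (Psi : nat -> T -> T -> R).
Variables (s B0 : R) (C : nat -> R) (n : nat).
Hypothesis mG : forall k, (k <= n)%N -> (F k).-sigma.-measurable (G k).
Hypothesis Gdec : forall k, G k.+1 `<=` G k.
Hypothesis mPhi : forall k, (k <= n)%N -> measurable_fun [set: TF k] (Phi k : TF k -> R).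
Hypothesis mPsi : forall k, (k < n)%N ->
  measurable_fun [set: TF k * TH k] (fun p : TF k * TH k => Psi k p.1 p.2).
Hypothesis PhiS : forall k w, (k < n)%N -> Phi k.+1 w = Psi k w w.
Hypothesis C0 : C 0%N = 0.
Hypothesis hB0 : forall w, G 0%N w -> s * Phi 0%N w <= B0.
Hypothesis step : forall k w, (k < n)%N -> G k w ->
  (\int[P]_v (expR (s * (Psi k w v - Phi k w)))%:E <= (expR (C k.+1 - C k))%:E)%E.

Let E k j := (\int[P]_w (\1_(G k) w * expR (s * Phi j w))%:E)%E.

Let mGT k : (k <= n)%N -> measurable (G k).
Proof. by move=> kn; apply: (sigma_sub_measurable (@Fm k)); exact: mG. Qed.

Let mPhiT k : (k <= n)%N -> measurable_fun [set: T] (Phi k).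
Proof.
by move=> kn; apply: (measurable_fun_sigma_sub (@Fm k)); exact: mPhi.
Qed.

Let mexp (k j : nat) : (k <= n)%N -> (j <= n)%N -> measurable_fun [set: T]
  (fun w => (\1_(G k) w * expR (s * Phi j w))%:E).
Proof.
move=> kn jn; apply/measurable_EFinP; apply: measurable_funM.
  by apply: measurable_indic; exact: mGT.
apply: measurableT_comp; first exact: measurable_expR.
by apply: measurable_funM => //; exact: mPhiT.
Qed.

Let exp_ge0 (k j : nat) w : 0 <= \1_(G k) w * expR (s * Phi j w).
Proof. by rewrite mulr_ge0 ?expR_ge0// indicE ler0n. Qed.

(** [ge0_integral_diag] separates past and noise, and for a fixed past w in [G k] the hypothesis
    [step] bounds the integral over the noise. The indicator must be that of [G k]: it may depend on
    the past only. *)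
Let E_step k : (k < n)%N -> (E k k.+1 <= (expR (C k.+1 - C k))%:E * E k k)%E.
Proof.
move=> kn; have kn' := ltnW kn.
have mkk := mexp kn' kn'; have mkS := mexp kn' kn; have mPk := mPhiT kn'.
pose h (p : TF k * TH k) := (\1_(G k) p.1 * expR (s * Psi k p.1 p.2))%:E.
have mh : measurable_fun [set: TF k * TH k] h.
  apply/measurable_EFinP; apply: measurable_funM.
    apply: (measurableT_comp (f := (\1_(G k) : TF k -> R))).
      have mi : measurable_fun [set: TF k] (\1_(G k : set (TF k)) : TF k -> R).
        by apply: measurable_indic; exact: mG.
      exact: mi.
    exact: measurable_fst.
  apply: measurableT_comp; first exact: measurable_expR.
  apply: measurable_funM => //; exact: mPsi.
have h0 p : (0 <= h p)%E by rewrite lee_fin mulr_ge0 ?expR_ge0// indicE ler0n.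
have -> : E k k.+1 = (\int[P]_w h (w, w))%E.
  by apply: eq_integral => w _; rewrite /h/= PhiS.
rewrite (@ge0_integral_diag _ T R P (F k) (H k) (@Fm k) (@Hm k) (@FT k) (@HT k)
  (@FI k) (@HI k) (@indep k) h mh h0).
rewrite -ge0_integralZl//; apply: ge0_le_integral => //.
- by move=> w _; exact: integral_ge0.
- exact: (@measurable_integral_section _ T R P (F k) (H k) (@Fm k) (@Hm k) h mh h0).
- by apply: measurable_funeM.
move=> w _; rewrite /h/= indicE.
case: (boolP (w \in G k)) => wG; last first.
  by rewrite mul0r mule0; under eq_integral do rewrite mul0r; rewrite integral0.
rewrite mul1r muleC.
have mv : measurable_fun [set: T] (fun v => (expR (s * (Psi k w v - Phi k w)))%:E).
  apply/measurable_EFinP; apply: measurableT_comp; first exact: measurable_expR.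
  apply: measurable_funM => //; apply: measurable_funB => //.
  apply: (measurable_fun_sigma_sub (@Hm k)).
  by have := measurableT_comp (mPsi kn) (@pair1_measurable _ _ (TF k) (TH k) w).
have -> : (\int[P]_v (1%:R * expR (s * Psi k w v))%:E =
    (expR (s * Phi k w))%:E * \int[P]_v (expR (s * (Psi k w v - Phi k w)))%:E)%E.
  rewrite -ge0_integralZl//.
  apply: eq_integral => v _; rewrite -EFinM -expRD mul1r; congr (expR _)%:E.
  by ring.
apply: lee_wpmul2l; first by rewrite lee_fin expR_ge0.
by apply: step => //; rewrite inE in wG.
Qed.

Let E_le k : (k <= n)%N -> (E k k <= (expR (B0 + C k))%:E)%E.
Proof.
elim: k => [n0|k IH kn].
  have m00 := mexp n0 n0; rewrite C0 addr0 -(integral_prob_cst P); apply: ge0_le_integral => //.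
  move=> w _; rewrite lee_fin indicE; case: (boolP (w \in G 0%N)) => [|_].
    by rewrite inE mul1r => /hB0; rewrite ler_expR.
  by rewrite mul0r expR_ge0.
have mSS := mexp kn kn; have mkS := mexp (ltnW kn) kn.
apply: (@le_trans _ _ (E k k.+1)).
  apply: ge0_le_integral => //.
  move=> w _; rewrite lee_fin ler_wpM2r ?expR_ge0// !indicE ler_nat.
  case: (boolP (w \in G k.+1)) => //; rewrite inE => /Gdec wG.
  by rewrite mem_set.
apply: le_trans (@E_step k kn) _.
apply: (@le_trans _ _ ((expR (C k.+1 - C k))%:E * (expR (B0 + C k))%:E)%E).
  by apply: lee_wpmul2l; [rewrite lee_fin expR_ge0|exact/IH/ltnW].
by rewrite -EFinM -expRD lee_fin ler_expR; lra.
Qed.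

(** Chernoff's bound. Testing the next value on [G k], and not on [G k.+1], gives the probability of
    leaving at iteration k + 1 for the first time. *)
Lemma exp_supermartingale_tail k (B : R) : (k < n)%N -> 0 <= s ->
  (P (G k `&` [set w | B < Phi k.+1 w]%R) <= (expR (B0 + C k.+1 - s * B))%:E)%E.
Proof.
move=> kn s0; have kn' := ltnW kn; have mkS := mexp kn' kn.
have mB : measurable (G k `&` [set w | B < Phi k.+1 w]).
  apply: measurableI; first exact: mGT.
  by apply: measurable_lt_set => //; exact: mPhiT.
rewrite -[X in P X]setIT -integral_indic//.
apply: (@le_trans _ _ ((expR (- (s * B)))%:E * E k k.+1)%E).
  rewrite -ge0_integralZl//.
  apply: ge0_le_integral => //.
  - by apply/measurable_EFinP; exact: measurable_indic.
  - by apply: measurable_funeM.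
  move=> w _; rewrite -EFinM lee_fin !indicE.
  have [wB|wB] := boolP (w \in _ `&` _); last by rewrite mulr_ge0 ?expR_ge0// mulr_ge0 ?expR_ge0.
  move: wB; rewrite inE => -[wG /= wB].
  rewrite mem_set// mul1r -expRD -expR0 ler_expR.
  have : s * B <= s * Phi k.+1 w by rewrite ler_wpM2l// ltW.
  lra.
apply: (@le_trans _ _ ((expR (- (s * B)))%:E *
    ((expR (C k.+1 - C k))%:E * (expR (B0 + C k))%:E))%E).
  apply: lee_wpmul2l; first by rewrite lee_fin expR_ge0.
  apply: le_trans (@E_step k kn) _; apply: lee_wpmul2l; first by rewrite lee_fin expR_ge0.
  exact/E_le/ltnW.
by rewrite -!EFinM -!expRD lee_fin ler_expR; lra.
Qed.

End ExponentialSupermartingale.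

(** * The iterates as measurable functions of past and noise *)

Section ClippedSSTMIterates.
Context {R : realType} {d : nat}.
Implicit Types (a L : R) (lam : nat -> R).

Lemma alpha_sumS a L k :
  alpha_sum a L k.+1 = alpha_sum a L k + alpha a L k.+1.
Proof. by rewrite /alpha_sum big_ord_recr. Qed.

Lemma alpha_sum0 a L : alpha_sum a L 0 = 0.
Proof. by rewrite /alpha_sum big_ord1. Qed.

Lemma clipped_SSTM_S a L lam (g : nat -> 'rV[R]_d -> 'rV[R]_d) x0 k
    (s := clipped_SSTM a L lam g x0 k)
    (A := alpha_sum a L k) (al := alpha a L k.+1)
    (x := sstm_query A al (sstm_y s) (sstm_z s))
    (z' := sstm_z s - al *: clip (g k x) (lam k)) :
  clipped_SSTM a L lam g x0 k.+1 = SstmState x (sstm_query A al (sstm_y s) z') z'.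
Proof. by rewrite /= alpha_sumS. Qed.

Context dT (T : measurableType dT).
Variables (a L : R) (lam : nat -> R) (n : nat).
Variables (F H : nat -> set (set T)).
Hypotheses (Fmono : forall k, F k `<=` F k.+1) (HF : forall k, H k `<=` F k.+1).
Local Notation TF k := (g_sigma_algebraType (F k)).
Local Notation TH k := (g_sigma_algebraType (H k)).
Variables (X0 : T -> 'rV[R]_d) (est : nat -> 'rV[R]_d -> T -> 'rV[R]_d).
Hypothesis mX0 : vmeasurable (X0 : TF 0%N -> 'rV[R]_d).
Hypothesis mest : forall k, (k < n)%N ->
  measurable_fun [set: borel R d * TH k]
    (fun p : borel R d * TH k => est k p.1 p.2 : borel R d).

Definition sstm_iterate k w :=
  clipped_SSTM a L lam (fun k x => est k x w) (X0 w) k.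

Definition iterate_query k w := sstm_query (alpha_sum a L k) (alpha a L k.+1)
  (sstm_y (sstm_iterate k w)) (sstm_z (sstm_iterate k w)).

(** The sample point is split in two: w determines the iterates up to k, v only the estimate drawn
    at iteration k. *)
Definition next_z k w v := sstm_z (sstm_iterate k w) -
  alpha a L k.+1 *: clip (est k (iterate_query k w) v) (lam k).

Definition next_y k w v := sstm_query (alpha_sum a L k) (alpha a L k.+1)
  (sstm_y (sstm_iterate k w)) (next_z k w v).

Lemma sstm_iterateS k w : sstm_iterate k.+1 w =
  SstmState (iterate_query k w) (next_y k w w) (next_z k w w).
Proof. exact: clipped_SSTM_S. Qed.

Lemma vmeasurable_query d' (T' : measurableType d') (A al : R)
    (Y Z : T' -> 'rV[R]_d) : vmeasurable Y -> vmeasurable Z ->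
  vmeasurable (fun w => sstm_query A al (Y w) (Z w)).
Proof.
move=> mY mZ; rewrite /sstm_query; apply: vmeasurableZ => //.
by apply: vmeasurableD; apply: vmeasurableZ.
Qed.

Lemma vmeasurable_sigma_mono (F1 F2 : set (set T)) (X : T -> 'rV[R]_d) :
  F1 `<=` F2 -> vmeasurable (X : g_sigma_algebraType F1 -> 'rV[R]_d) ->
  vmeasurable (X : g_sigma_algebraType F2 -> 'rV[R]_d).
Proof.
by move=> F12 mX i; have := @measurable_fun_sigma_mono _ _ F1 F2 _ _ _ F12 (mX i).
Qed.

Section Pair.
Variables (k : nat) (kn : (k < n)%N).
Hypothesis my : vmeasurable ((fun w => sstm_y (sstm_iterate k w)) : TF k -> 'rV[R]_d).
Hypothesis mz : vmeasurable ((fun w => sstm_z (sstm_iterate k w)) : TF k -> 'rV[R]_d).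

Lemma vmeasurable_iterate_query :
  vmeasurable (iterate_query k : TF k -> 'rV[R]_d).
Proof. exact: vmeasurable_query. Qed.

Lemma vmeasurable_fst (X : TF k -> 'rV[R]_d) : vmeasurable X ->
  vmeasurable (fun p : TF k * TH k => X p.1).
Proof. by move=> mX i; apply: measurableT_comp (mX i) _; exact: measurable_fst. Qed.

Lemma vmeasurable_est_pair :
  vmeasurable (fun p : TF k * TH k => est k (iterate_query k p.1) p.2).
Proof.
apply: vmeasurable_borel.
apply: (measurableT_comp (f := fun p : borel R d * TH k => est k p.1 p.2 : borel R d)
  (mest kn) (g := fun p : TF k * TH k => (iterate_query k p.1 : borel R d, p.2))).
apply: measurable_fun_pair; last exact: measurable_snd.
apply: measurable_rV.
exact: (vmeasurable_fst (X := iterate_query k) vmeasurable_iterate_query).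
Qed.

Lemma vmeasurable_next_z :
  vmeasurable (fun p : TF k * TH k => next_z k p.1 p.2).
Proof.
apply: vmeasurableB; first exact: (vmeasurable_fst (X := fun w => sstm_z (sstm_iterate k w)) mz).
apply: vmeasurableZ => //; apply: vmeasurable_clip; exact: vmeasurable_est_pair.
Qed.

Lemma vmeasurable_next_y :
  vmeasurable (fun p : TF k * TH k => next_y k p.1 p.2).
Proof.
apply: vmeasurable_query; last exact: vmeasurable_next_z.
exact: (vmeasurable_fst (X := fun w => sstm_y (sstm_iterate k w)) my).
Qed.

Lemma vmeasurable_diag (X : TF k * TH k -> 'rV[R]_d) : vmeasurable X ->
  vmeasurable ((fun w => X (w, w)) : TF k.+1 -> 'rV[R]_d).
Proof.
move=> mX i; apply: measurableT_comp (mX i) _.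
apply: measurable_fun_pair.
- exact: (@measurable_fun_sigma_mono _ _ (F k) (F k.+1) _ (TF k) id).
- exact: (@measurable_fun_sigma_mono _ _ (H k) (F k.+1) _ (TH k) id).
Qed.

End Pair.

Lemma vmeasurable_iterate k : (k <= n)%N ->
  vmeasurable ((fun w => sstm_y (sstm_iterate k w)) : TF k -> 'rV[R]_d) /\
  vmeasurable ((fun w => sstm_z (sstm_iterate k w)) : TF k -> 'rV[R]_d).
Proof.
elim: k => [//|k IH kn]; have [my mz] := IH (ltnW kn); split.
- under eq_fun do rewrite sstm_iterateS.
  by apply: (vmeasurable_diag (X := fun p => next_y k p.1 p.2)); exact: vmeasurable_next_y.
- under eq_fun do rewrite sstm_iterateS.
  by apply: (vmeasurable_diag (X := fun p => next_z k p.1 p.2)); exact: vmeasurable_next_z.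
Qed.

End ClippedSSTMIterates.

(** * Closed forms and inequalities for the step sizes *)

Section StepSizes.
Context {R : realType}.
Variables (a L : R).
Hypotheses (a0 : 0 < a) (L0 : 0 < L).

Let aL0 : a * L != 0. Proof. by rewrite gt_eqF// mulr_gt0. Qed.

Lemma alphaE k : alpha a L k.+1 = k.+2%:R / (2 * (a * L)).
Proof. by rewrite /= mulrA. Qed.

Lemma alpha_gt0 k : 0 < alpha a L k.+1.
Proof. by rewrite alphaE divr_gt0// !mulr_gt0. Qed.

Lemma alpha_sumE k : alpha_sum a L k = k%:R * (k%:R + 3) / (4 * (a * L)).
Proof.
elim: k => [|k IH]; first by rewrite alpha_sum0 !mul0r.
rewrite alpha_sumS IH alphaE -[k.+2]addn2 -[k.+1]addn1 !natrD.
by field; apply/andP; split; rewrite gt_eqF.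
Qed.

Lemma alpha_sum_ge0 k : 0 <= alpha_sum a L k.
Proof.
rewrite alpha_sumE divr_ge0// ?mulr_ge0 ?addr_ge0 ?ler0n//.
all: exact: ltW.
Qed.

Lemma alpha_sum_mono i j : (i <= j)%N -> alpha_sum a L i <= alpha_sum a L j.
Proof.
move=> /subnKC <-; elim: (j - i)%N => [|m IH]; first by rewrite addn0.
rewrite addnS alpha_sumS; apply: le_trans IH _.
by rewrite lerDl ltW// alpha_gt0.
Qed.

(** In closed form this is (k + 2)^2 <= (k + 1) (k + 4). *)
Lemma alpha_sqr_le k :
  a * L * alpha a L k.+1 ^+ 2 <= alpha_sum a L k + alpha a L k.+1.
Proof.
rewrite -alpha_sumS alpha_sumE alphaE -[k.+2]addn2 -[k.+1]addn1 !natrD.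
set c := a * L; have c0 : 0 < c by rewrite mulr_gt0.
set x : R := k%:R; have x0 : 0 <= x by rewrite ler0n.
have -> : c * ((x + 2) / (2 * c)) ^+ 2 = (x + 2) ^+ 2 / (4 * c).
  by field; rewrite gt_eqF.
rewrite ler_pM2r ?invr_gt0 ?mulr_gt0//; nra.
Qed.

Lemma alpha_first : a * L * alpha a L 1 = 1.
Proof. by rewrite alphaE; field; apply/andP; split; rewrite gt_eqF. Qed.

(** In closed form (k + 2) (k + 5) <= 5/2 (k + 1) (k + 4), an equality at k = 0. *)
Lemma alpha_sum_ratio k :
  alpha_sum a L k.+1 + alpha a L k.+2 <= 5 / 2 * alpha_sum a L k.+1.
Proof.
rewrite -alpha_sumS !alpha_sumE -[k.+2]addn2 -[k.+1]addn1 !natrD.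
set c := a * L; have c0 : 0 < c by rewrite mulr_gt0.
set x : R := k%:R; have x0 : 0 <= x by rewrite ler0n.
rewrite mulrA ler_pM2r ?invr_gt0 ?mulr_gt0//; nra.
Qed.

End StepSizes.

Section StepMoment.
Context dT (T : measurableType dT) (R : realType) (P : probability T R).
Context {d : nat}.

Lemma exp_step_moment (g : T -> 'rV[R]_d) (psi : T -> R)
    (sg sigma lam s h nv D e : R) (v : 'rV[R]_d) :
  measurable_fun [set: T] (g : T -> borel R d) ->
  (forall i, P.-integrable [set: T] (fun w => (g w 0 i)%:E)) ->
  ('E_P[fun w => (enorm (g w - mean_vec P g) ^+ 2)%R] <= (sg ^+ 2)%:E)%E ->
  0 <= sg -> sg <= sigma ->
  0 < lam -> enorm (mean_vec P g) <= lam / 2 -> 0 <= s -> 0 <= h ->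
  enorm v <= nv ->
  s * (nv * (3 / 2 * lam) + h * (3 / 2 * lam) ^+ 2) <= 4 ->
  measurable_fun [set: T] psi ->
  (forall w, psi w <= D + (dot (clip (g w) lam - mean_vec P g) v
                          + h * enorm (clip (g w) lam - mean_vec P g) ^+ 2)) ->
  s * D + (s * (nv / (2 * lam) + h) + 7 * (s * (nv + h * (3 / 2 * lam))) ^+ 2)
            * sigma ^+ 2 <= e ->
  (\int[P]_w (expR (s * psi w))%:E <= (expR e)%:E)%E.
Proof.
move=> mg gi hvar sg0 sgs l0 hm s0 h0 hv hs mpsi hpsi he.
set m := mean_vec P g in hpsi *.
have nv0 : 0 <= nv by apply: le_trans hv; exact: enorm_ge0.
pose X w := dot (clip (g w) lam - m) v + h * enorm (clip (g w) lam - m) ^+ 2.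
have mX : measurable_fun [set: T] X.
  have mg' : vmeasurable (fun w => clip (g w) lam - m).
    apply: vmeasurableB; last exact: vmeasurable_cst.
    by apply: vmeasurable_clip; exact: vmeasurable_borel.
  apply: measurable_funD.
    by apply: measurable_dot => //; exact: vmeasurable_cst.
  by apply: measurable_funM => //; apply: measurable_funX; exact: measurable_enorm.
have mE (Z : T -> R) : measurable_fun [set: T] Z ->
    measurable_fun [set: T] (fun w => (expR (s * Z w))%:E).
  move=> mZ; apply/measurable_EFinP; apply: measurableT_comp.
    exact: measurable_expR.
  exact: measurable_funM.
have mEX := mE _ mX; have mEp := mE _ mpsi.
apply: (@le_trans _ _ (\int[P]_w ((expR (s * D))%:E * (expR (s * X w))%:E))%E).
  apply: ge0_le_integral => //.
  - by apply: measurable_funeM.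
  - move=> w _; rewrite -EFinM -expRD lee_fin ler_expR -mulrDr.
    by rewrite ler_wpM2l.
rewrite ge0_integralZl//.
have h1 := exp_clip_moment mg gi hvar l0 hm s0 h0 hv hs.
apply: (@le_trans _ _ ((expR (s * D))%:E * (expR
    ((s * (nv / (2 * lam) + h) + 7 * (s * (nv + h * (3 / 2 * lam))) ^+ 2)
     * sg ^+ 2))%:E)%E).
  by apply: lee_wpmul2l => //; rewrite lee_fin expR_ge0.
rewrite -EFinM -expRD lee_fin ler_expR; apply: le_trans he.
rewrite lerD2l; apply: ler_wpM2l; last first.
  by rewrite ler_sqr ?nnegrE// (le_trans sg0).
apply: addr_ge0; last by rewrite mulr_ge0// sqr_ge0.
by rewrite mulr_ge0// addr_ge0// divr_ge0// mulr_ge0// ltW.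
Qed.

End StepMoment.

Lemma sqr_mono (R : realType) (x y : R) : 0 <= x -> x <= y -> x ^+ 2 <= y ^+ 2.
Proof. by move=> x0 xy; rewrite ler_sqr ?nnegrE// (le_trans x0). Qed.

(** * Numerical bounds on the exponents *)

Section MomentExponents.
Context {R : realType}.
Variables (r l al lam sg n : R).
Hypotheses (r0 : 0 < r) (l10 : 10 <= l) (al0 : 0 < al) (n0 : 0 < n).
Hypothesis alam : al * lam = r / (30 * l).
Hypothesis hsg : (60 * 60 * al * sg) ^+ 2 * (n * l) <= r ^+ 2.

Let l0 : 0 < l. Proof. by move: l10; lra. Qed.
Let rn : r != 0. Proof. by rewrite gt_eqF. Qed.
Let ln0 : l != 0. Proof. by rewrite gt_eqF. Qed.
Let aln : al != 0. Proof. by rewrite gt_eqF. Qed.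
Let nn : n != 0. Proof. by rewrite gt_eqF. Qed.

Let q := l * al / r.
Let q0 : 0 < q. Proof. by rewrite divr_gt0 ?mulr_gt0. Qed.

Let lamE : lam = r / (30 * (l * al)).
Proof.
have -> : lam = al * lam / al by field.
by rewrite alam; field; apply/andP; split.
Qed.

Let il : l^-1 <= 10^-1. Proof. by rewrite lef_pV2 ?posrE. Qed.

(** Variance of one iteration in the units of the exponent; by [QE], n of them weigh at most l /
    3600^2 together. *)
Let Q := q ^+ 2 * sg ^+ 2.
Let Q0 : 0 <= Q. Proof. by rewrite mulr_ge0 ?sqr_ge0. Qed.

Let QE : (60 * 60) ^+ 2 * Q <= l / n.
Proof.
rewrite ler_pdivlMr//.
have -> : (60 * 60) ^+ 2 * Q * n = (60 * 60 * al * sg) ^+ 2 * (n * l) * (l / r ^+ 2).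
  by rewrite /Q /q; field.
have e : r ^+ 2 * (l / r ^+ 2) = l by field.
rewrite -[X in _ <= X]e; apply: ler_wpM2r hsg.
by rewrite divr_ge0 ?sqr_ge0 ?(ltW l0).
Qed.

(** The rate 30 l / r is the reciprocal of al lam, so the main part is the number 303/200. *)
Lemma phi_moment_bounded h : h <= 51 / 10 * al ^+ 2 / r ->
  30 * l / r * (101 / 100 * al * (3 / 2 * lam) + h * (3 / 2 * lam) ^+ 2) <= 4.
Proof.
move=> hh.
have h1 : h * (3 / 2 * lam) ^+ 2 <= 51 / 10 * al ^+ 2 / r * (3 / 2 * lam) ^+ 2.
  by rewrite ler_wpM2r ?sqr_ge0.
apply: (@le_trans _ _ (30 * l / r * (101 / 100 * al * (3 / 2 * lam)
    + 51 / 10 * al ^+ 2 / r * (3 / 2 * lam) ^+ 2))).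
  by rewrite ler_wpM2l ?lerD2l// divr_ge0 ?mulr_ge0 ?(ltW l0) ?(ltW r0).
have -> : 30 * l / r * (101 / 100 * al * (3 / 2 * lam)
    + 51 / 10 * al ^+ 2 / r * (3 / 2 * lam) ^+ 2) =
  303 / 200 + 153 / 400 * l^-1.
  by rewrite lamE; field; do ?[apply/andP; split].
by move: il; lra.
Qed.

(** The variance part is below 7300 Q <= l / (1000 n), and the squared bias is below 1 / (2 n)
    because al b <= 2 r / n and 1440 l <= n. Over n iterations only the linear bias term is of the
    order of the available margin. *)
Lemma phi_moment_exponent h b : 0 <= h -> h <= 51 / 10 * al ^+ 2 / r ->
  0 <= b -> al * b <= 2 * r / n -> 1440 * l <= n ->
  30 * l / r * (al * b + 51 / 10 * al ^+ 2 * b ^+ 2 / r)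
  + (30 * l / r * (101 / 100 * al / (2 * lam) + h)
     + 7 * (30 * l / r * (101 / 100 * al + h * (3 / 2 * lam))) ^+ 2) * sg ^+ 2
  <= 30 * l / r * b * al + (1 / 2 + l / 1000) / n.
Proof.
move=> h0 hh b0 alb ln.
have lam0 : 0 < lam by rewrite lamE divr_gt0 ?mulr_gt0.
have sp : 0 < 30 * l / r by rewrite divr_gt0 ?mulr_gt0.
have sh : 30 * l / r * h <= 153 / 10 * q ^+ 2.
  apply: (@le_trans _ _ (30 * l / r * (51 / 10 * al ^+ 2 / r))).
    by rewrite ler_wpM2l// ltW.
  have -> : 30 * l / r * (51 / 10 * al ^+ 2 / r) = 153 * q ^+ 2 * l^-1.
    by rewrite /q; field; apply/andP; split.
  have : 153 * q ^+ 2 * l^-1 <= 153 * q ^+ 2 * 10^-1.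
    by rewrite ler_wpM2l// mulr_ge0 ?sqr_ge0.
  lra.
have sal : 30 * l / r * (101 / 100 * al / (2 * lam)) = 909 / 2 * q ^+ 2.
  by rewrite lamE /q; field; do ?[apply/andP; split].
have shl : 30 * l / r * (101 / 100 * al + h * (3 / 2 * lam)) <= 311 / 10 * q.
  have h1 : h * (3 / 2 * lam) <= 51 / 10 * al ^+ 2 / r * (3 / 2 * lam).
    by rewrite ler_wpM2r // mulr_ge0 ?divr_ge0 ?(ltW lam0).
  apply: (@le_trans _ _ (30 * l / r * (101 / 100 * al
      + 51 / 10 * al ^+ 2 / r * (3 / 2 * lam)))).
    by apply: ler_wpM2l; [exact: ltW|rewrite lerD2l].
  have -> : 30 * l / r * (101 / 100 * al + 51 / 10 * al ^+ 2 / r * (3 / 2 * lam))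
      = 303 / 10 * q + 153 / 20 * q * l^-1.
    by rewrite lamE /q; field; do ?[apply/andP; split].
  have : 153 / 20 * q * l^-1 <= 153 / 20 * q * 10^-1.
    by rewrite ler_wpM2l// mulr_ge0 ?(ltW q0) ?divr_ge0.
  by move: (q0); lra.
have shl2 : (30 * l / r * (101 / 100 * al + h * (3 / 2 * lam))) ^+ 2 <=
    (311 / 10 * q) ^+ 2.
  apply: sqr_mono; last exact: shl.
  rewrite mulr_ge0 ?(ltW sp)// addr_ge0 ?mulr_ge0 ?divr_ge0 ?(ltW al0) ?(ltW lam0)//.
have key : (30 * l / r * (101 / 100 * al / (2 * lam) + h)
     + 7 * (30 * l / r * (101 / 100 * al + h * (3 / 2 * lam))) ^+ 2) * sg ^+ 2
    <= l / n / 1000.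
  apply: (@le_trans _ _ ((909 / 2 * q ^+ 2 + 153 / 10 * q ^+ 2
      + 7 * (311 / 10 * q) ^+ 2) * sg ^+ 2)).
    apply: ler_wpM2r; first exact: sqr_ge0.
    by rewrite mulrDr sal; move: sh shl2; lra.
  have -> : (909 / 2 * q ^+ 2 + 153 / 10 * q ^+ 2 + 7 * (311 / 10 * q) ^+ 2)
      * sg ^+ 2 = (909 / 2 + 153 / 10 + 7 * (311 / 10) ^+ 2) * Q.
    by rewrite /Q; field.
  by move: QE Q0; lra.
have ab2 : 30 * l / r * (51 / 10 * al ^+ 2 * b ^+ 2 / r) <= 1 / 2 / n.
  have h1 : (al * b) ^+ 2 <= (2 * r / n) ^+ 2.
    by apply: sqr_mono => //; rewrite mulr_ge0 ?(ltW al0).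
  have -> : 30 * l / r * (51 / 10 * al ^+ 2 * b ^+ 2 / r) =
      153 * l / r ^+ 2 * (al * b) ^+ 2 by field.
  apply: (@le_trans _ _ (153 * l / r ^+ 2 * (2 * r / n) ^+ 2)).
    by rewrite ler_wpM2l// divr_ge0 ?sqr_ge0 ?mulr_ge0 ?(ltW l0).
  have -> : 153 * l / r ^+ 2 * (2 * r / n) ^+ 2 = 612 * (l / n) / n.
    by field; apply/andP; split.
  rewrite ler_pM2r ?invr_gt0//.
  have ln1 : l / n <= 1 / 1440.
    rewrite ler_pdivrMr//; lra.
  lra.
have -> : (1 / 2 + l / 1000) / n = 1 / 2 / n + l / n / 1000 by field.
rewrite mulrDr; have -> : 30 * l / r * b * al = 30 * l / r * (al * b) by ring.
by move: key ab2; lra.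
Qed.

Variable AK : R.
Hypothesis AK0 : 0 < AK.
Let AKn : AK != 0. Proof. by rewrite gt_eqF. Qed.

Let s := 20 * l / (AK * r ^+ 2).
Let s0 : 0 < s. Proof. by rewrite divr_gt0 ?mulr_gt0 ?exprn_gt0. Qed.

(** The noise is at most 3/2 lam in norm and acts with a coefficient of about 3 AK r al, so the rate
    20 l / (AK r^2) leads to an exponent of about 3. *)
Lemma mixed_moment_bounded h : h <= 77 / 100 * AK * al ^+ 2 ->
  s * (301 / 100 * AK * r * al * (3 / 2 * lam) + h * (3 / 2 * lam) ^+ 2) <= 4.
Proof.
move=> hh.
have h1 : h * (3 / 2 * lam) ^+ 2 <= 77 / 100 * AK * al ^+ 2 * (3 / 2 * lam) ^+ 2.
  by rewrite ler_wpM2r ?sqr_ge0.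
apply: (@le_trans _ _ (s * (301 / 100 * AK * r * al * (3 / 2 * lam)
    + 77 / 100 * AK * al ^+ 2 * (3 / 2 * lam) ^+ 2))).
  by rewrite ler_wpM2l ?lerD2l// ltW.
have -> : s * (301 / 100 * AK * r * al * (3 / 2 * lam)
    + 77 / 100 * AK * al ^+ 2 * (3 / 2 * lam) ^+ 2) =
  301 / 100 + 77 / 2000 * l^-1.
  by rewrite lamE /s; field; do ?[apply/andP; split].
by move: il; lra.
Qed.

Lemma mixed_moment_exponent h : 0 <= h -> h <= 77 / 100 * AK * al ^+ 2 ->
  (s * (301 / 100 * AK * r * al / (2 * lam) + h)
     + 7 * (s * (301 / 100 * AK * r * al + h * (3 / 2 * lam))) ^+ 2) * sg ^+ 2
  <= l / n / 400.
Proof.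
move=> h0 hh.
have lam0 : 0 < lam by rewrite lamE divr_gt0 ?mulr_gt0.
have sh : s * h <= 77 / 50 * q ^+ 2.
  apply: (@le_trans _ _ (s * (77 / 100 * AK * al ^+ 2))).
    by rewrite ler_wpM2l// ltW.
  have -> : s * (77 / 100 * AK * al ^+ 2) = 77 / 5 * q ^+ 2 * l^-1.
    by rewrite /q /s; field; do ?[apply/andP; split].
  have : 77 / 5 * q ^+ 2 * l^-1 <= 77 / 5 * q ^+ 2 * 10^-1.
    by rewrite ler_wpM2l// mulr_ge0 ?sqr_ge0 ?divr_ge0.
  lra.
have sal : s * (301 / 100 * AK * r * al / (2 * lam)) = 903 * q ^+ 2.
  by rewrite lamE /q /s; field; do ?[apply/andP; split].
have shl : s * (301 / 100 * AK * r * al + h * (3 / 2 * lam)) <= 603 / 10 * q.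
  have h1 : h * (3 / 2 * lam) <= 77 / 100 * AK * al ^+ 2 * (3 / 2 * lam).
    by rewrite ler_wpM2r // mulr_ge0 ?divr_ge0 ?(ltW lam0).
  apply: (@le_trans _ _ (s * (301 / 100 * AK * r * al
      + 77 / 100 * AK * al ^+ 2 * (3 / 2 * lam)))).
    by apply: ler_wpM2l; [exact: ltW|rewrite lerD2l].
  have -> : s * (301 / 100 * AK * r * al + 77 / 100 * AK * al ^+ 2 * (3 / 2 * lam))
      = 301 / 5 * q + 77 / 100 * q * l^-1.
    by rewrite lamE /q /s; field; do ?[apply/andP; split].
  have : 77 / 100 * q * l^-1 <= 77 / 100 * q * 10^-1.
    by rewrite ler_wpM2l// mulr_ge0 ?(ltW q0) ?divr_ge0.
  by move: (q0); lra.
have shl2 : (s * (301 / 100 * AK * r * al + h * (3 / 2 * lam))) ^+ 2 <=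
    (603 / 10 * q) ^+ 2.
  apply: sqr_mono; last exact: shl.
  apply: mulr_ge0; first exact: ltW.
  apply: addr_ge0; last first.
    by apply: mulr_ge0 => //; apply: mulr_ge0; [lra|exact: ltW].
  by do 3?[apply: mulr_ge0; last exact: ltW]; lra.
apply: (@le_trans _ _ ((903 * q ^+ 2 + 77 / 50 * q ^+ 2
    + 7 * (603 / 10 * q) ^+ 2) * sg ^+ 2)).
  apply: ler_wpM2r; first exact: sqr_ge0.
  by rewrite mulrDr sal; move: sh shl2; lra.
have -> : (903 * q ^+ 2 + 77 / 50 * q ^+ 2 + 7 * (603 / 10 * q) ^+ 2)
    * sg ^+ 2 = (903 + 77 / 50 + 7 * (603 / 10) ^+ 2) * Q.
  by rewrite /Q; field.
by move: QE Q0; lra.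
Qed.

End MomentExponents.

(** The weight p decreases by al / 2, so p^3 decreases by at least 3 p^2 al / 2: the drift terms al
    p^2 / 3 telescope. *)
Lemma weight_cube_decrease (R : realType) (AK A al : R) : 0 <= al -> 0 <= sstm_weight AK (A + al) ->
  al * sstm_weight AK (A + al) ^+ 2 / 3 <=
  2 / 9 * (sstm_weight AK A ^+ 3 - sstm_weight AK (A + al) ^+ 3).
Proof.
move=> al0 hp; have -> : sstm_weight AK A = sstm_weight AK (A + al) + al / 2.
  by rewrite /sstm_weight; field.
set p := sstm_weight AK (A + al).
rewrite -/p in hp; clearbody p.
have h1 : 0 <= p * al ^+ 2 by rewrite mulr_ge0 ?sqr_ge0.
have h2 : 0 <= al ^+ 3 by rewrite exprn_ge0.
lra.
Qed.

(** On the left, the accumulated drift plus the initial value 3 AK r^2 / 4; on the right, the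
    threshold used for [sstm_mixed] less a margin of 7 AK r^2 / 100 for the noise. The factor 19/36
    is 2/9 ((3/2)^3 - 1), the telescoped sum of [weight_cube_decrease]. *)
Lemma mixed_margin (R : realType) (r mu AK b : R) :
  0 < r -> 0 < mu -> 0 < AK -> 0 <= b -> 5 <= mu * AK -> b * AK <= 15 / 16 * r ->
  b <= 5 / 32 * mu * r ->
  19 / 36 * b ^+ 2 * AK ^+ 3 + b ^+ 2 * AK / (4 * mu) * AK + AK * r ^+ 2 / 225
  + 3 / 4 * AK * r ^+ 2 + AK * r ^+ 2 / 4000
  <= AK * r ^+ 2 * (mu * AK / 4 - 1 / 16) - 7 / 100 * AK * r ^+ 2.
Proof.
move=> r0 mu0 AK0 b0; set u := mu * AK => u5; set v := b * AK => v1 b1.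
have u0 : 0 < u by lra.
have v0 : 0 <= v by rewrite mulr_ge0// ltW.
have v2 : v <= 5 / 32 * u * r.
  have : b * AK <= 5 / 32 * mu * r * AK by rewrite ler_wpM2r// ltW.
  by rewrite /v /u; lra.
have -> : b ^+ 2 * AK / (4 * mu) * AK = AK * (v ^+ 2 * (1 / (4 * u))).
  by rewrite /v /u; field; do ?[apply/andP; split]; rewrite gt_eqF.
have -> : 19 / 36 * b ^+ 2 * AK ^+ 3 = AK * (19 / 36 * v ^+ 2) by rewrite /v; field.
clearbody u v.
have iu : 1 / (4 * u) <= 1 / 20.
  by rewrite ler_pdivrMr; lra.
have vv0 := sqr_ge0 v.
have vu : v ^+ 2 * (1 / (4 * u)) <= v ^+ 2 * (1 / 20) by rewrite ler_wpM2l.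
suff h : 19 / 36 * v ^+ 2 + v ^+ 2 * (1 / 20) <= r ^+ 2 * (u / 4 - 888 / 1000).
  have h2 : AK * (19 / 36 * v ^+ 2 + v ^+ 2 * (1 / (4 * u))) <=
      AK * (r ^+ 2 * (u / 4 - 888 / 1000)).
    by rewrite ler_wpM2l ?(ltW AK0)//; lra.
  have : 0 <= AK * r ^+ 2 by rewrite mulr_ge0 ?(ltW AK0) ?sqr_ge0.
  lra.
have rr : 0 < r ^+ 2 by rewrite exprn_gt0.
(* The two bounds on v = b AK, namely 5 u r / 32 and 15 r / 16, cross at u = 6. Below it, u^2 <= 11
   u - 30 on [5, 6] linearizes the first one. *)
have [u6|u6] := leP u 6.
  have h1 : v ^+ 2 <= (5 / 32 * u * r) ^+ 2 by apply: sqr_mono.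
  have h2 : r ^+ 2 * u ^+ 2 <= r ^+ 2 * (11 * u - 30).
    by rewrite ler_wpM2l ?(ltW rr)//; nra.
  have h3 : r ^+ 2 * 5 <= r ^+ 2 * u by rewrite ler_wpM2l ?(ltW rr).

  lra.
have h1 : v ^+ 2 <= (15 / 16 * r) ^+ 2 by apply: sqr_mono.
have h3 : r ^+ 2 * 6 <= r ^+ 2 * u by rewrite ler_wpM2l ?(ltW rr)// ltW.
lra.
Qed.

(** * Failure probability of one stage *)

Section StageTail.
Context {R : realType} {d : nat}.
Variables (f : 'rV[R]_d -> R) (xs : 'rV[R]_d) (rho L mu : R).
Hypotheses (rho0 : 0 <= rho) (L0 : 0 < L) (mu0 : 0 < mu).
Hypothesis fmin : forall x, f xs <= f x.
Hypothesis smooth : forall x y, eball xs rho x -> eball xs rho y ->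
  enorm (grad f x - grad f y) <= L * enorm (x - y).
Hypothesis gradbound : forall x, eball xs rho x ->
  enorm (grad f x) ^+ 2 <= 2 * L * (f x - inf (f @` eball xs rho)).
Hypothesis strconv : forall x y, eball xs rho x -> eball xs rho y ->
  f x + dot (grad f x) (y - x) + mu / 2 * enorm (x - y) ^+ 2 <= f y.
Hypothesis fcont : continuous f.

Context dT (T : measurableType dT) (P : probability T R).
Variables F H : nat -> set (set T).
Hypotheses (Fm : forall k, F k `<=` measurable) (Hm : forall k, H k `<=` measurable).
Hypotheses (FT : forall k, F k setT) (HT : forall k, H k setT).
Hypotheses (FI : forall k, setI_closed (F k)) (HI : forall k, setI_closed (H k)).
Hypothesis indep : forall k A B, F k A -> H k B -> P (A `&` B) = (P A * P B)%E.
Hypotheses (Fmono : forall k, F k `<=` F k.+1) (HF : forall k, H k `<=` F k.+1).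
Local Notation TF k := (g_sigma_algebraType (F k)).
Local Notation TH k := (g_sigma_algebraType (H k)).

Variables (a : R) (lam : nat -> R) (n : nat).
Variables (X0 : T -> 'rV[R]_d) (est : nat -> 'rV[R]_d -> T -> 'rV[R]_d).
Hypothesis mX0 : vmeasurable (X0 : TF 0%N -> 'rV[R]_d).
Hypothesis mest : forall k, (k < n)%N ->
  measurable_fun [set: borel R d * TH k]
    (fun p : borel R d * TH k => est k p.1 p.2 : borel R d).
Variables (bk sk : nat -> R) (b sg : R).
Hypothesis hbv : forall k, (k < n)%N -> bias_variance P f (est k) (bk k) (sk k).
Hypothesis hbk : forall k, (k < n)%N -> bk k <= b.
Hypothesis hsk : forall k, (k < n)%N -> 0 <= sk k <= sg.

Variables (r l : R).
Hypotheses (r0 : 0 < r) (rrho : 3 * r <= rho) (l10 : 10 <= l).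
Hypotheses (ha : (310 * l) ^+ 2 <= a) (n0 : (0 < n)%N) (hln : 1440 * l <= n%:R).
Hypothesis b0 : 0 <= b.

Local Notation A k := (alpha_sum a L k).
Local Notation al k := (alpha a L k.+1).
Hypothesis hlam : forall k, (k < n)%N -> al k * lam k = r / (30 * l).
Hypothesis halb : forall k, (k < n)%N -> al k * b <= 2 * r / n%:R.
Hypothesis hsg : forall k, (k < n)%N ->
  (60 * 60 * al k * sg) ^+ 2 * (n%:R * l) <= r ^+ 2.
Hypothesis hbA : b * A n <= 15 / 16 * r.

Let a0 : 0 < a.
Proof. by apply: lt_le_trans ha; apply: exprn_gt0; move: l10; lra. Qed.
Let l0 : 0 < l. Proof. by move: l10; lra. Qed.
Let np : 0 < n%:R :> R. Proof. by rewrite ltr0n. Qed.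
Let A0 k : 0 <= A k. Proof. exact: alpha_sum_ge0. Qed.
Let al0 k : 0 < al k. Proof. exact: alpha_gt0. Qed.
Let AS k : A k.+1 = A k + al k. Proof. exact: alpha_sumS. Qed.
Let lamp k : (k < n)%N -> 0 < lam k.
Proof.
move=> kn; rewrite -(pmulr_rgt0 _ (al0 k)) hlam//.
by rewrite divr_gt0 ?mulr_gt0.
Qed.
Let halb720 k : (k < n)%N -> al k * b <= r / (720 * l).
Proof.
move=> kn; apply: le_trans (halb kn) _.
rewrite ler_pdivrMr//; have -> : r / (720 * l) * n%:R = r / l / 720 * n%:R.
  by field; rewrite gt_eqF.
have h : r / l / 720 * (1440 * l) <= r / l / 720 * n%:R.
  apply: ler_wpM2l; last exact: hln.
  by apply: divr_ge0; [rewrite divr_ge0 ?(ltW r0) ?(ltW l0)|lra].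
have e : r / l / 720 * (1440 * l) = 2 * r by field; rewrite gt_eqF.
by rewrite -e.
Qed.

Local Notation itr := (sstm_iterate a L lam X0 est).
Local Notation yk k w := (sstm_y (itr k w)).
Local Notation zk k w := (sstm_z (itr k w)).
Local Notation ny := (next_y a L lam X0 est).
Local Notation nz := (next_z a L lam X0 est).
Local Notation xq := (iterate_query a L lam X0 est).

Definition stage_phi k w := sstm_phi f xs r (A k) (yk k w) (zk k w).

(** Level 0 is the event that the stage starts within r, stronger than a bound on [stage_phi];
    failure probabilities are counted inside it. *)
Fixpoint stage_good k : set T :=
  if k is k'.+1 then stage_good k' `&` [set w | stage_phi k'.+1 w <= 2 * r]
  else [set w | enorm (X0 w - xs) <= r].

Lemma stage_good_phi k w : stage_good k w -> stage_phi k w <= 2 * r.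
Proof.
case: k => [/= h|k []//].
have e : stage_phi 0 w ^+ 2 = enorm (X0 w - xs) ^+ 2 + r ^+ 2 / 100.
  rewrite /stage_phi sstm_phi_sqr// /sstm_potential alpha_sum0 mul0r add0r/=.
  by field.
have h2 : enorm (X0 w - xs) ^+ 2 <= r ^+ 2 by apply: sqr_mono; rewrite ?enorm_ge0.
rewrite -ler_sqr ?nnegrE ?sqrtr_ge0 ?mulr_ge0 ?(ltW r0)//.
rewrite e; have := sqr_ge0 r; lra.
Qed.

Lemma stage_good_mono k k' w : (k' <= k)%N -> stage_good k w -> stage_good k' w.
Proof.
elim: k => [|k IH]; first by rewrite leqn0 => /eqP ->.
by rewrite leq_eqVlt => /orP[/eqP -> //|kk [g _]]; exact: IH.
Qed.

(** [stage_phi] controls z and the potential directly. The point y is treated by induction, being an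
    average of the previous y and the new z. *)
Lemma stage_good_ball k w : stage_good k w ->
  [/\ enorm (yk k w - xs) <= 2 * r, enorm (zk k w - xs) <= 2 * r &
      sstm_potential f xs (A k) (yk k w) (zk k w) <= 2 * r ^+ 2].
Proof.
move=> g; have hp := stage_good_phi g.
have hz : enorm (zk k w - xs) <= 2 * r.
  by apply: le_trans hp; exact: enorm_le_phi.
split => //; last first.
  have := sqr_mono (sqrtr_ge0 _) hp.
  rewrite sstm_phi_sqr//; have := sqr_ge0 r; lra.
elim: k g {hp} hz => [/= h _|k IH g hz]; first by move: (r0); lra.
case: (g) => g' _.
have hzk : enorm (zk k w - xs) <= 2 * r.
  by apply: le_trans (stage_good_phi g'); exact: enorm_le_phi.
move: hz; rewrite sstm_iterateS /= => hz.
(* The new y is a query point formed with the new z, so the lemma on queries applies to it. *)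
rewrite /next_y; apply: query_ball => //; exact: IH.
Qed.

Let start k w : (A k = 0 /\ yk k w = zk k w /\ a * L * al k = 1) \/
  (A k + al k <= 5 / 2 * A k).
Proof.
case: k => [|k]; last by right; exact: alpha_sum_ratio.
by left; rewrite alpha_sum0 alpha_first.
Qed.

Lemma measurable_sstm_potential d' (T' : measurableType d') (A1 : R)
    (Y Z : T' -> 'rV[R]_d) : vmeasurable Y -> vmeasurable Z ->
  measurable_fun [set: T'] (fun w => sstm_potential f xs A1 (Y w) (Z w)).
Proof.
move=> mY mZ; apply: measurable_funD.
  apply: measurable_funM => //; apply: measurable_funB => //.
  exact: measurable_continuous_comp.
apply: measurable_funM => //; apply: measurable_funX; apply: measurable_enorm.
by apply: vmeasurableB => //; exact: vmeasurable_cst.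
Qed.

Lemma measurable_sstm_phi d' (T' : measurableType d') (A1 : R)
    (Y Z : T' -> 'rV[R]_d) : 0 <= A1 -> vmeasurable Y -> vmeasurable Z ->
  measurable_fun [set: T'] (fun w => sstm_phi f xs r A1 (Y w) (Z w)).
Proof.
move=> A10 mY mZ; apply: measurable_sqrt => [w|].
  have : 0 <= A1 * (f (Y w) - f xs) by rewrite mulr_ge0// subr_ge0.
  by rewrite /sstm_potential; have := sqr_ge0 r; have := sqr_ge0 (enorm (Z w - xs)); lra.
apply: measurable_funD => //; apply: measurable_funM => //.
exact: measurable_sstm_potential.
Qed.

Lemma measurable_sstm_cross d' (T' : measurableType d') (A1 : R)
    (Y Z : T' -> 'rV[R]_d) : vmeasurable Y -> vmeasurable Z ->
  measurable_fun [set: T'] (fun w => sstm_cross xs A1 (Y w) (Z w)).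
Proof.
move=> mY mZ; apply: measurable_dot.
  apply: vmeasurableZ => //.
  by apply: vmeasurableB => //; exact: vmeasurable_cst.
by apply: vmeasurableB => //; exact: vmeasurable_cst.
Qed.

Lemma measurable_sstm_mixed d' (T' : measurableType d') (AK A1 : R)
    (Y Z : T' -> 'rV[R]_d) : vmeasurable Y -> vmeasurable Z ->
  measurable_fun [set: T'] (fun w => sstm_mixed f xs AK A1 (Y w) (Z w)).
Proof.
move=> mY mZ; apply: measurable_funB.
  by apply: measurable_funM => //; exact: measurable_sstm_potential.
by apply: measurable_funM => //; exact: measurable_sstm_cross.
Qed.

Let mit k : (k <= n)%N -> vmeasurable ((fun w => yk k w) : TF k -> 'rV[R]_d) /\
  vmeasurable ((fun w => zk k w) : TF k -> 'rV[R]_d).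
Proof. by move=> kn; exact: (@vmeasurable_iterate _ _ _ _ a L lam n F H). Qed.

Let mny k : (k < n)%N -> vmeasurable (fun p : TF k * TH k => ny k p.1 p.2).
Proof.
by move=> kn; have [my mz] := mit (ltnW kn); exact: (@vmeasurable_next_y _ _ _ _ a L lam n F H).
Qed.

Let mnz k : (k < n)%N -> vmeasurable (fun p : TF k * TH k => nz k p.1 p.2).
Proof.
by move=> kn; have [my mz] := mit (ltnW kn); exact: (@vmeasurable_next_z _ _ _ _ a L lam n F H).
Qed.

Lemma measurable_stage_good k : (k <= n)%N ->
  (F k).-sigma.-measurable (stage_good k : set (TF k)).
Proof.
elim: k => [_|k IH kn].
  apply: (@measurable_le_set _ _ (TF 0%N) (fun w => enorm (X0 w - xs)) (cst r)) => //.
  by apply: measurable_enorm; apply: vmeasurableB => //; exact: vmeasurable_cst.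
have [my mz] := mit kn.
apply: (@measurableI _ (TF k.+1)).
  exact: (sub_sigma_algebra2 (@Fmono k) (IH (ltnW kn))).
apply: (@measurable_le_set _ _ (TF k.+1) (stage_phi k.+1) (cst (2 * r))) => //.
exact: measurable_sstm_phi.
Qed.

(* Exponential rate of the supermartingale built on [stage_phi]. *)
Let s := 30 * l / r.
Let sp : 0 < s. Proof. by rewrite divr_gt0 ?mulr_gt0. Qed.

Let mest1 k x : (k < n)%N -> measurable_fun [set: T] (est k x : T -> borel R d).
Proof.
move=> kn; apply: (measurable_fun_sigma_sub (@Hm k)).
exact: (measurableT_comp (mest kn) (@pair1_measurable _ _ (borel R d) (TH k) x)).
Qed.

Let Psi1 k w v := sstm_phi f xs r (A k + al k) (ny k w v) (nz k w v).

Let mPsi1 k : (k < n)%N ->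
  measurable_fun [set: TF k * TH k] (fun p : TF k * TH k => Psi1 k p.1 p.2).
Proof.
move=> kn; apply: measurable_sstm_phi; [|exact: mny|exact: mnz].
by rewrite addr_ge0 ?A0 ?(ltW (al0 k)).
Qed.

Let msection (Psi : T -> T -> R) k w :
  measurable_fun [set: TF k * TH k] (fun p : TF k * TH k => Psi p.1 p.2) ->
  measurable_fun [set: T] (Psi w).
Proof.
move=> m; apply: (measurable_fun_sigma_sub (@Hm k)).
exact: (measurableT_comp m (@pair1_measurable _ _ (TF k) (TH k) w)).
Qed.

Let mean_bias k x : (k < n)%N -> enorm (mean_vec P (est k x) - grad f x) <= b.
Proof.
move=> kn; have [_ h _] := hbv kn x.
exact: le_trans h (hbk kn).
Qed.

(** Accumulated exponent: the linear bias terms telescope to A_k, and the remaining terms are the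
    same at every iteration. *)
Let Cphi k := s * b * A k + (1 / 2 + l / 1000) / n%:R * k%:R.

Lemma stage_phi_moment k w : (k < n)%N -> stage_good k w ->
  (\int[P]_v (expR (s * (Psi1 k w v - stage_phi k w)))%:E
     <= (expR (Cphi k.+1 - Cphi k))%:E)%E.
Proof.
move=> kn g; have [yb zb Vb] := stage_good_ball g.
have mb := mean_bias (xq k w) kn.
have [gi _ gv] := hbv kn (xq k w).
have /andP[sk0 sks] := hsk kn.
pose v := phi_dir f xs r (A k) (al k) (yk k w) (zk k w) (mean_vec P (est k (xq k w))).
pose h := phi_curv f xs r (A k) (al k) (yk k w) (zk k w).
have h0 : 0 <= h by exact: phi_curv_ge0.
have hh : h <= 51 / 10 * al k ^+ 2 / r by exact: phi_curv_le.
have hv : enorm v <= 101 / 100 * al k.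
  by apply: (phi_dir_le L0 fmin r0 rrho l10 ha (A0 k) (al0 k) _ yb zb (halb720 kn) mb);
    exact: alpha_sqr_le.
apply: (exp_step_moment (mest1 _ kn) gi gv sk0 sks (lamp kn) _ (ltW sp) h0 hv
  (D := al k * b + 51 / 10 * al k ^+ 2 * b ^+ 2 / r)).
- apply: (mean_le_half_clip rho0 L0 fmin smooth gradbound r0 rrho l10 ha (A0 k)
    (al0 k) _ (start k w) yb zb Vb (halb720 kn) (hlam kn) mb).
  exact: alpha_sqr_le.
- exact: phi_moment_bounded (hlam kn) _ hh.
- by apply: measurable_funB => //; apply: msection; exact: mPsi1.
- move=> u; rewrite /stage_phi /Psi1.
  apply: (phi_step rho0 L0 mu0 fmin smooth strconv r0 rrho l10 ha (A0 k)
    (al0 k) _ yb zb (est k (xq k w) u) b0 (lamp kn) (hlam kn) mb).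
  exact: alpha_sqr_le.
- apply: le_trans (phi_moment_exponent r0 l10 (al0 k) np (hlam kn) (hsg kn) h0 hh
    b0 (halb kn) hln) _.
  rewrite /Cphi AS -[k.+1]addn1 natrD -/s; lra.
Qed.

(** The exponent is at most 30.15 l from the start, 28.125 l from the bias and 1/2 + l / 1000 from
    the noise, against 60 l at level 2 r; since l >= 10, this is below - l. *)
Lemma stage_phi_tail k : (k < n)%N ->
  (P (stage_good k `&` [set w | 2 * r < stage_phi k.+1 w]%R) <= (expR (- l))%:E)%E.
Proof.
move=> kn.
have C00 : Cphi 0 = 0 by rewrite /Cphi alpha_sum0 !mulr0 addr0.
have start0 w : stage_good 0 w -> s * stage_phi 0 w <= 30 * l * (201 / 200).
  move=> g.
  have e : stage_phi 0 w ^+ 2 = enorm (X0 w - xs) ^+ 2 + r ^+ 2 / 100.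
    rewrite /stage_phi sstm_phi_sqr// /sstm_potential alpha_sum0 mul0r add0r/=.
    by field.
  have h2 : enorm (X0 w - xs) ^+ 2 <= r ^+ 2 by apply: sqr_mono; rewrite ?enorm_ge0.
  have h3 : stage_phi 0 w <= 201 / 200 * r.
    have p : 0 <= 201 / 200 * r by move: (r0); lra.
    rewrite -(@ler_pXn2r _ 2)// ?nnegrE ?sqrtr_ge0// e; have := sqr_ge0 r; lra.
  apply: (@le_trans _ _ (s * (201 / 200 * r))).
    by apply: ler_wpM2l; [exact: ltW|exact: h3].
  by rewrite /s le_eqVlt; apply/orP; left; apply/eqP; field; rewrite gt_eqF.
have mg k' : (k' <= n)%N -> (F k').-sigma.-measurable (stage_good k').
  exact: measurable_stage_good.
have gd k' : stage_good k'.+1 `<=` stage_good k' by move=> w [].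
have mp k' : (k' <= n)%N -> measurable_fun [set: TF k'] (stage_phi k' : TF k' -> R).
  by move=> kn'; have [my mz] := mit kn'; exact: measurable_sstm_phi.
have PS k' w : (k' < n)%N -> stage_phi k'.+1 w = Psi1 k' w w.
  by move=> _; rewrite /stage_phi /Psi1 sstm_iterateS AS.
have tail := exp_supermartingale_tail Fm Hm FT HT FI HI indep mg gd mp mPsi1 PS
  C00 start0 stage_phi_moment (2 * r) kn (ltW sp).
apply: le_trans tail _; rewrite lee_fin ler_expR.
have h1 : s * b * A k.+1 <= 30 * l * (15 / 16).
  apply: (@le_trans _ _ (s * (15 / 16 * r))).
    rewrite -mulrA; apply: ler_wpM2l; first exact: ltW.
    apply: le_trans hbA; apply: ler_wpM2l => //.
    by apply: alpha_sum_mono.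
  by rewrite /s le_eqVlt; apply/orP; left; apply/eqP; field; rewrite gt_eqF.
have h2 : (1 / 2 + l / 1000) / n%:R * k.+1%:R <= 1 / 2 + l / 1000.
  rewrite mulrAC ler_pdivrMr//; apply: ler_wpM2l; last by rewrite ler_nat.
  by move: (l0); lra.
have h3 : s * (2 * r) = 60 * l by rewrite /s; field; rewrite gt_eqF.
rewrite h3 /Cphi; move: (l10); lra.
Qed.

Hypotheses (hmuA : 5 <= mu * A n) (hbmu : b <= 5 / 32 * mu * r).

Let AK := A n.
Let AKp : 0 < AK.
Proof. by rewrite -(pmulr_rgt0 _ mu0); move: hmuA; rewrite -/AK; lra. Qed.

Let s2 := 20 * l / (AK * r ^+ 2).
Let s2p : 0 < s2. Proof. by rewrite divr_gt0 ?mulr_gt0 ?exprn_gt0. Qed.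

Definition stage_mixed k w := sstm_mixed f xs AK (A k) (yk k w) (zk k w).
Let Psi2 k w v := sstm_mixed f xs AK (A k + al k) (ny k w v) (nz k w v).

Let mPsi2 k : (k < n)%N ->
  measurable_fun [set: TF k * TH k] (fun p : TF k * TH k => Psi2 k p.1 p.2).
Proof. by move=> kn; apply: measurable_sstm_mixed; [exact: mny|exact: mnz]. Qed.

Let pw k := sstm_weight AK (A k).
(** A sequence whose increments dominate [mixed_drift]: telescoped cubes for b^2 p^2 / 3, multiples
    of A_k for the terms linear in al, and al b <= 2 r / n for the squared bias. *)
Let cost k := 2 / 9 * b ^+ 2 * (pw 0 ^+ 3 - pw k ^+ 3)
  + (b ^+ 2 * AK / (4 * mu) + r ^+ 2 / 225) * A k
  + 77 / 25 * AK * r ^+ 2 / n%:R ^+ 2 * k%:R.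
Let Cmix k := s2 * cost k + l / n%:R / 400 * k%:R.

Let ASle k : (k < n)%N -> A k + al k <= AK.
Proof. by move=> kn; rewrite -AS; exact: alpha_sum_mono. Qed.

Lemma mixed_drift_le_cost k : (k < n)%N ->
  mixed_drift mu r (A k) (al k) b AK <= cost k.+1 - cost k.
Proof.
move=> kn; rewrite /mixed_drift /cost /pw AS -[k.+1%:R]natr1.
have w0 : 0 <= sstm_weight AK (A k + al k).
  by have := ASle kn; have := AKp; rewrite /sstm_weight; lra.
have h1 := weight_cube_decrease (ltW (al0 k)) w0.
have h2 := ler_wpM2l (sqr_ge0 b) h1.
have h3 : (al k * b) ^+ 2 <= (2 * r / n%:R) ^+ 2.
  by apply: sqr_mono (halb kn); rewrite mulr_ge0 ?(ltW (al0 k)).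
have h4 : 77 / 100 * AK * (al k * b) ^+ 2 <= 77 / 25 * AK * r ^+ 2 / n%:R ^+ 2.
  have -> : 77 / 25 * AK * r ^+ 2 / n%:R ^+ 2 = 77 / 100 * AK * (2 * r / n%:R) ^+ 2.
    by field; rewrite gt_eqF.
  by apply: ler_wpM2l h3; rewrite !mulr_ge0 ?invr_ge0 ?(ltW AKp).
have [U UE] : exists U, U = b ^+ 2 * AK / (4 * mu) by exists (b ^+ 2 * AK / (4 * mu)).
have [W WE] : exists W, W = 77 / 25 * AK * r ^+ 2 / n%:R ^+ 2.
  by exists (77 / 25 * AK * r ^+ 2 / n%:R ^+ 2).
rewrite -WE in h4 *; rewrite -UE.
move: (sstm_weight AK (A k + al k)) (sstm_weight AK (A k)) (sstm_weight AK (A 0)) h2 => p p' p0 h2.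
move: h4 h2; lra.
Qed.

Lemma stage_mixed_moment k w : (k < n)%N -> stage_good k w ->
  (\int[P]_v (expR (s2 * (Psi2 k w v - stage_mixed k w)))%:E
     <= (expR (Cmix k.+1 - Cmix k))%:E)%E.
Proof.
move=> kn g; have [yb zb Vb] := stage_good_ball g.
have mb := mean_bias (xq k w) kn.
have [gi _ gv] := hbv kn (xq k w).
have /andP[sk0 sks] := hsk kn.
pose v := mixed_dir f xs (A k) (al k) (yk k w) (zk k w)
  (mean_vec P (est k (xq k w))) AK.
pose h := mixed_curv (A k) (al k) AK.
have h0 : 0 <= h by exact: mixed_curv_ge0 (ASle kn).
have hh : h <= 77 / 100 * AK * al k ^+ 2 by exact: mixed_curv_le (ASle kn).
have hv : enorm v <= 301 / 100 * AK * r * al k.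
  by apply: (mixed_dir_le r0 l10 (A0 k) (al0 k) yb zb b0 (halb720 kn) mb (ASle kn)).
have ddrift := mixed_drift_le_cost kn.
apply: (exp_step_moment (mest1 _ kn) gi gv sk0 sks (lamp kn) _ (ltW s2p) h0 hv
  (D := mixed_drift mu r (A k) (al k) b AK)).
- apply: (mean_le_half_clip rho0 L0 fmin smooth gradbound r0 rrho l10 ha (A0 k)
    (al0 k) _ (start k w) yb zb Vb (halb720 kn) (hlam kn) mb).
  exact: alpha_sqr_le.
- exact: (mixed_moment_bounded r0 l10 (al0 k) (hlam kn) AKp hh).
- by apply: measurable_funB => //; apply: msection; exact: mPsi2.
- move=> u; rewrite /stage_mixed /Psi2.
  apply: (mixed_step rho0 L0 mu0 fmin smooth gradbound strconv r0 rrho l10 ha (A0 k)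
    (al0 k) _ (start k w) yb zb Vb (est k (xq k w) u) b0 (lamp kn) (hlam kn) mb (ASle kn)).
  exact: alpha_sqr_le.
- have := mixed_moment_exponent r0 l10 (al0 k) np (hlam kn) (hsg kn) AKp h0 hh.
  have := ler_wpM2l (ltW s2p) ddrift.
  rewrite /Cmix -/s2 -[k.+1%:R]natr1; lra.
Qed.

(** The value (AK^2 - AK / (4 mu)) (mu r^2 / 4), which the final process exceeds if the gap exceeds
    mu r^2 / 4. *)
Let thr := AK * r ^+ 2 * (mu * AK / 4 - 1 / 16).

(** At the rate [s2] the margin 7 AK r^2 / 100 of [mixed_margin] is worth 7 l / 5, and the noise
    costs only l / 400. *)
Lemma stage_mixed_tail :
  (P (stage_good n `&` [set w | thr < stage_mixed n w]%R) <= (expR (- l))%:E)%E.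
Proof.
(* The tail bound tests the next value on the previous event, so it is applied at n - 1, and the
   event at n is contained in that one. *)
have [m nm] : exists m, n = m.+1 by exists n.-1; rewrite prednK.
have kn : (m < n)%N by rewrite nm.
have C00 : Cmix 0 = 0.
  by rewrite /Cmix /cost alpha_sum0 subrr !mulr0 !addr0 mulr0.
have ark : s2 * (AK * r ^+ 2) = 20 * l.
  by rewrite /s2; field; do ?[apply/andP; split]; rewrite gt_eqF.
have start0 w : stage_good 0 w -> s2 * stage_mixed 0 w <= 15 * l.
  move=> g.
  have -> : stage_mixed 0 w = 3 / 4 * AK * enorm (X0 w - xs) ^+ 2.
    rewrite /stage_mixed /sstm_mixed /sstm_cross /sstm_weight /sstm_potential.
    rewrite alpha_sum0 scale0r mul0r add0r subr0 /=.
    have -> v : dot (0 : 'rV[R]_d) v = 0 by rewrite -(scale0r v) dotZl mul0r.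
    by field.
  have h2 : enorm (X0 w - xs) ^+ 2 <= r ^+ 2 by apply: sqr_mono; rewrite ?enorm_ge0.
  have h3 : 3 / 4 * AK * enorm (X0 w - xs) ^+ 2 <= 3 / 4 * AK * r ^+ 2.
    by apply: ler_wpM2l h2; rewrite !mulr_ge0 ?invr_ge0 ?(ltW AKp).
  have := ler_wpM2l (ltW s2p) h3; lra.
have mg k' : (k' <= n)%N -> (F k').-sigma.-measurable (stage_good k').
  exact: measurable_stage_good.
have gd k' : stage_good k'.+1 `<=` stage_good k' by move=> w [].
have mp k' : (k' <= n)%N -> measurable_fun [set: TF k'] (stage_mixed k' : TF k' -> R).
  by move=> kn'; have [my mz] := mit kn'; exact: measurable_sstm_mixed.
have PS k' w : (k' < n)%N -> stage_mixed k'.+1 w = Psi2 k' w w.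
  by move=> _; rewrite /stage_mixed /Psi2 sstm_iterateS AS.
have tail := exp_supermartingale_tail Fm Hm FT HT FI HI indep mg gd mp mPsi2 PS
  C00 start0 stage_mixed_moment thr kn (ltW s2p).
rewrite -nm in tail.
have mT : measurable [set w | thr < stage_mixed n w].
  apply: measurable_lt_set => //; apply: (measurable_fun_sigma_sub (@Fm n)).
  exact: mp.
have mG k' : (k' <= n)%N -> measurable (stage_good k').
  by move=> kn'; apply: (sigma_sub_measurable (@Fm k')); exact: mg.
apply: (@le_trans _ _ (P (stage_good m `&` [set w | thr < stage_mixed n w]%R))).
  apply: le_measure; rewrite ?inE; [| |by rewrite nm => w [/gd]].
  - by apply: measurableI => //; exact: mG.
  - by apply: measurableI => //; apply: mG; exact: ltnW.
apply: le_trans tail _; rewrite lee_fin ler_expR.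
have margin := mixed_margin r0 mu0 AKp b0 hmuA hbA hbmu.
have pw0 : pw 0 = 3 / 2 * AK by rewrite /pw /sstm_weight alpha_sum0; field.
have pwn : pw n = AK by rewrite /pw /sstm_weight -/AK; field.
have nr : 77 / 25 * AK * r ^+ 2 / n%:R ^+ 2 * n%:R <= AK * r ^+ 2 / 4000.
  have -> : 77 / 25 * AK * r ^+ 2 / n%:R ^+ 2 * n%:R =
    AK * r ^+ 2 * (77 / 25 / n%:R) by field; rewrite gt_eqF.
  apply: ler_wpM2l; first by rewrite mulr_ge0 ?sqr_ge0 ?(ltW AKp).
  by rewrite ler_pdivrMr//; move: hln (l10); lra.
have cn : cost n <= 19 / 36 * b ^+ 2 * AK ^+ 3 + b ^+ 2 * AK / (4 * mu) * AK
    + AK * r ^+ 2 / 225 + AK * r ^+ 2 / 4000.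
  by rewrite /cost pw0 pwn -/AK; move: nr; lra.
have h1 := ler_wpM2l (ltW s2p) cn.
have h2 := ler_wpM2l (ltW s2p) margin.
have h3 : l / n%:R / 400 * n%:R = l / 400 by field; rewrite gt_eqF.
rewrite /Cmix h3 -/thr in h2 *.
by move: h1 h2 ark (l10); lra.
Qed.

(** At k = n the cross term is harmless: with Y and U the distances of y and z to xs, Y U / 2 <= U^2
    / 2 + Y^2 / 8, where the first part cancels against the potential and Y^2 <= 2 (f y - f xs) / mu
    by quadratic growth. *)
Lemma gap_gt_mixed w : stage_good n w ->
  mu * r ^+ 2 / 4 < f (yk n w) - f xs -> thr < stage_mixed n w.
Proof.
move=> g; have [yb zb _] := stage_good_ball g.
set Fy := f _ - f xs => hF.
have qg : mu / 2 * enorm (yk n w - xs) ^+ 2 <= Fy.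
  apply: (quadratic_growth rho0 fmin gradbound strconv).
  by rewrite /eball/=; apply: le_trans yb _; move: rrho (r0); lra.
rewrite /stage_mixed /sstm_mixed /sstm_potential /sstm_cross -/AK -/Fy.
have -> : sstm_weight AK AK = AK by rewrite /sstm_weight; field.
rewrite dotZl; have := dot_le (yk n w - xs) (zk n w - xs).
set Y := enorm (yk n w - xs) in qg *; set U := enorm (zk n w - xs) => hd.
have e1 : AK * dot (yk n w - xs) (zk n w - xs) <= AK * (Y * U).
  by apply: ler_wpM2l => //; exact: ltW.
have e2 : 0 <= AK * (U - Y / 2) ^+ 2 by rewrite mulr_ge0 ?sqr_ge0 ?(ltW AKp).
have im : 0 < mu^-1 by rewrite invr_gt0.
have e3 : AK * (Y ^+ 2 / 8) <= AK * (Fy * mu^-1 / 4).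
  apply: ler_wpM2l; first exact: ltW.
  have -> : Y ^+ 2 / 8 = mu / 2 * Y ^+ 2 * mu^-1 / 4 by field; rewrite gt_eqF.
  have := ler_wpM2r (ltW im) qg; lra.
have c0 : 0 < AK - mu^-1 / 4.
  rewrite subr_gt0 ltr_pdivrMr// -(ltr_pM2l mu0) divff ?gt_eqF//.
  by move: hmuA; rewrite -/AK; lra.
have e4 : AK * (AK - mu^-1 / 4) * (mu * r ^+ 2 / 4) < AK * (AK - mu^-1 / 4) * Fy.
  by rewrite ltr_pM2l// mulr_gt0.
have e5 : AK * (AK - mu^-1 / 4) * (mu * r ^+ 2 / 4) = thr.
  by rewrite /thr; field; rewrite gt_eqF.
move: e1 e2 e3 e4; rewrite e5; lra.
Qed.

Definition stage_success : set T :=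
  stage_good n `&` [set w | f (yk n w) - f xs <= mu * r ^+ 2 / 4].

Lemma measurable_stage_good_T k : (k <= n)%N -> measurable (stage_good k).
Proof.
by move=> kn; apply: (sigma_sub_measurable (@Fm k)); exact: measurable_stage_good.
Qed.

Lemma measurable_gap : measurable [set w | f (yk n w) - f xs <= mu * r ^+ 2 / 4].
Proof.
apply: measurable_le_set => //; apply: measurable_funB => //.
apply: measurable_continuous_comp => // i.
by apply: (measurable_fun_sigma_sub (@Fm n)); have [my _] := mit (leqnn n); exact: my.
Qed.

(** Union bound over the first iteration at which [stage_phi] exceeds 2 r. *)
Lemma stage_good_prob k : (k <= n)%N ->
  (P (stage_good 0 `\` stage_good k) <= (k%:R * expR (- l))%R%:E)%E.
Proof.
elim: k => [_|k IH kn]; first by rewrite setDv measure0 mul0r.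
have mk := measurable_stage_good_T (ltnW kn).
have mS := measurable_stage_good_T kn.
have m0 := measurable_stage_good_T (leq0n n).
have mlt : measurable [set w | 2 * r < stage_phi k.+1 w].
  apply: measurable_lt_set => //; apply: (measurable_fun_sigma_sub (@Fm k.+1)).
  by have [my mz] := mit kn; exact: measurable_sstm_phi.
apply: (@le_trans _ _ (P ((stage_good 0 `\` stage_good k) `|`
    (stage_good k `&` [set w | 2 * r < stage_phi k.+1 w]%R)))).
  apply: le_measure; rewrite ?inE.
  - exact: measurableD.
  - by apply: measurableU; [exact: measurableD|exact: measurableI].
  - move=> w [w0 wS]; have [wk|wk] := pselect (stage_good k w); last by left.
    right; split => //=; rewrite ltNge; apply/negP => h; apply: wS.
    by split.
apply: le_trans (measureU2 _ _ _) _.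
- exact: measurableD.
- exact: measurableI.
have -> : (k.+1%:R * expR (- l))%:E = ((k%:R * expR (- l))%:E + (expR (- l))%:E)%E.
  by rewrite -EFinD -[k.+1%:R]natr1 mulrDl mul1r.
by apply: leeD; [exact/IH/ltnW|exact: stage_phi_tail].
Qed.

Lemma stage_success_prob :
  (P (stage_good 0 `\` stage_success) <= (n.+1%:R * expR (- l))%R%:E)%E.
Proof.
have mn := measurable_stage_good_T (leqnn n).
have m0 := measurable_stage_good_T (leq0n n).
have mlt : measurable [set w | thr < stage_mixed n w].
  apply: measurable_lt_set => //; apply: (measurable_fun_sigma_sub (@Fm n)).
  by have [my mz] := mit (leqnn n); exact: measurable_sstm_mixed.
have mg := measurable_gap.
apply: (@le_trans _ _ (P ((stage_good 0 `\` stage_good n) `|`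
    (stage_good n `&` [set w | thr < stage_mixed n w]%R)))).
  apply: le_measure; rewrite ?inE.
  - by apply: measurableD => //; exact: measurableI.
  - by apply: measurableU; [exact: measurableD|exact: measurableI].
  - move=> w [w0 wS]; have [wn|wn] := pselect (stage_good n w); last by left.
    right; split => //=; apply: gap_gt_mixed => //.
    by rewrite ltNge; apply/negP => h; apply: wS; split.
apply: le_trans (measureU2 _ _ _) _.
- exact: measurableD.
- exact: measurableI.
have -> : (n.+1%:R * expR (- l))%:E = ((n%:R * expR (- l))%:E + (expR (- l))%:E)%E.
  by rewrite -EFinD -[n.+1%:R]natr1 mulrDl mul1r.
by apply: leeD; [exact: stage_good_prob|exact: stage_mixed_tail].
Qed.

End StageTail.

(** * Stage parameters *)

Section LogBounds.
Context {R : realType}.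
Implicit Types x c : R.

Lemma expR1_ge : 5 / 2 <= expR 1 :> R.
Proof.
have -> : 1 = 8%:R * (1 / 8) :> R by lra.
rewrite expRM_natl; apply: (@le_trans _ _ ((1 + 1 / 8) ^+ 8)); first by lra.
by rewrite lerXn2r ?nnegrE ?expR_ge0 ?expR_ge1Dx//; lra.
Qed.

Lemma ln_ge_nat (m : nat) x : 3 ^+ m <= x -> m%:R <= ln x.
Proof.
move=> h; have x0 : 0 < x by apply: lt_le_trans h; exact: exprn_gt0.
rewrite -ler_expR lnK//; apply: le_trans h.
by rewrite -[m%:R]mulr1 expRM_natl lerXn2r ?nnegrE ?expR_ge0 ?expR1_le3.
Qed.

(** The tangent of the logarithm at 15, with ln 15 <= 3. *)
Lemma ln_le_shift x : 0 < x -> ln x <= 2 + x / 15.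
Proof.
move=> x0; have x15 : 0 < x / 15 by rewrite divr_gt0.
have -> : x = 15 * (x / 15) by field.
rewrite [ln _]lnM ?posrE//.
have h1 : ln 15 <= 3 :> R.
  rewrite -ler_expR lnK ?posrE//.
  have -> : 3 = 3%:R * 1 :> R by rewrite mulr1.
  rewrite expRM_natl; apply: (@le_trans _ _ ((5 / 2) ^+ 3)); first by lra.
  by rewrite lerXn2r ?nnegrE ?expR_ge0 ?expR1_ge//; lra.
have h2 : ln (1 + (x / 15 - 1)) <= x / 15 - 1 by apply: le_ln1Dx; lra.
have e : 1 + (x / 15 - 1) = x / 15 by lra.
rewrite e in h2; lra.
Qed.

End LogBounds.

(** * What the choice of K_t and a_t guarantees *)

Section StageParameters.
Context {R : realType}.
Variables (L mu delta r b sg : R) (tau n : nat).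
Hypotheses (L0 : 0 < L) (mu0 : 0 < mu) (muL : mu <= L) (r0 : 0 < r).
Hypotheses (d0 : 0 < delta) (d1 : delta <= 1) (tau1 : (1 <= tau)%N).
Hypotheses (b0 : 0 <= b) (sg0 : 0 <= sg).

Let w := Num.sqrt (L / mu).
Let w1 : 1 <= w.
Proof.
have h : 1 <= L / mu by rewrite ler_pdivlMr// mul1r.
have h0 : 0 <= L / mu by apply: le_trans h.
by rewrite -(@sqrtr1 R) /w ler_sqrt.
Qed.
Let w0 : 0 < w. Proof. by apply: lt_le_trans w1. Qed.
Let w2 : w ^+ 2 = L / mu. Proof. by rewrite sqr_sqrtr// divr_ge0 ?ltW. Qed.
Let tau0 : 1 <= tau%:R :> R. Proof. by rewrite ler1n. Qed.

Let e := mu * r ^+ 2 / 4.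
Let e0 : 0 < e. Proof. by rewrite divr_gt0 ?mulr_gt0 ?exprn_gt0. Qed.

Lemma sqrt_radius_eps : Num.sqrt (L * r ^+ 2 / e) = 2 * w.
Proof.
have -> : L * r ^+ 2 / e = (2 * w) ^+ 2.
  by rewrite exprMn w2 /e; field; apply/andP; split; rewrite gt_eqF.
by rewrite sqrtr_sqr gtr0_norm// mulr_gt0.
Qed.

Lemma sqrt_radius : Num.sqrt (L * r ^+ 2) = 2 * w * Num.sqrt e.
Proof.
have -> : L * r ^+ 2 = (2 * w) ^+ 2 * e.
  by rewrite exprMn w2 /e; field; rewrite gt_eqF.
by rewrite sqrtrM ?sqr_ge0// sqrtr_sqr gtr0_norm// mulr_gt0.
Qed.

Let q := (5400 * (4 * sg / (mu * r))) ^+ 2.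

(** Substituting epsilon_t = mu r^2 / 4 shows that the first entry depends on sqrt (L / mu) only,
    and is the same in all stages. *)
Lemma iterationsE :
  Num.max (2160 * Num.sqrt (L * r ^+ 2 / e) *
       ln (4320 * Num.sqrt (L * r ^+ 2) * tau%:R / (Num.sqrt e * delta)))
    (4 * (5400 * sg * r / e) ^+ 2 *
       ln (8 * tau%:R / delta * (5400 * sg * r / e) ^+ 2)) =
  Num.max (2160 * (2 * w) * ln (4320 * (2 * w * tau%:R / delta)))
    (4 * q * ln (8 * tau%:R / delta * q)).
Proof.
rewrite sqrt_radius_eps sqrt_radius.
have se : Num.sqrt e != 0 by rewrite gt_eqF ?sqrtr_gt0.
have -> : 4320 * (2 * w * Num.sqrt e) * tau%:R / (Num.sqrt e * delta) =
    4320 * (2 * w * tau%:R / delta).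
  rewrite -!mulrA; congr (_ * _).
  by field; apply/andP; split=> //; rewrite gt_eqF.
have -> : 5400 * sg * r / e = 5400 * (4 * sg / (mu * r)).
  rewrite -!mulrA; congr (_ * _).
  by rewrite /e; field; apply/andP; split; rewrite gt_eqF.
by [].
Qed.

Let X := ln (4320 * (2 * w * tau%:R / delta)).
Hypothesis hn1 : 2160 * (2 * w) * X <= n%:R.
Hypothesis hn2 : 4 * q * ln (8 * tau%:R / delta * q) <= n%:R.

Let l := ln (4 * n%:R * tau%:R / delta).

Let td : 1 <= tau%:R / delta.
Proof. by rewrite ler_pdivlMr// mul1r (le_trans d1). Qed.

Let X8 : 8 <= X.
Proof.
apply: (@ln_ge_nat _ 8).
have h : 2 * 1 <= 2 * w * tau%:R / delta.
  rewrite -!mulrA ler_pM2l//.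
  apply: (@le_trans _ _ (1 * 1)); first by rewrite mulr1.
  by apply: ler_pM.
apply: (@le_trans _ _ (4320 * 2)); first by lra.
apply: ler_wpM2l; first by lra.
by rewrite mulr1 in h.
Qed.

Lemma iterations_large : 2160 * 16 <= n%:R :> R.
Proof.
apply: le_trans hn1; rewrite -mulrA; apply: ler_wpM2l; first by lra.
have : 8 * 1 <= X * w by apply: ler_pM.
by lra.
Qed.
Let np : 0 < n%:R :> R.
Proof. by apply: lt_le_trans iterations_large; lra. Qed.

(** The logarithm l contains n itself. With y = n / (2160 w), l = X + ln y, where the lower bound on
    n gives X <= y / 2 and ln y <= y, so l <= 3 y / 2; and 2160 * 2 / 3 = 1440. *)
Lemma log_le_iterations : 1440 * (w * l) <= n%:R.
Proof.
have [c [cE c0]] : exists c : R, c = 2160 /\ 0 < c by exists 2160; split; [reflexivity|lra].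
have cw0 : 0 < c * w by exact: mulr_gt0.
have y0 : 0 < n%:R / (c * w) by exact: divr_gt0.
have td0 : 0 < tau%:R / delta by apply: lt_le_trans td.
have wtd : 0 < w * (tau%:R / delta) by exact: mulr_gt0.
have XE : X = ln (4 * c * (w * (tau%:R / delta))).
  by rewrite /X; congr ln; rewrite -[2 * w * _ / _]mulrA cE; lra.
have lE : l = X + ln (n%:R / (c * w)).
  have z0 : 0 < 4 * c * (w * (tau%:R / delta)).
    by apply: mulr_gt0 => //; apply: mulr_gt0.
  rewrite /l XE -lnM ?posrE//.
  by congr ln; field; do ?[apply/andP; split]; rewrite gt_eqF.
have nE : n%:R = c * w * (n%:R / (c * w)) by field; apply/andP; split; rewrite gt_eqF.
have h1 : X <= n%:R / (c * w) / 2.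
  have h : 2 * (c * w) * X <= c * w * (n%:R / (c * w)).
    by rewrite -nE cE; move: hn1; lra.
  by rewrite -(ler_pM2l cw0); lra.
have h2 : ln (n%:R / (c * w)) <= n%:R / (c * w) by exact/ltW/ln_sublinear.
move: (n%:R / (c * w)) nE lE h1 h2 => y nE lE h1 h2.
have h3 : l <= 3 / 2 * y by lra.
have := ler_wpM2l (ltW cw0) h3; rewrite nE cE; lra.
Qed.

Lemma log_ge10 : 10 <= l.
Proof.
apply: (@ln_ge_nat _ 10).
have h := iterations_large.
have h1 : 4 * n%:R * 1 <= 4 * n%:R * (tau%:R / delta) by rewrite ler_pM2l ?mulr_gt0.
rewrite -mulrA; apply: le_trans h1.
by lra.
Qed.

Let l0 : 0 < l. Proof. by apply: lt_le_trans log_ge10; lra. Qed.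

Lemma log_le_iterations1 : 1440 * l <= n%:R.
Proof.
apply: le_trans log_le_iterations.
apply: ler_wpM2l; first by lra.
by rewrite ler_peMl// ltW.
Qed.

(** As in [log_le_iterations], with u = n / (2 q): l = ln (8 tau q / delta) + ln u, where the first
    part is at most u / 2 and the second at most 2 + u / 15. For u >= 16 the sum is at most 18 u /
    25. *)
Lemma variance_le_iterations : 25 / 9 * q * l <= n%:R.
Proof.
have q0 : 0 <= q by exact: sqr_ge0.
move: (q) q0 (hn2) => q' q0 hn2'.
have [->|qn] := eqVneq q' 0; first by rewrite mulr0 mul0r ltW.
have qp : 0 < q' by rewrite lt_def qn.
have td0 : 0 < tau%:R / delta by apply: lt_le_trans td.
have lE : l = ln (8 * tau%:R / delta * q') + ln (n%:R / (2 * q')).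
  have z1 : 0 < 8 * tau%:R / delta * q'.
    by rewrite -(mulrA 8) mulr_gt0// mulr_gt0.
  have z2 : 0 < n%:R / (2 * q') by rewrite divr_gt0 ?mulr_gt0.
  rewrite /l -lnM ?posrE//.
  congr ln.
  by field; apply/andP; split; rewrite gt_eqF.
set u := n%:R / (2 * q') in lE.
have nE : n%:R = 2 * q' * u by rewrite /u; field; rewrite gt_eqF.
have u0 : 0 < u by rewrite divr_gt0 ?mulr_gt0.
have h1 : ln (8 * tau%:R / delta * q') <= u / 2.
  have := hn2'; rewrite nE => h.
  by rewrite -(ler_pM2l qp); lra.
(* If u were smaller, n >= 2160 * 16 would force q >= 1080; then the first logarithm is at least 8,
   although it is at most u / 2 < 8. *)
have u16 : 16 <= u.
  rewrite leNgt; apply/negP => ul.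
  have q1 : 1080 <= q'.
    have h := iterations_large; rewrite nE in h.
    have : q' * u <= q' * 16 by rewrite ler_pM2l// ltW.
    lra.
  have h8 : 8 <= ln (8 * tau%:R / delta * q').
    apply: (@ln_ge_nat _ 8).
    have : 8 * 1 * 1080 <= 8 * (tau%:R / delta) * q'.
      apply: ler_pM; [lra|lra| |exact: q1].
      by apply: ler_wpM2l; [lra|exact: td].
    by rewrite -(mulrA 8); lra.
  lra.
have h2 := ln_le_shift u0.
rewrite nE lE.
have h3 : ln (8 * tau%:R / delta * q') + ln u <= 18 / 25 * u by lra.
have := ler_wpM2l (ltW qp) h3; lra.
Qed.

Local Notation N := (n%:R : R).
Let ld := ln (4 * N / delta).
Let a := Num.max (972 * 100 * l ^+ 2)
   (Num.max (1800 * sg * n.+1%:R * Num.sqrt N * Num.sqrt l / (L * r))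
     (Num.max (4 * b * n.+2%:R ^+ 2 / (15 * L * r))
              (60 * b * n.+2%:R * ld / (L * r)))).

Let n1E : n.+1%:R = N + 1. Proof. by rewrite -natr1. Qed.
Let n2E : n.+2%:R = N + 2. Proof. by rewrite -addn2 natrD. Qed.
Let Lr0 : 0 < L * r. Proof. exact: mulr_gt0. Qed.

Lemma stepparam_ge_log : (310 * l) ^+ 2 <= a.
Proof.
apply: (@le_trans _ _ (972 * 100 * l ^+ 2)); last by rewrite /a le_max lexx.
by have := sqr_ge0 l; lra.
Qed.

Let a0 : 0 < a.
Proof.
apply: lt_le_trans stepparam_ge_log; apply: exprn_gt0.
by apply: mulr_gt0; [lra|exact: l0].
Qed.

Let a_sg : 1800 * sg * (N + 1) * Num.sqrt N * Num.sqrt l <= a * (L * r).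
Proof.
rewrite -ler_pdivrMr// /a n1E !le_max; apply/orP; right; apply/orP; left.
exact: lexx.
Qed.

Let a_b : 4 * b * (N + 2) ^+ 2 <= 15 * (a * L * r).
Proof.
have h : 4 * b * (N + 2) ^+ 2 / (15 * L * r) <= a.
  rewrite /a n2E !le_max; apply/orP; right; apply/orP; right; apply/orP; left.
  exact: lexx.
move: h; rewrite ler_pdivrMr; last by rewrite !mulr_gt0.
by lra.
Qed.

Let aL0 : 0 < a * L. Proof. exact: mulr_gt0. Qed.

Let alpha_le k : (k < n)%N -> alpha a L k.+1 * (2 * (a * L)) <= N + 1.
Proof.
move=> kn; rewrite alphaE divfK; last by rewrite gt_eqF// mulr_gt0.
by rewrite -n1E ler_nat.
Qed.

Lemma alpha_bias_le k : (k < n)%N -> alpha a L k.+1 * b <= 2 * r / N.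
Proof.
move=> kn; rewrite ler_pdivlMr//.
have h := ler_wpM2r b0 (alpha_le kn).
have h1 : 4 * (b * (N * (N + 1))) <= 15 * (a * L * r).
  apply: le_trans a_b; rewrite -(mulrA 4); apply: ler_wpM2l; first by [].
  by apply: ler_wpM2l => //; move: np; nra.
have h2 := ler_wpM2r (ltW np) h.
have aLr : 0 < a * L * r by rewrite mulr_gt0.
rewrite -(ler_pM2l aL0); lra.
Qed.

(** From the second entry of a: 60 * 60 = 2 * 1800, the 2 being that in the denominator of the step
    size. *)
Lemma alpha_variance_le k : (k < n)%N ->
  (60 * 60 * alpha a L k.+1 * sg) ^+ 2 * (N * l) <= r ^+ 2.
Proof.
move=> kn; have al := alpha_gt0 a0 L0 k.
have h : 60 * 60 * alpha a L k.+1 * sg * (Num.sqrt N * Num.sqrt l) <= r.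
  rewrite -(ler_pM2l aL0).
  have ss : 0 <= sg * (Num.sqrt N * Num.sqrt l) by rewrite !mulr_ge0 ?sqrtr_ge0.
  have := ler_wpM2r ss (alpha_le kn).
  by move: a_sg; lra.
have h0 : 0 <= 60 * 60 * alpha a L k.+1 * sg * (Num.sqrt N * Num.sqrt l).
  apply: mulr_ge0; last by rewrite mulr_ge0 ?sqrtr_ge0.
  by apply: mulr_ge0 => //; apply: mulr_ge0; [lra|exact: ltW].
have := sqr_mono h0 h.
by rewrite exprMn (exprMn _ (Num.sqrt _)) !sqr_sqrtr ?(ltW np) ?(ltW l0).
Qed.

Lemma bias_alpha_sum_le : b * alpha_sum a L n <= 15 / 16 * r.
Proof.
have -> : b * alpha_sum a L n = b * (N * (N + 3)) / (4 * (a * L)).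
  by rewrite (alpha_sumE a0 L0) !mulrA.
rewrite ler_pdivrMr; last by rewrite mulr_gt0.
have : 4 * (b * (N * (N + 3))) <= 15 * (a * L * r).
  apply: le_trans a_b; rewrite -(mulrA 4); apply: ler_wpM2l; first by [].
  by apply: ler_wpM2l => //; move: np; nra.
lra.
Qed.

Hypothesis hb : b <= 5 / 32 * mu * r.

Let LE : L = mu * w ^+ 2. Proof. by rewrite w2 mulrC divfK// gt_eqF. Qed.

(** Equivalent to mu A_n >= 5, checked for each entry of a: the logarithm by [log_le_iterations]
    (972 * 100 * 20 <= 1440^2), the variance by [variance_le_iterations], and the two bias entries
    by b <= 5/32 mu r. *)
Lemma stepparam_le : a * (20 * L) <= mu * (N * (N + 3)).
Proof.
have NN : 0 < N ^+ 2 by rewrite exprn_gt0.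
have muN : 0 < mu * N by rewrite mulr_gt0.
have n20 : 20 <= N by apply: le_trans iterations_large; lra.
have L20 : 0 < 20 * L by rewrite mulr_gt0.
rewrite -ler_pdivlMr// /a !ge_max !ler_pdivlMr//.
apply/and4P; split.
- have h : (1440 * (w * l)) ^+ 2 <= N ^+ 2.
    apply: sqr_mono log_le_iterations.
    by apply: mulr_ge0; [lra|rewrite mulr_ge0 ?(ltW w0) ?(ltW l0)].
  have h2 := ler_wpM2l (ltW mu0) h.
  have h3 : 0 <= mu * (w ^+ 2 * l ^+ 2) by rewrite !mulr_ge0 ?(ltW mu0) ?(ltW w0) ?(ltW l0).
  rewrite LE; lra.
- set h := sg / (mu * r).
  have h0 : 0 <= h by rewrite divr_ge0// mulr_ge0 ?(ltW mu0) ?(ltW r0).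
  have sgE : sg = h * (mu * r) by rewrite divfK// gt_eqF// mulr_gt0.
  (* 360 * 100 = 20 * 1800, while q = (216 * 100 * h)^2; the ratio 5/3 squared is the factor 25/9 of
     [variance_le_iterations]. *)
  have key : 360 * 100 * h * Num.sqrt l <= Num.sqrt N.
    have v := variance_le_iterations.
    have -> : 360 * 100 * h * Num.sqrt l =
        Num.sqrt ((360 * 100 * h * Num.sqrt l) ^+ 2).
      rewrite sqrtr_sqr ger0_norm; first by [].
      apply: mulr_ge0; last exact: sqrtr_ge0.
      by apply: mulr_ge0; [lra|exact: h0].
    rewrite ler_sqrt ?(ltW np)// exprMn sqr_sqrtr ?(ltW l0)//.
    have qE : q = (5400 * (4 * h)) ^+ 2 by rewrite /q -mulrA.
    by move: v; rewrite qE; lra.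
  rewrite n1E.
  have -> : 1800 * sg * (N + 1) * Num.sqrt N * Num.sqrt l / (L * r) * (20 * L) =
      360 * 100 * h * Num.sqrt l * (mu * Num.sqrt N * (N + 1)).
    rewrite sgE.
    have -> : 1800 * (h * (mu * r)) * (N + 1) * Num.sqrt N * Num.sqrt l / (L * r)
      * (20 * L) = 1800 * 20 * (h * mu * (N + 1) * Num.sqrt N * Num.sqrt l)
      * (r * L / (L * r)) by ring.
    rewrite (mulrC r) divff ?gt_eqF//; ring.
  have msN : 0 <= mu * Num.sqrt N * (N + 1).
    by rewrite !mulr_ge0 ?sqrtr_ge0 ?(ltW mu0)//; lra.
  apply: le_trans (ler_wpM2r msN key) _.
  have -> : Num.sqrt N * (mu * Num.sqrt N * (N + 1)) =
      mu * (Num.sqrt N ^+ 2 * (N + 1)) by ring.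
  rewrite sqr_sqrtr ?(ltW np)//; lra.
- rewrite n2E.
  have -> : 4 * b * (N + 2) ^+ 2 / (15 * L * r) * (20 * L) =
      16 / 3 * (N + 2) ^+ 2 * (b / r).
    by field; apply/andP; split; rewrite gt_eqF.
  have br : b / r <= 5 / 32 * mu by rewrite ler_pdivrMr.
  have c0 : 0 <= 16 / 3 * (N + 2) ^+ 2.
    by apply: mulr_ge0; [lra|exact: sqr_ge0].
  apply: le_trans (ler_wpM2l c0 br) _.
  have : (N + 2) ^+ 2 * 5 <= 6 * (N * (N + 3)) by nra.
  by move=> /(ler_wpM2l (ltW mu0)); lra.
- rewrite n2E.
  have -> : 60 * b * (N + 2) * ld / (L * r) * (20 * L) =
      1200 * (N + 2) * (ld * (b / r)).
    have -> : 60 * b * (N + 2) * ld / (L * r) * (20 * L) =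
      60 * 20 * (N + 2) * ld * (b * L / (L * r)) by ring.
    have -> : b * L / (L * r) = b / r by field; apply/andP; split; rewrite gt_eqF.
    ring.
  have br : b / r <= 5 / 32 * mu by rewrite ler_pdivrMr.
  have br0 : 0 <= b / r by rewrite divr_ge0// ltW.
  (* The last entry of a has a logarithm without tau; it is smaller because tau >= 1. *)
  have ldl : ld <= l.
    have nd : 0 < 4 * N / delta by rewrite divr_gt0 ?mulr_gt0.
    rewrite /ld /l ler_ln ?posrE//; last first.
      by rewrite divr_gt0// mulr_gt0 ?mulr_gt0// (lt_le_trans _ tau0).
    rewrite ler_pM2r ?invr_gt0// ler_peMr ?mulr_ge0 ?(ltW np)//.
  have h1 : ld * (b / r) <= l * (5 / 32 * mu).
    apply: (@le_trans _ _ (l * (b / r))); first by rewrite ler_wpM2r.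
    by rewrite ler_wpM2l// ltW.
  have c0 : 0 <= 1200 * (N + 2) by apply: mulr_ge0; lra.
  apply: le_trans (ler_wpM2l c0 h1) _.
  have h2 := ler_wpM2l (ltW muN) log_le_iterations1.
  have h3 := ler_wpM2l (ltW mu0) log_le_iterations1.
  have : 0 < mu * N ^+ 2 by rewrite mulr_gt0.
  have : 0 < mu * l by rewrite mulr_gt0.
  lra.
Qed.

Lemma mu_alpha_sum_ge : 5 <= mu * alpha_sum a L n.
Proof.
have -> : mu * alpha_sum a L n = mu * (N * (N + 3)) / (4 * (a * L)).
  by rewrite (alpha_sumE a0 L0) !mulrA.
rewrite ler_pdivlMr; last by rewrite mulr_gt0.
by have := stepparam_le; lra.
Qed.

End StageParameters.

(** * Restarts *)

Section OracleFiltration.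
Context {R : realType} {d : nat}.
Context dT (T : measurableType dT) (P : probability T R).
Context dS (S : measurableType dS).
Variable G : borel R d -> S -> borel R d.
Hypothesis hG : measurable_fun [set: borel R d * S] (fun p => G p.1 p.2).
Variables (N : nat -> nat -> nat)
  (agg : forall t k : nat, (N t k).-tuple (borel R d) -> borel R d).
Hypothesis hagg :
  forall t k, measurable_fun [set: (N t k).-tuple (borel R d)] (@agg t k).
Variables (xi : nat * nat * nat -> {RV P >-> S}) (tau : nat) (K : nat -> nat).
Let X (i : nat * nat * nat) : T -> S := xi i.
Let Idx : set (nat * nat * nat) := [set i | [/\ (1 <= i.1.1 <= tau)%N,
  (i.1.2 < K i.1.1)%N & (i.2 < N i.1.1 i.1.2)%N]].
Hypothesis hindep : mutually_independent P Idx X.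
Variable est : nat -> nat -> 'rV[R]_d -> T -> 'rV[R]_d.
Hypothesis hest : forall t k x w,
  est t k x w = agg [tuple G x (xi (t, k, val j) w) | j < N t k].

Let mX i : measurable_fun [set: T] (X i). Proof. exact: measurable_funP. Qed.

(** Lexicographic order on (stage, iteration): the past of a stage contains all earlier stages, so
    its random starting point is measurable at iteration 0. *)
Definition past_samples t k : set (nat * nat * nat) :=
  Idx `&` [set i | (i.1.1 < t)%N \/ i.1.1 = t /\ (i.1.2 < k)%N].

Definition stage_samples t k : set (nat * nat * nat) :=
  Idx `&` [set i | i.1 = (t, k)].

Definition past_events t k := cylinders X (past_samples t k).
Definition sample_events t k := cylinders X (stage_samples t k).

Lemma cylinders_mono (J1 J2 : set (nat * nat * nat)) : J1 `<=` J2 ->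
  cylinders X J1 `<=` cylinders X J2.
Proof.
by move=> J12 _ [s [B [us h mB ->]]]; exists s, B; split => // i /h/J12.
Qed.

Lemma past_events_mono t k : past_events t k `<=` past_events t k.+1.
Proof.
apply: cylinders_mono => i [Ii [h|[h1 h2]]]; split => //; [by left|right].
by split => //; apply: leq_trans h2 _.
Qed.

Lemma past_events_stage t k : past_events t k `<=` past_events t.+1 0.
Proof.
apply: cylinders_mono => i [Ii [h|[h1 _]]]; split => //; left.
  exact: ltnW.
by rewrite /= h1.
Qed.

Lemma sample_events_past t k : sample_events t k `<=` past_events t k.+1.
Proof.
by apply: cylinders_mono => -[[t' k'] j] [Ii /= [<- <-]]; split => //; right.
Qed.

Lemma past_sample_indep t k A B : past_events t k A -> sample_events t k B ->
  P (A `&` B) = (P A * P B)%E.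
Proof.
apply: (cylinders_indep hindep) => [i []//|i []//|[[t' k'] j] [_ /= h] [_ /= [e1 e2]]].
by move: h; rewrite e1 e2 ltnn => -[//|[_]]; rewrite ltnn.
Qed.

Lemma measurable_estimator t k : (1 <= t <= tau)%N -> (k < K t)%N ->
  measurable_fun [set: borel R d * g_sigma_algebraType (sample_events t k)]
    (fun p : borel R d * g_sigma_algebraType (sample_events t k) =>
       est t k p.1 p.2 : borel R d).
Proof.
move=> ht hk; under eq_fun do rewrite hest.
apply: (measurableT_comp (@hagg t k)); apply/measurable_fun_tnthP => j.
rewrite (_ : _ \o _ = fun p : borel R d * g_sigma_algebraType (sample_events t k) =>
  G p.1 (xi (t, k, val j) p.2)); last first.
  by apply/funext => p /=; rewrite tnth_mktuple.
apply: (measurableT_comp (f := fun p => G p.1 p.2) hG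
  (g := fun p : borel R d * g_sigma_algebraType (sample_events t k) =>
     (p.1, xi (t, k, val j) p.2))).
apply: measurable_fun_pair; first exact: measurable_fst.
apply: (measurableT_comp (f := X (t, k, val j) :
  g_sigma_algebraType (sample_events t k) -> S)); last exact: measurable_snd.
apply: measurable_cylinders => //; split => //=.
by split => //=.
Qed.

Variables (a : nat -> R) (L : R) (lam : nat -> nat -> R) (x0 : 'rV[R]_d).

Definition stage_output t w :=
  R_clipped_SSTM K a L lam (fun t k x => est t k x w) x0 t.

Lemma vmeasurable_stage_output t : (t <= tau)%N ->
  vmeasurable (stage_output t : g_sigma_algebraType (past_events t.+1 0) -> 'rV[R]_d).
Proof.
elim: t => [_|t IH tt].
  by move=> i; exact: measurable_cst.
have [my _] := vmeasurable_iterate (F := past_events t.+1)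
  (H := sample_events t.+1) (a t.+1) L (lam t.+1) (@past_events_mono t.+1)
  (@sample_events_past t.+1) (IH (ltnW tt))
  (fun k kn => measurable_estimator (t := t.+1) tt kn) (leqnn (K t.+1)).
apply: (vmeasurable_sigma_mono (@past_events_stage t.+1 (K t.+1))).
exact: my.
Qed.

End OracleFiltration.

Section StageRadius.
Context {R : realType}.
Variable Rad : R.
Hypothesis Rad0 : 0 < Rad.

Lemma stage_radius_gt0 t : 0 < stage_radius Rad t.
Proof. by rewrite divr_gt0// powR_gt0. Qed.

Lemma stage_radius_sqr t : stage_radius Rad t ^+ 2 = Rad ^+ 2 / 2 ^+ t.
Proof.
rewrite /stage_radius expr_div_n; congr (_ / _).
by rewrite -powR_mulrn ?powR_ge0// -powRrM divfK// powR_mulrn.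
Qed.

Lemma stage_radiusS t : stage_radius Rad t ^+ 2 / 2 = stage_radius Rad t.+1 ^+ 2.
Proof. by rewrite !stage_radius_sqr [2 ^+ t.+1]exprSr invfM mulrA. Qed.

Lemma stage_radius_le t : stage_radius Rad t <= Rad.
Proof.
rewrite ler_pdivrMr ?powR_gt0// ler_peMr ?(ltW Rad0)//.
by rewrite -[leLHS](powRr0 2) ler_powR ?ler1n// divr_ge0.
Qed.

(** Converts the assumed bias bound, which decays like 2^-t, into one proportional to the stage
    radius. *)
Lemma stage_radius_ge t : Rad / 2 ^+ t <= stage_radius Rad t.
Proof.
rewrite -ler_sqr ?nnegrE ?(ltW (stage_radius_gt0 _))//; last first.
  by rewrite divr_ge0 ?exprn_ge0// ltW.
rewrite stage_radius_sqr expr_div_n ler_pM2l ?exprn_gt0//.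
rewrite lef_pV2 ?posrE ?exprn_gt0// ler_eXnr//.
by rewrite exprn_ege1// ler1n.
Qed.

End StageRadius.

(** * Chaining the stages *)

Section Restarts.
Context {R : realType} {d : nat}.
Variables (f : 'rV[R]_d -> R) (xs x0 : 'rV[R]_d) (Rad L mu delta : R).
Hypothesis hd : (0 < d)%N.
Hypotheses (Rad0 : 0 < Rad) (hx0 : enorm (x0 - xs) <= Rad).
Hypotheses (L0 : 0 < L) (mu0 : 0 < mu).
Hypothesis fcont : continuous f.
Hypothesis fmin : forall x, f xs <= f x.
Hypothesis smooth : forall x y, eball xs (3 * Rad) x -> eball xs (3 * Rad) y ->
  enorm (grad f x - grad f y) <= L * enorm (x - y).
Hypothesis gradbound : forall x, eball xs (3 * Rad) x ->
  enorm (grad f x) ^+ 2 <= 2 * L * (f x - inf (f @` eball xs (3 * Rad))).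
Hypothesis strconv : forall x y, eball xs (3 * Rad) x -> eball xs (3 * Rad) y ->
  f x + dot (grad f x) (y - x) + mu / 2 * enorm (x - y) ^+ 2 <= f y.
Hypotheses (d0 : 0 < delta) (d1 : delta <= 1).
Variable tau : nat.
Hypothesis tau1 : (1 <= tau)%N.

Context dT (T : measurableType dT) (P : probability T R).
Context dS (S : measurableType dS).
Variable G : borel R d -> S -> borel R d.
Hypothesis hG : measurable_fun [set: borel R d * S] (fun p => G p.1 p.2).
Variables (N : nat -> nat -> nat)
  (agg : forall t k : nat, (N t k).-tuple (borel R d) -> borel R d).
Hypothesis hagg :
  forall t k, measurable_fun [set: (N t k).-tuple (borel R d)] (@agg t k).
Variables (xi : nat * nat * nat -> {RV P >-> S}) (K : nat -> nat).
Hypothesis hindep : mutually_independent P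
  [set i : nat * nat * nat | [/\ (1 <= i.1.1 <= tau)%N, (i.1.2 < K i.1.1)%N
     & (i.2 < N i.1.1 i.1.2)%N]] (fun i => xi i : T -> S).
Variable est : nat -> nat -> 'rV[R]_d -> T -> 'rV[R]_d.
Hypothesis hest : forall t k x w,
  est t k x w = agg [tuple G x (xi (t, k, val j) w) | j < N t k].
Variables b sigma : nat -> nat -> R.
Hypothesis hsigma : forall t k, (1 <= t <= tau)%N -> (k < K t)%N -> 0 <= sigma t k.
Hypothesis hbv : forall t k, (1 <= t <= tau)%N -> (k < K t)%N ->
  bias_variance P f (est t k) (b t k) (sigma t k).
Hypothesis hb : forall t k, (1 <= t <= tau)%N -> (k < K t)%N ->
  b t k <= 15 * mu * Rad / (24 * 2 ^+ t.+1).
Variables bmax smax : nat -> R.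
Hypothesis hbmax : forall t, bmax t = \big[Num.max/0]_(k < K t) b t k.
Hypothesis hsmax : forall t, smax t = \big[Num.max/0]_(k < K t) sigma t k.
Variables (a : nat -> R) (lam : nat -> nat -> R).
Hypothesis hK : forall t, (1 <= t <= tau)%N ->
  (K t)%:Z = Num.ceil (stage_iterations L mu Rad delta tau t (smax t)).
Hypothesis ha : forall t, (1 <= t <= tau)%N ->
  a t = stage_stepparam L Rad delta tau t (K t) (bmax t) (smax t).
Hypothesis hlam : forall t k, (1 <= t <= tau)%N -> (k < K t)%N ->
  lam t k = stage_clip L Rad delta tau t (K t) (a t) k.

Local Notation out := (stage_output K est a L lam x0).
Local Notation past := (past_events N xi tau K).
Local Notation now := (sample_events N xi tau K).
Local Notation r t := (stage_radius Rad t.-1).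
Local Notation l t := (ln (4 * (K t)%:R * tau%:R / delta)).

Let muL : mu <= L.
Proof.
have h3 : 0 < 3 * Rad by rewrite mulr_gt0.
exact: (mu_le_L (ltW h3) fmin smooth gradbound strconv hd h3).
Qed.

Let r0 t : 0 < r t. Proof. exact: stage_radius_gt0. Qed.

Lemma bmax_ge0 t : 0 <= bmax t.
Proof. by rewrite hbmax; exact: bigmax_ge_id. Qed.

Lemma smax_ge0 t : 0 <= smax t.
Proof. by rewrite hsmax; exact: bigmax_ge_id. Qed.

Let kap := Num.sqrt (L / mu).

Lemma stage_length_ge t : (1 <= t <= tau)%N ->
  Num.max (2160 * (2 * kap) * ln (4320 * (2 * kap * tau%:R / delta)))
    (4 * (5400 * (4 * smax t / (mu * r t))) ^+ 2 *
       ln (8 * tau%:R / delta * (5400 * (4 * smax t / (mu * r t))) ^+ 2))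
  <= (K t)%:R.
Proof.
move=> ht; rewrite -(iterationsE (smax t) tau L0 mu0 muL (r0 t) d0).
have := ceil_ge (stage_iterations L mu Rad delta tau t (smax t)).
by rewrite -hK.
Qed.

Let hn1 t : (1 <= t <= tau)%N ->
  2160 * (2 * kap) * ln (4320 * (2 * kap * tau%:R / delta)) <= (K t)%:R.
Proof. by move=> /stage_length_ge; rewrite ge_max => /andP[]. Qed.

Let hn2 t : (1 <= t <= tau)%N ->
  4 * (5400 * (4 * smax t / (mu * r t))) ^+ 2 *
    ln (8 * tau%:R / delta * (5400 * (4 * smax t / (mu * r t))) ^+ 2)
  <= (K t)%:R.
Proof. by move=> /stage_length_ge; rewrite ge_max => /andP[]. Qed.

Let hbm t : (1 <= t <= tau)%N -> bmax t <= 5 / 32 * mu * r t.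
Proof.
move=> ht; rewrite hbmax; apply: bigmax_le => [|k _].
  by rewrite mulr_ge0 ?(ltW (r0 t))// mulr_ge0 ?(ltW mu0).
apply: le_trans (hb ht (ltn_ord k)) _.
have rg := stage_radius_ge Rad0 t.-1.
(* 15 / (24 * 4) = 5/32, where 4 comes from t + 1 = (t - 1) + 2. *)
have -> : 15 * mu * Rad / (24 * 2 ^+ t.+1) = 5 / 32 * mu * (Rad / 2 ^+ t.-1).
  have -> : t.+1 = (t.-1 + 2)%N by case/andP: ht; case: (t) => // m _ _; rewrite addn2.
  by rewrite exprD; field; rewrite expf_neq0.
by rewrite ler_wpM2l// mulr_ge0 ?(ltW mu0).
Qed.

Let l10 t : (1 <= t <= tau)%N -> 10 <= l t.
Proof. by move=> ht; apply: (log_ge10 mu0 muL d0 d1 tau1 (hn1 ht)). Qed.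

Let ha310 t : (1 <= t <= tau)%N -> (310 * l t) ^+ 2 <= a t.
Proof. by move=> ht; rewrite ha//; exact: stepparam_ge_log. Qed.

Let a0 t : (1 <= t <= tau)%N -> 0 < a t.
Proof.
move=> ht; apply: lt_le_trans (ha310 ht); apply: exprn_gt0.
by have := l10 ht; lra.
Qed.

Let K0 t : (1 <= t <= tau)%N -> (0 < K t)%N.
Proof.
move=> ht; rewrite -(ltr0n R); apply: lt_le_trans (iterations_large mu0 muL d0 d1 tau1 (hn1 ht)).
by lra.
Qed.

Let pastm t k : past t k `<=` measurable.
Proof. by apply: cylinders_measurable => i; exact: measurable_funP. Qed.

Let nowm t k : now t k `<=` measurable.
Proof. by apply: cylinders_measurable => i; exact: measurable_funP. Qed.

Let mout t : (1 <= t <= tau)%N ->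
  vmeasurable (out t.-1 : g_sigma_algebraType (past t 0) -> 'rV[R]_d).
Proof.
case: t => [//|t /= tt].
exact: (vmeasurable_stage_output hG hagg hest a L lam x0 (ltnW tt)).
Qed.

Definition stage_start t := [set v | enorm (out t.-1 v - xs) <= r t].

Definition stage_succeeds t := stage_success f xs L mu (a t) (lam t) (K t)
  (out t.-1) (est t) (r t).

Lemma stage_succeeds_prob t : (1 <= t <= tau)%N ->
  (P (stage_start t `\` stage_succeeds t) <= (delta / (2 * tau%:R))%:E)%E.
Proof.
move=> ht.
have Kp : 0 < (K t)%:R :> R by rewrite ltr0n K0.
have h3 : 0 <= 3 * Rad by rewrite mulr_ge0 ?(ltW Rad0).
have rR : 3 * r t <= 3 * Rad by rewrite ler_pM2l// stage_radius_le.
have aE := ha ht; rewrite /stage_stepparam in aE.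
have lt0 : 0 < l t by have := l10 ht; lra.
have := @stage_success_prob R d f xs (3 * Rad) L mu h3 L0 mu0 fmin smooth gradbound
  strconv fcont dT T P (past t) (now t) (@pastm t) (@nowm t) _ _ _ _
  (@past_sample_indep R dT T P dS S N xi tau K hindep t) (@past_events_mono R dT T P dS S N xi tau K t)
  (@sample_events_past R dT T P dS S N xi tau K t) (a t) (lam t) (K t) (out t.-1) (est t)
  (mout ht) (fun k kn => measurable_estimator hG hagg hest ht kn)
  (b t) (sigma t) (bmax t) (smax t) (fun k kn => hbv ht kn) _ _
  (r t) (l t) (r0 t) rR (l10 ht) (ha310 ht) (K0 ht)
  (log_le_iterations1 mu0 muL d0 d1 tau1 (hn1 ht)) (bmax_ge0 t) _ _ _ _ _ (hbm ht).
move=> h; apply: le_trans (h _ _ _ _ _ _ _ _ _ _ _) _ => {h}.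
- by move=> k; exact: cylindersT.
- by move=> k; exact: cylindersT.
- by move=> k; exact: cylindersI.
- by move=> k; exact: cylindersI.
- by move=> k kn; rewrite hbmax; exact: (le_bigmax 0 (fun i : 'I__ => b t i) (Ordinal kn)).
- move=> k kn; rewrite hsigma//= hsmax.
  exact: (le_bigmax 0 (fun i : 'I__ => sigma t i) (Ordinal kn)).
- move=> k kn; rewrite hlam// /stage_clip.
  have al := alpha_gt0 (a0 ht) L0 k.
  by field; apply/andP; split; rewrite gt_eqF.
- move=> k kn; rewrite aE.
  exact: (alpha_bias_le (smax t) L0 mu0 muL (r0 t) d0 d1 tau1 (bmax_ge0 t) (hn1 ht)).
- move=> k kn; rewrite aE.
  exact: (alpha_variance_le (bmax t) L0 mu0 muL (r0 t) d0 d1 tau1 (smax_ge0 t) (hn1 ht)).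
- rewrite aE.
  exact: (bias_alpha_sum_le (smax t) L0 mu0 muL (r0 t) d0 d1 tau1 (bmax_ge0 t) (hn1 ht)).
- rewrite aE.
  exact: (mu_alpha_sum_ge L0 mu0 muL (r0 t) d0 d1 tau1 (bmax_ge0 t) (smax_ge0 t)
    (hn1 ht) (hn2 ht) (hbm ht)).
have tp : 0 < tau%:R :> R by rewrite ltr0n.
rewrite lee_fin expRN lnK ?posrE; last by rewrite divr_gt0// !mulr_gt0.
rewrite -[(K t).+1%:R]natr1 invf_div.
have K1 : 1 <= (K t)%:R :> R by rewrite ler1n K0.
have -> : delta / (2 * tau%:R) = (2 * (K t)%:R) * (delta / (4 * (K t)%:R * tau%:R)).
  by field; apply/andP; split; rewrite gt_eqF.
apply: ler_wpM2r; last by move: K1; lra.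
by rewrite divr_ge0 ?(ltW d0)// !mulr_ge0 ?(ltW Kp) ?(ltW tp).
Qed.

Fixpoint all_succeed t : set T :=
  if t is t'.+1 then all_succeed t' `&` stage_succeeds t else setT.

Lemma all_succeed_start t w : (t <= tau)%N -> all_succeed t w ->
  enorm (out t w - xs) <= stage_radius Rad t.
Proof.
case: t => [_ _|t tt [_ [g h]]]; first by rewrite /stage_radius mul0r powRr0 divr1.
have ht : (1 <= t.+1 <= tau)%N by [].
have h3 : 0 <= 3 * Rad by rewrite mulr_ge0 ?(ltW Rad0).
have [yb _ _] := stage_good_ball L0 fmin (r0 t.+1) (l10 ht) (ha310 ht) g.
have yQ : eball xs (3 * Rad) (out t.+1 w).
  apply: le_trans yb _; have := stage_radius_le Rad0 t; have := Rad0.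
  by rewrite /=; lra.
have q := quadratic_growth h3 fmin gradbound strconv yQ.
have h' : f (out t.+1 w) - f xs <= mu * r t.+1 ^+ 2 / 4 := h.
rewrite -ler_sqr ?nnegrE ?enorm_ge0 ?(ltW (stage_radius_gt0 Rad0 _))//.
rewrite -stage_radiusS -(ler_pM2l mu0).
by move: (le_trans q h') => /=; lra.
Qed.

Lemma all_succeed_stage s t w : (1 <= s <= t)%N -> all_succeed t w ->
  stage_succeeds s w.
Proof.
elim: t => [|t IH /andP[s1]]; first by case: s.
rewrite leq_eqVlt => /orP[/eqP -> []//|st [h _]].
by apply: IH => //; rewrite s1.
Qed.

Let mgood t k : (1 <= t <= tau)%N -> (k <= K t)%N ->
  measurable (stage_good f xs L (a t) (lam t) (out t.-1) (est t) (r t) k).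
Proof.
move=> ht kn; exact: (measurable_stage_good_T L0 fmin fcont (@pastm t)
  (@past_events_mono R dT T P dS S N xi tau K t)
  (@sample_events_past R dT T P dS S N xi tau K t) (lam t) (mout ht)
  (fun k kn => measurable_estimator hG hagg hest ht kn) (r t) (l10 ht) (ha310 ht) kn).
Qed.

Let msucc t : (1 <= t <= tau)%N -> measurable (stage_succeeds t).
Proof.
move=> ht; rewrite /stage_succeeds /stage_success; apply: measurableI; first exact: mgood.
exact: (measurable_gap xs L mu fcont (@pastm t)
  (@past_events_mono R dT T P dS S N xi tau K t)
  (@sample_events_past R dT T P dS S N xi tau K t) (a t) (lam t) (mout ht)
  (fun k kn => measurable_estimator hG hagg hest ht kn) (r t)).
Qed.

Lemma measurable_all_succeed t : (t <= tau)%N -> measurable (all_succeed t).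
Proof.
elim: t => [_|t IH tt]; first exact: measurableT.
by apply: measurableI; [exact/IH/ltnW|exact: msucc].
Qed.

Lemma all_succeed_probC t : (t <= tau)%N ->
  (P (~` all_succeed t) <= (t%:R * (delta / (2 * tau%:R)))%:E)%E.
Proof.
elim: t => [_|t IH tt]; first by rewrite /= setCT measure0 mul0r.
have ht : (1 <= t.+1 <= tau)%N by [].
have ma := measurable_all_succeed (ltnW tt).
have ms := msucc ht; have mg := mgood ht (leq0n _).
apply: (@le_trans _ _ (P (~` all_succeed t `|`
    (stage_start t.+1 `\` stage_succeeds t.+1)))).
  apply: le_measure; rewrite ?inE.
  - by apply: measurableC; exact: measurable_all_succeed.
  - by apply: measurableU; [exact: measurableC|exact: measurableD].
  - move=> v nv; have [av|nav] := pselect (all_succeed t v); last by left.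
    right; split; first exact: (all_succeed_start (ltnW tt) av).
    by move=> sv; apply: nv.
apply: le_trans (measureU2 _ _ _) _.
- exact: measurableC.
- exact: measurableD.
rewrite -[t.+1%:R]natr1 mulrDl mul1r EFinD.
by apply: leeD; [exact/IH/ltnW|exact: stage_succeeds_prob].
Qed.

(** Both probability claims follow from the success of all stages, so the bound is stated for every
    measurable event that contains it. *)
Lemma all_succeed_prob (E : set T) : measurable E -> all_succeed tau `<=` E ->
  ((1 - delta)%:E <= P E)%E.
Proof.
move=> mE hE; have ma := measurable_all_succeed (leqnn tau).
apply: (@le_trans _ _ (P (all_succeed tau))); last by apply: le_measure; rewrite ?inE.
have := all_succeed_probC (leqnn tau); rewrite probability_setC//.
have -> : tau%:R * (delta / (2 * tau%:R)) = delta / 2.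
  by field; rewrite pnatr_eq0 -lt0n.
rewrite -[P _]fineK ?fin_num_measure// -EFinB !lee_fin => h.
by move: h (d0); lra.
Qed.

Local Notation state t k w :=
  (stage_state K a L lam (fun s j x => est s j x w) x0 t k).

Let stateS t k v : sstm_x (state t k.+1 v) =
  sstm_query (alpha_sum (a t) L k) (alpha (a t) L k.+1)
    (sstm_y (state t k v)) (sstm_z (state t k v)).
Proof. by rewrite /stage_state clipped_SSTM_S. Qed.

Lemma measurable_stage_state t k : (1 <= t <= tau)%N -> (k <= K t)%N ->
  [/\ vmeasurable (fun w => sstm_x (state t k w)),
      vmeasurable (fun w => sstm_y (state t k w)) &
      vmeasurable (fun w => sstm_z (state t k w))].
Proof.
move=> ht kn.
have myz k' : (k' <= K t)%N -> vmeasurable (fun w => sstm_y (state t k' w)) /\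
    vmeasurable (fun w => sstm_z (state t k' w)).
  move=> kn'.
  have [my mz] := vmeasurable_iterate (F := past t) (H := now t) (a t) L (lam t)
    (@past_events_mono R dT T P dS S N xi tau K t)
    (@sample_events_past R dT T P dS S N xi tau K t) (mout ht)
    (fun k kn => measurable_estimator hG hagg hest ht kn) kn'.
  by split=> i; apply: (measurable_fun_sigma_sub (@pastm t k')); [exact: my|exact: mz].
have [my mz] := myz _ kn; split=> //.
case: k kn {my mz} => [kn|k kn]; first by have [] := myz 0%N isT.
have [my mz] := myz k (ltnW kn).
under eq_fun do rewrite stateS.
exact: (vmeasurable_query (alpha_sum (a t) L k) (alpha (a t) L k.+1) my mz).
Qed.

Lemma stage_ball_prob :
  ((1 - delta)%:E <= P [set w | forall t k, (1 <= t <= tau)%N -> (k <= K t)%N ->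
     let s := state t k w in
     let ball := eball xs (2 * stage_radius Rad t.-1)%R in
     [/\ ball (sstm_x s), ball (sstm_y s) & ball (sstm_z s)]])%E.
Proof.
apply: all_succeed_prob; last first.
  move=> v av t k ht kn.
  have [g _] : stage_succeeds t v by exact: all_succeed_stage av.
  have hball k' : (k' <= K t)%N -> enorm (sstm_y (state t k' v) - xs) <= 2 * r t /\
      enorm (sstm_z (state t k' v) - xs) <= 2 * r t.
    move=> kn'; have := stage_good_ball L0 fmin (r0 t) (l10 ht) (ha310 ht)
      (stage_good_mono kn' g).
    by case.
  have [yb zb] := hball k kn; split => //.
  (* The point x is not tracked by the potential: initially it is the starting point, afterwards a
     query formed from the previous y and z. *)
  case: k kn {yb zb} => [kn|k kn]; first by have [] := hball 0%N isT.
  have [yb zb] := hball k (ltnW kn).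
  have := query_ball (alpha_sum_ge0 (a0 ht) L0 k) (alpha_gt0 (a0 ht) L0 k) yb zb.
  by rewrite -stateS.
pose E t k := [set v | (1 <= t <= tau)%N -> (k <= K t)%N ->
  [/\ eball xs (2 * r t) (sstm_x (state t k v)),
      eball xs (2 * r t) (sstm_y (state t k v)) &
      eball xs (2 * r t) (sstm_z (state t k v))]].
(* Measurability: a countable intersection, in which index pairs outside the schedule contribute the
   full space. *)
rewrite (_ : mkset _ = \bigcap_t \bigcap_k E t k); last first.
  by apply/seteqP; split => v h; [move=> t _ k _; exact: h|move=> t k; exact: (h t I k I)].
apply: bigcap_measurableType => // t _; apply: bigcap_measurableType => // k _.
have [/andP[ht kn]|no] := boolP ((1 <= t <= tau)%N && (k <= K t)%N); last first.
  rewrite (_ : E t k = setT) //; apply/seteqP; split=> // v _ ht kn.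
  by move: no; rewrite ht kn.
have [mx my mz] := measurable_stage_state ht kn.
rewrite (_ : E t k = [set v | eball xs (2 * r t) (sstm_x (state t k v))] `&`
  [set v | eball xs (2 * r t) (sstm_y (state t k v))] `&`
  [set v | eball xs (2 * r t) (sstm_z (state t k v))]).
  by apply: measurableI; [apply: measurableI|]; exact: measurable_eball.
by apply/seteqP; split=> v; [case/(_ ht kn)|case=> -[? ?] ? _ _].
Qed.

Lemma final_gap_prob eps : mu * r tau ^+ 2 / 4 <= eps ->
  ((1 - delta)%:E <= P [set v | (f (out tau v) - f xs <= eps)%R])%E.
Proof.
move=> he; have ht : (1 <= tau <= tau)%N by rewrite tau1 leqnn.
apply: all_succeed_prob => [|v av].
  have [_ my _] := measurable_stage_state ht (leqnn (K tau)).
  apply: measurable_le_set => //; apply: measurable_funB => //.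
  case: tau tau1 my => // m _ my.
  exact: measurable_continuous_comp.
have [_ h] : stage_succeeds tau v by exact: all_succeed_stage av.
apply: le_trans he.
by case: tau tau1 h.
Qed.

End Restarts.

(** * Iteration complexity *)

Section Complexity.
Context {R : realType}.
Variables (L mu Rad delta eps : R) (tau : nat) (K : nat -> nat) (smax : nat -> R) (sig : R).
Hypotheses (mu0 : 0 < mu) (muL : mu <= L) (Rad0 : 0 < Rad).
Hypotheses (d0 : 0 < delta) (d1 : delta <= 1) (eps0 : 0 < eps).
Hypothesis htau : tau%:Z = Num.ceil (log2 (mu * Rad ^+ 2 / (2 * eps))).
Hypothesis tau1 : (1 <= tau)%N.
Hypothesis smax0 : forall t, 0 <= smax t.
Hypothesis hsig : sig = \big[Num.max/0]_(1 <= t < tau.+1) smax t.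
Hypothesis hK : forall t, (1 <= t <= tau)%N ->
  (K t)%:Z = Num.ceil (stage_iterations L mu Rad delta tau t (smax t)).

Let w := Num.sqrt (L / mu).
Let M := ln (mu * Rad ^+ 2 / eps).

Let L0 : 0 < L. Proof. exact: lt_le_trans muL. Qed.

Let w1 : 1 <= w.
Proof.
by rewrite -[leLHS]sqrtr1 ler_sqrt ?divr_ge0 ?(ltW L0) ?(ltW mu0)// ler_pdivlMr// mul1r.
Qed.

Let ln2_ge : 1 / 2 <= ln 2 :> R.
Proof.
rewrite -ler_expR lnK ?posrE// -ler_sqr ?nnegrE ?expR_ge0//.
rewrite -expRM_natr divfK//; apply: le_trans expR1_le3 _; lra.
Qed.

Let W0 : 0 < mu * Rad ^+ 2 / eps.
Proof. by rewrite divr_gt0 ?mulr_gt0 ?exprn_gt0. Qed.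

Let log2E : log2 (mu * Rad ^+ 2 / (2 * eps)) = M / ln 2 - 1.
Proof.
have l2 : 0 < ln 2 :> R by apply: lt_le_trans ln2_ge; lra.
rewrite /log2 /M.
have -> : mu * Rad ^+ 2 / (2 * eps) = (mu * Rad ^+ 2 / eps) / 2.
  by rewrite invfM mulrA [RHS]mulrAC.
by rewrite ln_div ?posrE//; field; rewrite gt_eqF.
Qed.

Let ln2p : 0 < ln 2 :> R. Proof. by apply: lt_le_trans ln2_ge; lra. Qed.

Let tau_lt : tau%:R * ln 2 < M.
Proof.
rewrite -ltr_pdivlMr//.
have := ceilB1_lt (log2 (mu * Rad ^+ 2 / (2 * eps))).
by rewrite -htau log2E intrB ltrD2r.
Qed.

Let tau_ge : M <= (tau%:R + 1) * ln 2.
Proof.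
rewrite -ler_pdivrMr// -lerBlDr.
have := ceil_ge (log2 (mu * Rad ^+ 2 / (2 * eps))).
by rewrite -htau log2E.
Qed.

(** The left side is mu Rad^2 / 2^(tau + 1), and the ceiling gives tau + 1 >= log2 (mu Rad^2 /
    eps). *)
Lemma final_gap_le : mu * stage_radius Rad tau.-1 ^+ 2 / 4 <= eps.
Proof.
rewrite stage_radius_sqr.
have -> : mu * (Rad ^+ 2 / 2 ^+ tau.-1) / 4 = mu * Rad ^+ 2 / eps / 2 ^+ tau.+1 * eps.
  have -> : tau.+1 = (tau.-1 + 2)%N by case: (tau) tau1 => // m _; rewrite addn2.
  by rewrite exprD; field; apply/andP; split; rewrite ?expf_neq0// gt_eqF.
rewrite ler_piMl ?(ltW eps0)// ler_pdivrMr ?exprn_gt0// mul1r.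
rewrite -ler_ln ?posrE ?exprn_gt0// lnXn// -[ln 2 *+ _]mulr_natl -[tau.+1%:R]natr1.
exact: tau_ge.
Qed.

Lemma stage_count_le : tau%:R <= 2 * M.
Proof.
have : tau%:R * (1 / 2) <= tau%:R * ln 2 :> R by exact: ler_wpM2l.
have := ltW tau_lt; lra.
Qed.

(** The other side of the ceiling: tau exceeds log2 (mu Rad^2 / (2 eps)) by less than 1. It caps the
    geometric sum of the variance terms. *)
Lemma pow2_stage_le : 2 ^+ tau <= mu * Rad ^+ 2 / eps.
Proof.
rewrite -ler_ln ?posrE ?exprn_gt0// lnXn// -[ln 2 *+ _]mulr_natl.
exact: ltW.
Qed.

Let M1 : 1 / 2 <= M.
Proof.
have t1 : 1 <= tau%:R :> R by rewrite ler1n.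
by have := stage_count_le; lra.
Qed.
Let M0 : 0 < M. Proof. by apply: lt_le_trans M1; lra. Qed.

(* 216 * 100 = 4 * 5400, the factor 4 coming from epsilon_t = mu R_{t-1}^2 / 4. *)
Let c : R := (216 * 100) ^+ 2.
Let c0 : 0 < c. Proof. by apply: exprn_gt0; lra. Qed.
Let q t := (5400 * (4 * smax t / (mu * stage_radius Rad t.-1))) ^+ 2.
Let s := sig ^+ 2 / (mu * eps).

Let qE t : q t = c * (smax t ^+ 2 / (mu ^+ 2 * Rad ^+ 2) * 2 ^+ t.-1).
Proof.
have r0 := stage_radius_gt0 Rad0 t.-1.
have -> : q t = c * (smax t ^+ 2 / (mu ^+ 2 * stage_radius Rad t.-1 ^+ 2)).
  by rewrite /q /c; field; apply/andP; split; rewrite gt_eqF.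
rewrite stage_radius_sqr; field.
by do ?[apply/andP; split]; rewrite ?expf_neq0// gt_eqF.
Qed.

Let smax_le t : (1 <= t <= tau)%N -> smax t <= sig.
Proof.
by move=> ht; rewrite hsig; apply: le_bigmax_seq => //; rewrite mem_index_iota.
Qed.

Let q_le t : (1 <= t <= tau)%N -> q t <= c * (sig ^+ 2 / (mu ^+ 2 * Rad ^+ 2) * 2 ^+ t.-1).
Proof.
move=> ht; rewrite qE; apply: ler_wpM2l; first exact: ltW.
rewrite ler_pM2r ?exprn_gt0// ler_pM2r ?invr_gt0 ?mulr_gt0 ?exprn_gt0//.
by apply: sqr_mono => //; exact: smax_le.
Qed.

Let sum_pow2 m : \sum_(1 <= t < m.+1) 2 ^+ t.-1 = 2 ^+ m - 1 :> R.
Proof.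
elim: m => [|m IH]; first by rewrite big_geq// subrr.
by rewrite big_nat_recr//= IH exprS; ring.
Qed.

(** The squared stage radius halves at each stage, so q t grows like 2^(t - 1); the sum is bounded
    by its value at 2^tau <= mu Rad^2 / eps, which cancels Rad. *)
Let sum_q_le : \sum_(1 <= t < tau.+1) q t <= c * s.
Proof.
apply: (@le_trans _ _ (\sum_(1 <= t < tau.+1)
    c * (sig ^+ 2 / (mu ^+ 2 * Rad ^+ 2) * 2 ^+ t.-1))).
  by apply: ler_sum_nat => t ht; exact: q_le.
rewrite -mulr_sumr -mulr_sumr sum_pow2; apply: ler_wpM2l; first exact: ltW.
have c1 : 0 <= sig ^+ 2 / (mu ^+ 2 * Rad ^+ 2) by apply: divr_ge0; [|apply: mulr_ge0]; exact: sqr_ge0.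
have h : 2 ^+ tau - 1 <= mu * Rad ^+ 2 / eps by have := pow2_stage_le; lra.
apply: le_trans (ler_wpM2l c1 h) _; rewrite le_eqVlt; apply/orP; left; apply/eqP.
by rewrite /s; field; do ?[apply/andP; split]; rewrite gt_eqF.
Qed.

Let q0 t : 0 <= q t. Proof. exact: sqr_ge0. Qed.

Let q_le_sum t : (1 <= t <= tau)%N -> q t <= c * s.
Proof.
move=> ht; apply: le_trans sum_q_le.
have hin : t \in index_iota 1 tau.+1 by rewrite mem_index_iota.
rewrite (bigD1_seq t)//= ?iota_uniq// lerDl; exact: sumr_ge0.
Qed.

Let s0 : 0 <= s. Proof. by rewrite divr_ge0 ?sqr_ge0// mulr_ge0 ?(ltW mu0) ?(ltW eps0). Qed.
Let X := ln (432 * 10 * 4 * (w / delta * M)).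
(** The logarithm can be negative for a small variance. Cutting it at 0 keeps the stage bounds
    nonnegative, and the cut is undone at the end because the first entry of the final maximum is
    nonnegative. *)
Let Y := Num.max 0 (ln (16 * c * (s / delta * M))).
Let w0 : 0 < w. Proof. by apply: lt_le_trans w1. Qed.

Let wdM : 1 / 2 <= w / delta * M.
Proof.
have wd : 1 <= w / delta by rewrite ler_pdivlMr// mul1r (le_trans d1).
by apply: le_trans M1 _; rewrite ler_peMl ?(ltW M0).
Qed.

Let X1 : 1 <= X.
Proof. by apply: (@ln_ge_nat _ 1); move: wdM; lra. Qed.

Let first_length_le :
  2160 * (2 * w) * ln (4320 * (2 * w * tau%:R / delta)) <= 432 * 10 * (w * X).
Proof.
have -> : 2160 * (2 * w) * ln (4320 * (2 * w * tau%:R / delta)) =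
    432 * 10 * (w * ln (4320 * (2 * w * tau%:R / delta))) by lra.
have wt : 0 < w * tau%:R / delta by rewrite divr_gt0 ?mulr_gt0 ?ltr0n.
have h : w * tau%:R / delta <= 2 * (w / delta * M).
  have wd : 0 <= w / delta by rewrite divr_ge0 ?ltW.
  have := ler_wpM2l wd stage_count_le; rewrite [w * _ / _]mulrAC; lra.
have -> : 2 * w * tau%:R / delta = 2 * (w * tau%:R / delta) by rewrite -!mulrA.
apply: ler_wpM2l; first by lra.
apply: ler_wpM2l; first exact: ltW.
move: wt h wdM; move: (w * tau%:R / delta) => u u0 h v; rewrite /X.
rewrite ler_ln ?posrE; lra.
Qed.

Let Y0 : 0 <= Y. Proof. by rewrite le_max lexx. Qed.

Let second_length_le t : (1 <= t <= tau)%N ->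
  4 * q t * ln (8 * tau%:R / delta * q t) <= 4 * (q t * Y).
Proof.
move=> ht; rewrite -mulrA; apply: ler_wpM2l => //.
have [->|qn] := eqVneq (q t) 0; first by rewrite !mul0r.
have qp : 0 < q t by rewrite lt_def qn q0.
apply: ler_wpM2l => //; rewrite le_max; apply/orP; right.
have td : 0 < tau%:R / delta by rewrite divr_gt0 ?ltr0n.
have z : 0 < tau%:R / delta * q t by rewrite mulr_gt0.
have di : 0 <= delta^-1 by rewrite invr_ge0 ltW.
have h : tau%:R / delta * q t <= 2 * M / delta * (c * s).
  apply: ler_pM => //; [exact: ltW|by rewrite ler_wpM2r// stage_count_le|exact: q_le_sum].
have e : 16 * c * (s / delta * M) = 8 * (2 * M / delta * (c * s)) by ring.
rewrite e -[8 * tau%:R / delta]mulrA -[8 * _ * q t]mulrA.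
have z8 : 0 < 8 * (tau%:R / delta * q t) by rewrite mulr_gt0.
have h8 : 8 * (tau%:R / delta * q t) <= 8 * (2 * M / delta * (c * s)) by rewrite ler_pM2l.
by rewrite ler_ln ?posrE//; exact: lt_le_trans h8.
Qed.

Let stage_length_le t : (1 <= t <= tau)%N ->
  (K t)%:R <= 1 + 432 * 10 * (w * X) + 4 * (q t * Y).
Proof.
move=> ht; have := ceilB1_lt (stage_iterations L mu Rad delta tau t (smax t)).
rewrite -hK// intrB /stage_iterations /stage_eps.
rewrite (iterationsE (smax t) tau L0 mu0 muL (stage_radius_gt0 Rad0 _) d0).
have h1 := first_length_le; have h2 := second_length_le ht.
have p1 : 0 <= 432 * 10 * (w * X).
  by apply: mulr_ge0; [lra|apply: mulr_ge0; [exact: ltW|move: X1; lra]].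
have p2 : 0 <= 4 * (q t * Y) by rewrite mulr_ge0// mulr_ge0.
move=> h; rewrite -addrA -lerBlDl; apply: le_trans (ltW h) _.
by rewrite ge_max; apply/andP; split; [apply: le_trans h1 _|apply: le_trans h2 _];
  rewrite ?lerDl ?lerDr.
Qed.

Lemma sum_stage_lengths_le :
  (\sum_(1 <= t < tau.+1) K t)%:R <= (100 * 100 + 4 * c) * Num.max
    (w * M * ln (432 * 10 * 4 * (w / delta * M)))
    (s * ln (16 * c * (s / delta * M))).
Proof.
set A := w * M * _; set B := s * _.
have A0 : 0 <= A.
  by apply: mulr_ge0; [apply: mulr_ge0; exact: ltW|rewrite -/X; move: X1; lra].
have sY : s * Y <= Num.max A B.
  rewrite /Y /Num.max; case: ifP => _; first by rewrite le_max lexx orbT.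
  by rewrite mulr0 le_max A0.
rewrite natr_sum; apply: (@le_trans _ _ (\sum_(1 <= t < tau.+1)
    (1 + 432 * 10 * (w * X) + 4 * (q t * Y)))).
  by apply: ler_sum_nat => t ht; exact: stage_length_le.
rewrite big_split/= -mulr_sumr -mulr_suml sumr_const_nat subn1/=.
have h1 : 4 * ((\sum_(1 <= t < tau.+1) q t) * Y) <= 4 * (c * Num.max A B).
  rewrite ler_pM2l//; apply: (@le_trans _ _ (c * s * Y)).
    exact: ler_wpM2r sum_q_le.
  by rewrite -mulrA ler_pM2l.
have h2 : (1 + 432 * 10 * (w * X)) *+ tau <= 100 * 100 * Num.max A B.
  rewrite -mulr_natl.
  have wX : 1 <= w * X by rewrite -[leLHS]mulr1; apply: ler_pM.
  have AE : A = M * (w * X) by rewrite /A -/X; ring.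
  (* The 1 lost to each ceiling is absorbed by w X >= 1, and 2 * 4321 <= 100 * 100. *)
  apply: (@le_trans _ _ (2 * M * (432 * 10 * (w * X) + (w * X)))).
    apply: ler_pM; [by []|lra|exact: stage_count_le|lra].
  have AM : A <= Num.max A B by rewrite le_max lexx.
  have : 0 <= M * (w * X) by rewrite -AE.
  move: AM; rewrite AE; lra.
move: h1 h2; lra.
Qed.

End Complexity.

Theorem theoremC4 (R : realType) :
  exists C0 C1 C2 : R, 0 < C0 /\ 0 < C1 /\ 0 < C2 /\
  forall (d : nat) (hd : (0 < d)%N)
    (* objective *)
    (f : 'rV[R]_d -> R) (xstar x0 : 'rV[R]_d) (Rad L mu eps delta : R)
    (hfdiff : forall x, differentiable f x)
    (hxstar : forall x, f xstar <= f x)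
    (hRad : 0 < Rad) (hx0 : enorm (x0 - xstar) <= Rad)
    (hL : 0 < L) (hmu : 0 < mu)
    (hsmooth : forall x y,
       eball xstar (3 * Rad) x -> eball xstar (3 * Rad) y ->
       enorm (grad f x - grad f y) <= L * enorm (x - y))
    (hgradbound : forall x, eball xstar (3 * Rad) x ->
       enorm (grad f x) ^+ 2
         <= 2 * L * (f x - inf (f @` eball xstar (3 * Rad))))
    (hstrconv : forall x y,
       eball xstar (3 * Rad) x -> eball xstar (3 * Rad) y ->
       f x + dot (grad f x) (y - x) + mu / 2 * enorm (x - y) ^+ 2 <= f y)
    (heps : 0 < eps) (hdelta0 : 0 < delta) (hdelta1 : delta <= 1)
    (tau : nat)
    (htau : tau%:Z = Num.ceil (log2 (mu * Rad ^+ 2 / (2 * eps))))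
    (htau1 : (1 <= tau)%N)
    (* probability space, stochastic oracle, aggregated estimators *)
    (dT : measure_display) (T : measurableType dT) (P : probability T R)
    (dS : measure_display) (S : measurableType dS) (D : probability S R)
    (G : borel R d -> S -> borel R d)
    (hG : measurable_fun [set: borel R d * S] (fun p => G p.1 p.2))
    (N : nat -> nat -> nat)
    (agg : forall t k : nat, (N t k).-tuple (borel R d) -> borel R d)
    (hagg : forall t k, measurable_fun [set: (N t k).-tuple (borel R d)] (@agg t k))
    (xi : nat * nat * nat -> {RV P >-> S})
    (K : nat -> nat)
    (hlaw : forall t k j, (1 <= t <= tau)%N -> (k < K t)%N -> (j < N t k)%N ->
       forall B, measurable B -> distribution P (xi (t, k, j)) B = D B)
    (hindep : mutually_independent P
       [set i : nat * nat * nat |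
          [/\ (1 <= i.1.1 <= tau)%N, (i.1.2 < K i.1.1)%N
            & (i.2 < N i.1.1 i.1.2)%N]]
       (fun i => xi i : T -> S))
    (est : nat -> nat -> 'rV[R]_d -> T -> 'rV[R]_d)
    (hest : forall t k x w,
       est t k x w = agg t k [tuple G x (xi (t, k, val j) w) | j < N t k])
    (* bias and variance *)
    (b sigma : nat -> nat -> R)
    (hsigma : forall t k, (1 <= t <= tau)%N -> (k < K t)%N -> 0 <= sigma t k)
    (hbv : forall t k, (1 <= t <= tau)%N -> (k < K t)%N ->
       bias_variance P f (est t k) (b t k) (sigma t k))
    (hb : forall t k, (1 <= t <= tau)%N -> (k < K t)%N ->
       b t k <= 15 * mu * Rad / (24 * 2 ^+ t.+1))
    (bmax smax : nat -> R) (sig : R)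
    (hbmax : forall t, bmax t = \big[Num.max/0]_(k < K t) b t k)
    (hsmax : forall t, smax t = \big[Num.max/0]_(k < K t) sigma t k)
    (hsig : sig = \big[Num.max/0]_(1 <= t < tau.+1) smax t)
    (* parameters of the method *)
    (a : nat -> R) (lam : nat -> nat -> R)
    (hK : forall t, (1 <= t <= tau)%N ->
       (K t)%:Z = Num.ceil (stage_iterations L mu Rad delta tau t (smax t)))
    (ha : forall t, (1 <= t <= tau)%N ->
       a t = stage_stepparam L Rad delta tau t (K t) (bmax t) (smax t))
    (hlam : forall t k, (1 <= t <= tau)%N -> (k < K t)%N ->
       lam t k = stage_clip L Rad delta tau t (K t) (a t) k),
  let g w t k x := est t k x w in
  [/\ ((1 - delta)%:E <=
        P [set w | (f (R_clipped_SSTM K a L lam (g w) x0 tau) - f xstar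
                      <= eps)%R])%E,
      (\sum_(1 <= t < tau.+1) K t)%:R <=
        C0 * Num.max
          (Num.sqrt (L / mu) * ln (mu * Rad ^+ 2 / eps) *
             ln (C1 * (Num.sqrt L / (Num.sqrt mu * delta) *
                         ln (mu * Rad ^+ 2 / eps))))
          (sig ^+ 2 / (mu * eps) *
             ln (C2 * (sig ^+ 2 / (mu * eps * delta) *
                         ln (mu * Rad ^+ 2 / eps))))
    & ((1 - delta)%:E <=
        P [set w | forall t k, (1 <= t <= tau)%N -> (k <= K t)%N ->
             let s := stage_state K a L lam (g w) x0 t k in
             let ball := eball xstar (2 * stage_radius Rad t.-1)%R in
             [/\ ball (sstm_x s), ball (sstm_y s) & ball (sstm_z s)]])%E].

Proof.
have c0 : 0 < (216 * 100) ^+ 2 :> R by apply: exprn_gt0; lra.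
exists (100 * 100 + 4 * (216 * 100) ^+ 2), (432 * 10 * 4), (16 * (216 * 100) ^+ 2).
move: c0; set c := (216 * 100) ^+ 2 => c0.
split; first by lra.
split; first by lra.
split; first by lra.
move=> d hd f xstar x0 Rad L mu eps delta hfdiff hxstar hRad hx0 hL hmu hsmooth
  hgradbound hstrconv heps hdelta0 hdelta1 tau htau htau1 dT T P dS S D G hG N agg
  hagg xi K _ hindep est hest b sigma hsigma hbv hb bmax smax sig hbmax hsmax
  hsig a lam hK ha hlam g.
have fcont : continuous f by move=> x; exact: differentiable_continuous.
have h3 : 0 < 3 * Rad by rewrite mulr_gt0.
have muL := mu_le_L (ltW h3) hxstar hsmooth hgradbound hstrconv hd h3.
split.
- have := final_gap_prob hd hRad hx0 hL hmu fcont hxstar hsmooth hgradbound hstrconv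
    hdelta0 hdelta1 htau1 hG hagg hindep hest hsigma hbv hb hbmax hsmax hK ha hlam
    (final_gap_le hmu hRad heps htau htau1).
  exact.
- have := sum_stage_lengths_le hmu muL hRad hdelta0 hdelta1 heps htau htau1
    (smax_ge0 hsmax) hsig hK.
  have -> : Num.sqrt L / (Num.sqrt mu * delta) = Num.sqrt (L / mu) / delta.
    by rewrite sqrtrM ?(ltW hL)// sqrtrV ?(ltW hmu)// invfM mulrA.
  have -> : sig ^+ 2 / (mu * eps * delta) = sig ^+ 2 / (mu * eps) / delta.
    by rewrite invfM mulrA.
  exact.
- exact: (stage_ball_prob hd hRad hx0 hL hmu fcont hxstar hsmooth hgradbound hstrconv
    hdelta0 hdelta1 htau1 hG hagg hindep hest hsigma hbv hb hbmax hsmax hK ha hlam).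
Qed.
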